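(* Let $K\ge h\ge 1$ be fixed integers and let $f:[0,1]^K\to\mathbb{R}$ be continuous. Consider a sequence of orthogonal arrays $H=OA(N,K,n,h)$ free of coincidence defect, with $N\to\infty$, $n\to\infty$, and index $\lambda=N/n^h$ such that either $\lambda$ is fixed or $\lambda=o(n)$. For each array let $X_1,\ldots,X_N$ be the points of the randomized orthogonal array based on $H$, and let $\hat\mu=N^{-1}\sum_{i=1}^N f(X_i)$ and $\mu=\int_{[0,1)^K}f(x)\,dx$. Then, as $N\to\infty$, $$N^{1/2}(\hat\mu-\mu)\to N\Bigl(0,\int_{[0,1)^K} r(x)^2\,dx\Bigr)$$ in distribution, where $r=f-\mu-\sum_{0<|u|\le h}f_u$ is the remainder of $f$ after removing its functional ANOVA components of order at most $h$.
   Context: Orthogonal array: an $N\times K$ matrix $H=(H_i^k)$ is an $OA(N,K,n,h)$ if its entries lie in $\{0,1,\ldots,n-1\}$ and, for any $p\le h$ columns, each of the $n^p$ combinations of values appears exactly the same number of times among the rows. It is free of coincidence defect if no two rows of any $N\times(h+1)$ submatrix (obtained by choosing $h+1$ columns) are the same. Randomized orthogonal array based on $H$: the points $X_i=(X_i^1,\ldots,X_i^K)\in[0,1)^K$, $i=1,\ldots,N$, are $$X_i^k=\pi_k\bigl(H^k_{\gamma^{-1}(i)}\bigr)/n+\eta_i^k/n,$$ where $\gamma$ is a uniformly random permutation of $\{1,\ldots,N\}$, each $\pi_k$ is a uniformly random permutation of $\{0,\ldots,n-1\}$, each $\eta_i^k$ is uniform on $[0,1)$, and $\gamma$, the $\pi_k$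 and the $\eta_i^k$ are all independent. Functional ANOVA: $f_\emptyset=\mu=\int_{[0,1)^K} f\,dx$ and, for nonempty $u\subseteq\{1,\ldots,K\}$, recursively $f_u(x)=\int\{f(x)-\sum_{v\subsetneq u}f_v(x)\}\,dF_{\{1,\ldots,K\}\setminus u}$, i.e. integration over the coordinates $x^k$, $k\notin u$, each with respect to the uniform measure on $[0,1)$. *)

(* Defs.v *)
From HB Require Import structures.
From mathcomp Require Import all_boot all_order all_algebra all_fingroup.
From mathcomp Require Import all_classical all_reals all_analysis.

Set Implicit Arguments.
Unset Strict Implicit.
Unset Printing Implicit Defensive.
Import Order.TTheory GRing.Theory Num.Theory.
Import numFieldNormedType.Exports.

Local Open Scope classical_set_scope.
Local Open Scope ring_scope.

(* A row of values on the columns in C is the restriction to C of some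
   v : 'I_n ^ K; the entries of v outside C play no role. *)
Definition row_count (N K n : nat) (H : 'M['I_n]_(N, K)) (C : {set 'I_K})
    (v : {ffun 'I_K -> 'I_n}) : nat :=
  #|[set i : 'I_N | [forall k in C, H i k == v k]]|.

Definition is_OA (N K n h : nat) (H : 'M['I_n]_(N, K)) : Prop :=
  forall C : {set 'I_K}, (#|C| <= h)%N ->
  forall v w : {ffun 'I_K -> 'I_n}, row_count H C v = row_count H C w.

Definition coincidence_free (N K n h : nat) (H : 'M['I_n]_(N, K)) : Prop :=
  forall C : {set 'I_K}, #|C| = h.+1 ->
  forall i j : 'I_N, i != j -> exists2 k, k \in C & H i k != H j k.

Definition OA_index (R : realType) (N n h : nat) : R := N%:R / n%:R ^+ h.

Definition uniform_fin d (T : measurableType d) (R : realType)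
    (P : probability T R) (S : finType) (X : T -> S) : Prop :=
  forall s : S, measurable (X @^-1` [set s]) /\
                P (X @^-1` [set s]) = (#|S|%:R^-1)%:E.

(* X lies in [0, 1[ everywhere, not only almost surely: the integrand is only
   constrained on the closed cube. *)
Definition uniform01 d (T : measurableType d) (R : realType)
    (P : probability T R) (X : T -> R) : Prop :=
  [/\ measurable_fun setT X,
      forall w, 0 <= X w < 1 &
      forall B : set R, measurable B ->
        P (X @^-1` B) = uniform_prob (@ltr01 R) B].

Definition independent_systems d (T : measurableType d) (R : realType)
    (P : probability T R) (I : finType) (G : I -> set (set T)) : Prop :=
  forall (J : {set I}) (E : I -> set T), (forall i, i \in J -> G i (E i)) ->
    P (\bigcap_(i in [set` J]) E i) = (\prod_(i in J) P (E i))%E.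

Definition sources d (T : measurableType d) (R : realType) (N K n : nat)
    (gam : T -> 'S_N) (p : 'I_K -> T -> 'S_n) (eta : 'I_N -> 'I_K -> T -> R)
    (s : unit + 'I_K + 'I_N * 'I_K) : set (set T) :=
  match s with
  | inl (inl _) => preimage_set_system setT gam setT
  | inl (inr k) => preimage_set_system setT (p k) setT
  | inr (i, k)  => preimage_set_system setT (eta i k) measurable
  end.

Definition randomization d (T : measurableType d) (R : realType)
    (P : probability T R) (N K n : nat) (gam : T -> 'S_N)
    (p : 'I_K -> T -> 'S_n) (eta : 'I_N -> 'I_K -> T -> R) : Prop :=
  [/\ uniform_fin P gam,
      forall k, uniform_fin P (p k),
      forall i k, uniform01 P (eta i k) &
      independent_systems P (sources gam p eta)].

Definition rOA_point (R : realType) (N K n : nat) (H : 'M['I_n]_(N, K))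
    (gam : 'S_N) (p : 'I_K -> 'S_n) (eta : 'I_N -> 'I_K -> R) (i : 'I_N) :
    'rV[R]_K :=
  \row_k ((p k (H ((gam^-1)%g i) k) : nat)%:R / n%:R + eta i k / n%:R).

Definition rOA_mean (R : realType) (N K n : nat) (f : 'rV[R]_K -> R)
    (H : 'M['I_n]_(N, K)) (gam : 'S_N) (p : 'I_K -> 'S_n)
    (eta : 'I_N -> 'I_K -> R) : R :=
  N%:R^-1 * \sum_(i < N) f (rOA_point H gam p eta i).

Section cube.
Variable R : realType.

Definition tcons n (x : measurableTypeR R * n.-tuple R) : n.+1.-tuple R :=
  [tuple of x.1 :: x.2].

Lemma measurable_tcons n :
  measurable_fun [set: measurableTypeR R * n.-tuple R] (@tcons n).
Proof. by apply: measurable_cons; [exact: measurable_fst|exact: measurable_snd]. Qed.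

HB.instance Definition _ n :=
  @isMeasurableFun.Build _ _ _ _ (@tcons n) (@measurable_tcons n).

(* K-fold product of the uniform distribution on the unit interval. *)
Fixpoint unif_cube (K : nat) : probability (K.-tuple R) R :=
  match K with
  | 0 => \d_([tuple] : 0.-tuple R)
  | K'.+1 => distribution (uniform_prob (@ltr01 R) \x unif_cube K')%E (@tcons K')
  end.

Lemma unif_cube_box K (A : 'I_K -> set R) : (forall k, measurable (A k)) ->
  unif_cube K [set t | forall k, A k (tnth t k)] =
  (\prod_(k < K) uniform_prob (@ltr01 R) (A k))%E.
Proof.
elim: K A => [|K IH] A mA /=.
  by rewrite big_ord0 /dirac indicE mem_set//= => -[].
rewrite /distribution /pushforward /=.
have -> : @tcons K @^-1` [set t | forall k, A k (tnth t k)] =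
  A ord0 `*` [set t | forall k, A (lift ord0 k) (tnth t k)].
  apply/seteqP; split=> -[a t] /= H.
    split=> [|k]; first by have := H ord0; rewrite tnth0.
    by have := H (lift ord0 k); rewrite tnthS.
  move=> k; case: (unliftP ord0 k) => [j|] ->; first by rewrite tnthS; apply H.
  by rewrite tnth0; apply H.1.
have mB : measurable [set t : K.-tuple R | forall k, A (lift ord0 k) (tnth t k)].
  rewrite [X in measurable X](_ : _ = \bigcap_(k in [set: 'I_K])
      ((fun t : K.-tuple R => tnth t k) @^-1` A (lift ord0 k))); last first.
    by apply/seteqP; split=> t /= At k; [move=> _|]; apply: At.
  apply: fin_bigcap_measurable => [|k _]; first exact: finite_finset.
  by rewrite -[X in measurable X]setTI; apply: measurable_tnth.
rewrite product_measure1E//; last exact: mA.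
by rewrite big_ord_recl; congr (_ * _)%E; apply: IH => k; exact: mA.
Qed.

Variable K : nat.

(* The sigma-algebra lives on tuples and the topology on row vectors. *)
Definition cube_int (g : 'rV[R]_K -> R) : R :=
  \int[unif_cube K]_(t in [set t | forall k, 0 <= tnth t k < 1])
    g (\row_k tnth t k).

Definition glue (u : {set 'I_K}) (x y : 'rV[R]_K) : 'rV[R]_K :=
  \row_k (if k \in u then x ord0 k else y ord0 k).

(* Integrating out the coordinates outside u; the coordinates of y inside u
   are dummies, which is harmless since the marginals have mass 1. *)
Definition int_out (u : {set 'I_K}) (g : 'rV[R]_K -> R) (x : 'rV[R]_K) : R :=
  cube_int (fun y => g (glue u x y)).

Variable f : 'rV[R]_K -> R.

Fixpoint anova_rec (d : nat) (u : {set 'I_K}) : 'rV[R]_K -> R :=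
  int_out u (fun z => f z - match d with
    | 0 => 0
    | d'.+1 => \sum_(v : {set 'I_K} | v \proper u) anova_rec d' v z
    end).

Definition anova (u : {set 'I_K}) : 'rV[R]_K -> R := anova_rec #|u| u.

Lemma anova_rec_stable d (u : {set 'I_K}) :
  (#|u| <= d)%N -> anova_rec d u = anova u.
Proof.
rewrite /anova; elim/ltn_ind: d u => -[|d] IH u ud.
  by move: ud; rewrite leqn0 => /eqP ->.
have [u0|u0] := posnP #|u|.
  rewrite u0 /=; congr int_out; apply/funext => z; congr (_ - _).
  rewrite big_pred0// => v; apply/negbTE/negP => /proper_card.
  by rewrite u0.
case cu : #|u| u0 => [//|c] _ /=; congr int_out; apply/funext => z; congr (_ - _).
apply: eq_bigr => v /proper_card; rewrite cu ltnS => vc.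
have cd : (c <= d)%N by rewrite -ltnS -cu.
by rewrite (IH d) ?(leq_trans vc)// (IH c).
Qed.

Lemma anovaE (u : {set 'I_K}) :
  anova u =
  int_out u (fun z => f z - \sum_(v : {set 'I_K} | v \proper u) anova v z).
Proof.
rewrite -(@anova_rec_stable #|u|.+1) //=; congr int_out; apply/funext => z.
congr (_ - _); apply: eq_bigr => v vu; rewrite anova_rec_stable//.
by rewrite ltnW// proper_card.
Qed.

Definition anova_remainder (h : nat) (x : 'rV[R]_K) : R :=
  f x - cube_int f - \sum_(u : {set 'I_K} | (0 < #|u| <= h)%N) anova u x.

End cube.

(* normal_prob takes a standard deviation and is not a point mass when that
   deviation is 0. *)
Definition normal_law (R : realType) (m v : R) (A : set R) : \bar R :=
  if v == 0 then \d_m A else normal_prob m (Num.sqrt v) A.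

Definition cvg_in_distribution (R : realType) (d : nat -> measure_display)
    (T : forall m, measurableType (d m)) (P : forall m, probability (T m) R)
    (Y : forall m, T m -> R) (L : set R -> \bar R) : Prop :=
  forall x : R, {for x, continuous (fun t : R => L `]-oo, t]%classic)} ->
    P m [set w | Y m w <= x] @[m --> \oo] --> L `]-oo, x]%classic.

(* Main.v *)
From HB Require Import structures.
Require Import Defs.
From mathcomp Require Import all_boot all_order all_algebra all_fingroup.
From mathcomp Require Import all_classical all_reals all_analysis.
From mathcomp Require Import ring lra zify.

(* Replace f by its cell averages F on the n^K cells: the remainder of the discrete
   ANOVA of F is close to r, and strength h of the array kills the components of
   order between 1 and h, so the error becomes N^(-1/2) times the sum over rows of
   that remainder, up to within-cell noise which is centred and of size the
   oscillation of f on a cell. Sorting n iid uniform labels in every column couples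
   the random permutations of symbols with iid labels; the cost of the coupling is
   controlled by index/n. For iid labels, Lindeberg's replacement is carried out
   column by column and symbol by symbol on the explicit heat flow
   P(x + sqrt t Z <= y); the fourth-moment terms are bounded by the number of
   quadruples of rows that agree in too many columns, which freedom from
   coincidence makes O(N^2 index/n). Everything random is discretized, so all
   expectations are finite averages, and the heat flow at small time sandwiches
   the indicators defining the distribution function. *)

Set Implicit Arguments.
Unset Strict Implicit.
Unset Printing Implicit Defensive.
Import Order.TTheory GRing.Theory Num.Theory.
Import numFieldNormedType.Exports.

Local Open Scope ring_scope.

(** * Finite averages *)

(** Two obstacles shape the argument. Labels given by a permutation cannot be redrawn one at a time,
    so conditioning on all labels but one, on which Lindeberg's swap rests, is available only after
    the coupling. And the conditional variance of a swapped block is itself random. The heat flow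
    settles this: a random variance is added to the time argument, the second-order terms in space
    and time cancel by the heat equation, and only at the end of a column is the accumulated time
    replaced by its mean, at the cost of its standard deviation. Cancellation has one source: a
    function whose conditional means given at most [h] columns vanish averages to zero in a product
    over rows as soon as one row can be redrawn outside at most [h] columns without moving the
    others. The mesh [M] of the noise is chosen after [N], because the discretization error is
    multiplied by the square root of [N]; the quantitative bounds are therefore uniform in [M]. They
    are of the order of the square root of one number [k] that dominates the modulus of continuity,
    the sorting error and the crowding, so the passage to the limit comes last. *)

Section average.
Variable R : realType.

Definition avg (S : finType) (F : S -> R) : R := #|S|%:R^-1 * \sum_s F s.

Section avg_theory.
Variable S : finType.
Implicit Types F G : S -> R.

Lemma eq_avg F G : F =1 G -> avg F = avg G.
Proof. by move=> FG; rewrite /avg (eq_bigr _ (fun s _ => FG s)). Qed.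

Lemma avgD F G : avg (fun s => F s + G s) = avg F + avg G.
Proof. by rewrite /avg big_split mulrDr. Qed.

Lemma avgZ (a : R) F : avg (fun s => a * F s) = a * avg F.
Proof. by rewrite /avg -mulr_sumr mulrCA. Qed.

Lemma avgZr (a : R) F : avg (fun s => F s * a) = avg F * a.
Proof. by rewrite /avg -mulr_suml mulrA. Qed.

Lemma avgN F : avg (fun s => - F s) = - avg F.
Proof. by rewrite /avg sumrN mulrN. Qed.

Lemma avgB F G : avg (fun s => F s - G s) = avg F - avg G.
Proof. by rewrite avgD avgN. Qed.

Lemma avg_sum (I : Type) (r : seq I) (P : pred I) (F : I -> S -> R) :
  avg (fun s => \sum_(i <- r | P i) F i s) = \sum_(i <- r | P i) avg (F i).
Proof. by rewrite /avg exchange_big mulr_sumr. Qed.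

Lemma avg0 : avg (fun _ : S => 0) = 0.
Proof. by rewrite /avg big1// mulr0. Qed.

Lemma ler_avg F G : (forall s, F s <= G s) -> avg F <= avg G.
Proof.
by move=> FG; rewrite /avg ler_wpM2l ?invr_ge0// ler_sum.
Qed.

Lemma avg_ge0 F : (forall s, 0 <= F s) -> 0 <= avg F.
Proof. by move=> F0; rewrite -[leLHS]avg0 ler_avg. Qed.

Lemma ler_norm_avg F : `|avg F| <= avg (fun s => `|F s|).
Proof.
by rewrite /avg normrM ger0_norm ?invr_ge0// ler_wpM2l ?invr_ge0// ler_norm_sum.
Qed.

Lemma avg_cst (a : R) : (0 < #|S|)%N -> avg (fun _ : S => a) = a.
Proof.
by move=> S0; rewrite /avg sumr_const -[a *+ _]mulr_natl mulKf// pnatr_eq0 -lt0n.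
Qed.

Lemma avg_le_cst F (a : R) : 0 <= a -> (forall s, F s <= a) -> avg F <= a.
Proof.
move=> a0 Fa; have [S0|S0] := posnP #|S|; last first.
  by rewrite -[leRHS](avg_cst a S0) ler_avg.
by rewrite /avg S0 invr0 mul0r.
Qed.

Lemma norm_avg_le_cst F (a : R) :
  0 <= a -> (forall s, `|F s| <= a) -> `|avg F| <= a.
Proof. by move=> a0 Fa; rewrite (le_trans (ler_norm_avg F))// avg_le_cst. Qed.

Lemma sqr_avg_le F : avg F ^+ 2 <= avg (fun s => F s ^+ 2).
Proof.
have [S0|S0] := posnP #|S|; first by rewrite /avg S0 invr0 !mul0r expr0n.
have : 0 <= avg (fun s => (F s - avg F) ^+ 2) by apply: avg_ge0 => s; rewrite sqr_ge0.
under eq_avg do rewrite sqrrB.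
rewrite avgD avgB avg_cst//.
under [X in _ - X + _]eq_avg do rewrite -mulr_natr.
by rewrite !avgZr; lra.
Qed.

End avg_theory.

Lemma avg_exchange (S T : finType) (F : S -> T -> R) :
  avg (fun s => avg (F s)) = avg (fun t => avg (fun s => F s t)).
Proof.
rewrite /avg -!mulr_sumr exchange_big /= mulrCA; congr (_ * (_ * _)).
Qed.

Lemma avg_pair (S T : finType) (F : S * T -> R) :
  avg F = avg (fun s => avg (fun t => F (s, t))).
Proof.
rewrite /avg -mulr_sumr mulrA card_prod natrM invfM; congr (_ * _).
by rewrite pair_bigA; apply: eq_bigr => -[].
Qed.

Lemma avg_reindex (S T : finType) (h : S -> T) (F : T -> R) :
  bijective h -> avg (fun s => F (h s)) = avg F.
Proof.
move=> bh; rewrite /avg (bij_eq_card bh); congr (_ * _).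
rewrite [RHS](reindex h)//; exact: onW_bij.
Qed.

Lemma avg_indicator (S : finType) (P : pred S) :
  avg (fun s => (P s)%:R) = #|P|%:R / #|S|%:R.
Proof.
by rewrite /avg mulrC -natr_sum -sum1_card [in RHS]big_mkcond /=; congr (_%:R / _).
Qed.

End average.

(** * Conditional expectations on finite product spaces *)

Section resampling.
Variables (R : realType) (X S : finType).
Hypothesis S0 : (0 < #|S|)%N.
Implicit Types (J : pred X) (c d : {ffun X -> S}) (F G : {ffun X -> S} -> R).

Definition mix J c d : {ffun X -> S} := [ffun x => if J x then d x else c x].

(** The conditional expectation of [F] given the coordinates outside [J]. It remains a function of
    the whole sample, so that conditional expectations for different [J] compose. *)
Definition resample J F c : R := avg (fun d => F (mix J c d)).

Lemma card_ffun_gt0 : (0 < #|{ffun X -> S}|)%N.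
Proof. by rewrite card_ffun expn_gt0 S0. Qed.

Lemma mix_mix J J' c d e :
  mix J' (mix J c d) e = mix (predU J J') c (mix J' d e).
Proof. by apply/ffunP => x; rewrite !ffunE /=; case: (J x); case: (J' x). Qed.

(** Exchanging the coordinates in [J] between two independent samples is an involution of the pairs,
    and [mix J] of a pair is the first component of its image. *)
Lemma avg_resample J F : avg (resample J F) = avg F.
Proof.
rewrite /resample.
transitivity (avg (fun q : {ffun X -> S} * {ffun X -> S} => F q.1)); last first.
  by rewrite avg_pair; apply: eq_avg => c; rewrite /= avg_cst ?card_ffun_gt0.
rewrite -(avg_pair (fun q => F (mix J q.1 q.2))).
pose sw (q : {ffun X -> S} * {ffun X -> S}) := (mix J q.1 q.2, mix J q.2 q.1).
rewrite -(@avg_reindex _ _ _ sw (fun q => F q.1)) //.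
by exists sw => -[c d]; congr pair; apply/ffunP => x; rewrite !ffunE; case: (J x).
Qed.

Lemma eq_resample J F G : F =1 G -> resample J F =1 resample J G.
Proof. by move=> FG c; apply: eq_avg => d; rewrite FG. Qed.

Lemma resampleB J F G c :
  resample J (fun e => F e - G e) c = resample J F c - resample J G c.
Proof. exact: avgB. Qed.

Lemma resampleZ J (a : R) F c :
  resample J (fun e => a * F e) c = a * resample J F c.
Proof. exact: avgZ. Qed.

Lemma resample_sum (I : Type) (r : seq I) (P : pred I) J
    (F : I -> {ffun X -> S} -> R) c :
  resample J (fun e => \sum_(i <- r | P i) F i e) c =
  \sum_(i <- r | P i) resample J (F i) c.
Proof. exact: avg_sum. Qed.

Lemma resample_cst J (a : R) c : resample J (fun=> a) c = a.
Proof. by rewrite /resample avg_cst ?card_ffun_gt0. Qed.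

(** Tower property: redrawing coordinates of the inner sample once more leaves it uniform, by
    [avg_resample]. *)
Lemma resampleU J J' F c :
  resample J (resample J' F) c = resample (predU J J') F c.
Proof.
rewrite {1}/resample.
under eq_avg => d.
  rewrite /resample; under eq_avg => e do rewrite mix_mix.
  over.
exact: (avg_resample J' (fun d => F (mix (predU J J') c d))).
Qed.

(** Measurability with respect to the coordinates outside [J], expressed without a sigma-algebra. *)
Definition free_of J F := forall c d, F (mix J c d) = F c.

Lemma resample_free J F : free_of J F -> resample J F =1 F.
Proof.
move=> JF c; rewrite /resample; under eq_avg do rewrite JF.
by rewrite /= avg_cst ?card_ffun_gt0.
Qed.

Lemma resample_mulr J F G c : free_of J G ->
  resample J (fun e => F e * G e) c = resample J F c * G c.
Proof. by move=> JG; rewrite /resample -avgZr; apply: eq_avg => d; rewrite JG. Qed.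

Lemma free_of_resample J J' F : (forall x, J x -> J' x) ->
  free_of J (resample J' F).
Proof.
move=> JJ' c d; apply: eq_avg => e; congr F; apply/ffunP => x; rewrite !ffunE.
by case: ifP => // J'x; case: ifP => // /JJ'; rewrite J'x.
Qed.

Lemma free_of_resampleW J J' F : free_of J F -> free_of J (resample J' F).
Proof.
move=> JF c d; apply: eq_avg => e.
rewrite -[in RHS](JF _ (mix J' d e)); congr F; apply/ffunP => x; rewrite !ffunE.
by case: (J' x); case: (J x).
Qed.

Lemma resample_absorb J J' F : (forall x, J x -> J' x) ->
  resample J (resample J' F) =1 resample J' F.
Proof. by move=> JJ'; apply: resample_free; apply: free_of_resample. Qed.

(** Independence of functions of complementary coordinates: redrawing [J] leaves [F] alone and turns
    [G] into a function of the fresh sample only. *)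
Lemma avg_mul_indep J F G : free_of J F -> free_of (predC J) G ->
  avg (fun c => F c * G c) = avg F * avg G.
Proof.
move=> JF JG; rewrite -(avg_resample J) /resample.
under eq_avg => c.
  under eq_avg => d.
    rewrite JF (_ : mix J c d = mix (predC J) d c); last first.
      by apply/ffunP => x; rewrite !ffunE /=; case: (J x).
    rewrite JG; over.
  rewrite avgZ; over.
exact: avgZr.
Qed.

Lemma resample_bound J F (B : R) c : 0 <= B -> (forall e, `|F e| <= B) ->
  `|resample J F c| <= B.
Proof. by move=> B0 FB; apply: norm_avg_le_cst. Qed.

Lemma resample_all F c : resample predT F c = avg F.
Proof.
by apply: eq_avg => d; congr F; apply/ffunP => x; rewrite !ffunE.
Qed.

End resampling.

Lemma avg_comp_inj (R : realType) (I X S : finType) (iota : I -> X)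
    (F : {ffun I -> S} -> R) : (0 < #|S|)%N -> injective iota ->
  avg (fun U : {ffun X -> S} => F [ffun i => U (iota i)]) = avg F.
Proof.
(* (U, c) |-> U and c with the values of U on the image of iota exchanged with c. *)
move=> S0 inj_iota.
pose T := ({ffun X -> S} * {ffun I -> S})%type.
transitivity (avg (fun q : T => F q.2)); last first.
  by rewrite avg_pair /= avg_cst ?card_ffun_gt0.
transitivity (avg (fun q : T => F [ffun i => q.1 (iota i)])).
  by rewrite avg_pair; apply: eq_avg => c; rewrite /= avg_cst ?card_ffun_gt0.
pose sw (q : T) : T :=
  ([ffun x => if [pick i | iota i == x] is Some i then q.2 i else q.1 x],
   [ffun i => q.1 (iota i)]).
rewrite -(@avg_reindex _ _ _ sw (fun q : T => F q.2)) //.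
have pickE i : [pick i0 | iota i0 == iota i] = Some i.
  case: pickP => [j /eqP /inj_iota -> //|/(_ i)]; by rewrite eqxx.
exists sw => -[c d]; rewrite /sw /=; congr pair; apply/ffunP => x;
  rewrite !ffunE ?pickE//.
- by case: pickP => // i /eqP <-; rewrite ffunE.
- by case: pickP => // i /eqP <-; rewrite ffunE.
Qed.

(** * Counting in orthogonal arrays *)

Section orthogonal_array.
Variables (R : realType) (N K n h : nat) (H : 'M['I_n]_(N, K)).
Hypotheses (n0 : (0 < n)%N) (h0 : (0 < h)%N).
Hypotheses (HOA : is_OA h H) (Hfree : coincidence_free h H).
Implicit Types (A B : {set 'I_K}) (i j l m : 'I_N) (v w c : {ffun 'I_K -> 'I_n}).

Let In0 : (0 < #|'I_n|)%N. Proof. by rewrite card_ord. Qed.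
Let n0R : n%:R != 0 :> R. Proof. by rewrite pnatr_eq0 -lt0n. Qed.

Definition row_of i : {ffun 'I_K -> 'I_n} := [ffun k => H i k].

Definition agree i j : {set 'I_K} := [set k | H i k == H j k]%SET.

Lemma indicator_forall_in A (Q : pred 'I_K) :
  [forall k in A, Q k]%:R = \prod_k (if k \in A then (Q k)%:R else 1) :> R.
Proof.
case: (boolP [forall k in A, _]) => [/forall_inP AQ|].
  by rewrite big1// => k _; case: ifP => // /AQ ->.
rewrite negb_forall_in => /exists_inP[k kA /negbTE Qk].
by rewrite (bigD1 k)//= kA Qk mul0r.
Qed.

Lemma avg_agree A v :
  avg (fun w => [forall k in A, w k == v k]%:R : R) = n%:R ^- #|A|.
Proof.
have E w := indicator_forall_in A (fun k => w k == v k).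
rewrite (eq_avg E) /avg -(bigA_distr_bigA
  (fun k (q : 'I_n) => if k \in A then (q == v k)%:R else 1 : R)).
have -> : \prod_k \sum_(q : 'I_n) (if k \in A then (q == v k)%:R else 1 : R) =
    n%:R ^+ #|~: A|.
  rewrite -prodr_const [RHS]big_mkcond/=; apply: eq_bigr => k _.
  rewrite finset.in_setC; case: (k \in A) => /=; last by rewrite sumr_const card_ord.
  by rewrite (bigD1 (v k))//= eqxx big1 ?addr0// => q /negbTE ->.
rewrite card_ffun !card_ord natrX cardsCs card_ord finset.setCK -exprVn.
have AK : (#|A| <= K)%N by rewrite -[leqRHS]card_ord max_card.
rewrite -{1}(subnKC AK) exprD -exprVn -mulrA -exprMn mulVf// expr1n mulr1//.
Qed.

Lemma row_count_sum A v :
  (row_count H A v)%:R = \sum_i [forall k in A, H i k == v k]%:R :> R.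
Proof.
rewrite /row_count mem_setE -sum1_card natr_sum [LHS]big_mkcond /=.
apply: eq_bigr => i _; rewrite -[X in if X then _ else _]/([forall k in A, H i k == v k]).
by case: [forall _ in _, _].
Qed.

(** Strength only says that all counts are equal. Averaging them over [v] gives the value: each row
    matches a uniform [v] on [A] with probability n^-|A|. *)
Lemma row_countE A v : (#|A| <= h)%N ->
  (row_count H A v)%:R = N%:R * n%:R ^- #|A| :> R.
Proof.
move=> Ah.
have -> : (row_count H A v)%:R = avg (fun w => (row_count H A w)%:R) :> R.
  rewrite -[LHS](avg_cst _ (card_ffun_gt0 'I_K In0)); apply: eq_avg => w.
  by rewrite (HOA Ah v w).
have E w : (row_count H A w)%:R =
    \sum_i [forall k in A, w k == row_of i k]%:R :> R.
  rewrite row_count_sum; apply: eq_bigr => i _; congr (_ (nat_of_bool _)).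
  by apply: eq_forallb_in => k _; rewrite ffunE eq_sym.
rewrite (eq_avg E) avg_sum (eq_bigr (fun=> n%:R ^- #|A|)).
  by rewrite sumr_const card_ord mulr_natl.
by move=> i _; rewrite avg_agree.
Qed.

Lemma row_countS A v : #|A| = h.+1 -> (row_count H A v <= 1)%N.
Proof.
move=> Ah; rewrite /row_count mem_setE leqNgt; apply/negP => /card_gt1P[i [j [iv jv ij]]].
have {iv}/forall_inP ivA : [forall k in A, H i k == v k] by exact: iv.
have {jv}/forall_inP jvA : [forall k in A, H j k == v k] by exact: jv.
by have [k kA] := Hfree Ah ij; rewrite (eqP (ivA _ kA)) (eqP (jvA _ kA)) eqxx.
Qed.

Lemma card_subset_exists A q : (q <= #|A|)%N ->
  exists2 B : {set 'I_K}, B \subset A & #|B| = q.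
Proof.
case/card_geqP => s [us ss sA]; exists [set x in s]%SET.
  by apply/fintype.subsetP => x; rewrite inE => /sA.
by rewrite cardsE (card_uniqP us).
Qed.

Lemma agree_le i j : i != j -> (#|agree i j| <= h)%N.
Proof.
move=> ij; rewrite leqNgt; apply/negP => hlt.
have [A AS Ah] := card_subset_exists hlt.
have [k kA] := Hfree Ah ij.
by move/fintype.subsetP : AS => /(_ _ kA); rewrite inE => ->.
Qed.

(** The array integrates functions of at most [h] columns exactly: each value of [G] is spread over
    the cells that agree with its row on [A], where [G] is constant, and [row_countE] then gives all
    cells the same weight. *)
Lemma OA_balance A (G : {ffun 'I_K -> 'I_n} -> R) : (#|A| <= h)%N ->
  free_of [pred k | k \notin A] G ->
  \sum_i G (row_of i) = N%:R * avg G.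
Proof.
move=> Ah GA.
have E i : G (row_of i) =
    n%:R ^+ #|A| * avg (fun w => [forall k in A, w k == row_of i k]%:R * G w).
  rewrite (eq_avg (G := fun w => [forall k in A, w k == row_of i k]%:R * G (row_of i))).
    by rewrite avgZr avg_agree mulrA divff ?mul1r// expf_neq0.
  move=> w; case: (boolP [forall k in A, _]) => [/forall_inP wi|_]; last by rewrite !mul0r.
  rewrite !mul1r -(GA w (row_of i)); congr G; apply/ffunP => k.
  by rewrite ffunE /=; case: ifP => // /negbFE /wi /eqP.
rewrite (eq_bigr _ (fun i _ => E i)) -mulr_sumr -avg_sum.
have E' w : \sum_i ([forall k in A, w k == row_of i k]%:R * G w) =
    (N%:R * n%:R ^- #|A|) * G w.
  rewrite -mulr_suml -(row_countE w Ah); congr (_ * _).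
  rewrite row_count_sum; apply: eq_bigr => i _; congr (_ (nat_of_bool _)).
  by apply: eq_forallb_in => k _; rewrite ffunE eq_sym.
rewrite (eq_avg E') avgZ mulrA [_ * (N%:R * _)]mulrCA divff ?mulr1 ?expf_neq0//.
Qed.

(* The index divided by n, which tends to 0 in both regimes for the index. *)
Definition crowding : R := N%:R / n%:R ^+ h.+1.

(** Strength [h] forces at least n^h rows: the pattern of the first row on [h] columns occurs at
    least once, and its count is N/n^h. Counts of order N^2/n are thereby absorbed into N^2 times
    the crowding. *)
Lemma crowding_ge0 : 0 <= crowding.
Proof. by rewrite divr_ge0. Qed.

Lemma crowding_ge : (0 < N)%N -> (h <= K)%N -> n%:R^-1 <= crowding.
Proof.
move=> N0 hK; rewrite /crowding exprSr invfM mulrA ler_peMl ?invr_ge0//.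
have [A _ Ah] : exists2 A : {set 'I_K}, A \subset [set: 'I_K]%SET & #|A| = h.
  by apply: card_subset_exists; rewrite cardsT card_ord.
have := row_countE (A := A) (row_of (Ordinal N0)).
rewrite Ah => /(_ (leqnn h)) <-; rewrite row_count_sum (bigD1 (Ordinal N0))//=.
rewrite (_ : [forall _ in A, _]); first by rewrite lerDl sumr_ge0.
by apply/forall_inP => k _; rewrite ffunE.
Qed.

End orthogonal_array.

(** * Quadruples of rows that agree in many columns *)

Section counting.
Variables (R : realType) (N K n h : nat) (H : 'M['I_n]_(N, K)).
Hypotheses (N0 : (0 < N)%N) (n0 : (0 < n)%N) (h0 : (0 < h)%N) (hK : (h <= K)%N).
Hypotheses (HOA : is_OA h H) (Hfree : coincidence_free h H).
Implicit Types (A B D : {set 'I_K}) (i j l m : 'I_N).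

Let rho : R := crowding R N n h.

Lemma le_indicator_sum (P : bool) (I : finType) (Q : pred I) :
  (P -> exists x, Q x) -> P%:R <= \sum_x (Q x)%:R :> R.
Proof.
case: P => [/(_ isT) [x Qx]|_]; last by rewrite sumr_ge0.
by rewrite (bigD1 x)//= Qx lerDl sumr_ge0.
Qed.

(* A function whose averages over all but h coordinates vanish makes a product
   over four rows average to 0 as soon as one of them is not covered. *)
Definition covered i j l m :=
  (h < #|agree H i j :|: agree H i l :|: agree H i m|)%N.

Lemma count_agree A (v : {ffun 'I_K -> 'I_n}) : (#|A| <= h)%N ->
  \sum_i [forall k in A, H i k == v k]%:R = N%:R * n%:R ^- #|A| :> R.
Proof. by move=> Ah; rewrite -row_count_sum (row_countE R n0 HOA). Qed.

(** A covered row is encoded by [h.+1] columns and, for each column, the choice of a row among [i],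
    [j], [l] that it meets there. A code fixes the values on [h.+1] columns, so freedom from
    coincidence leaves at most one row per code; 2^K and 3^K count the codes. *)
Lemma count_covered i j l :
  \sum_m (covered m i j l)%:R <= (2 ^ K * 3 ^ K)%:R :> R.
Proof.
pose v (s : {ffun 'I_K -> option bool}) : {ffun 'I_K -> 'I_n} := [ffun k =>
  if s k is Some b then (if b then H i k else H j k) else H l k].
pose Q m (p : {set 'I_K} * {ffun 'I_K -> option bool}) :=
  (#|p.1| == h.+1) && [forall k in p.1, H m k == v p.2 k].
apply: (@le_trans _ _ (\sum_m \sum_p (Q m p)%:R)).
  apply: ler_sum => m _; apply: le_indicator_sum => hc.
  have [D DS Dh] := card_subset_exists hc.
  exists (D, [ffun k => if H m k == H i k then Some true else
                        if H m k == H j k then Some false else None]).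
  rewrite /Q /= Dh eqxx; apply/forall_inP => k /(fintype.subsetP DS).
  rewrite !inE !ffunE -orbA; case: (H m k =P H i k) => [->//|_].
  by case: (H m k =P H j k) => [->//|_].
rewrite exchange_big /=.
apply: (@le_trans _ _ (\sum_(p : {set 'I_K} * {ffun 'I_K -> option bool}) 1)).
  apply: ler_sum => p _; rewrite /Q.
  case: eqP => [Dh|_]; last by rewrite big1.
  under eq_bigr do rewrite andTb.
  by rewrite -row_count_sum lern1 (row_countS Hfree).
rewrite sumr_const card_prod card_ffun card_option card_bool card_ord.
by rewrite -cardsT -powersetT card_powerset cardsT card_ord.
Qed.

Let pick2 i j (s : {ffun 'I_K -> bool}) : {ffun 'I_K -> 'I_n} :=
  [ffun k => if s k then H i k else H j k].

(** Certificate that a triple of rows is rare. It records [h.+1] coincidences in total, while each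
    of the two sets stays within the strength, so that the matching rows can be counted exactly. *)
Let Q1 i j l (p : {set 'I_K} * {set 'I_K} * {ffun 'I_K -> bool}) :=
  [&& (#|p.1.1| <= h)%N, (#|p.1.2| <= h)%N, (#|p.1.1| + #|p.1.2| == h.+1)%N,
    [forall k in p.1.1, H j k == row_of H i k] &
    [forall k in p.1.2, H l k == pick2 i j p.2 k]].

Let Q2 i j l k := (i == j) && (H l k == H i k).

Let triples i j l : R := \sum_p (Q1 i j l p)%:R + \sum_k (Q2 i j l k)%:R.

Let triples_ge0 i j l : 0 <= triples i j l.
Proof. by rewrite addr_ge0// sumr_ge0. Qed.

(** For a [Q1] certificate with sets [A] and [B] there are N choices of [i], then N/n^|A| of [j] and
    N/n^|B| of [l]: N^3/n^(h+1) in total, which is N^2 times [rho]. The number of certificates is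
    8^K. For [Q2] a column gives N^2/n, and [crowding_ge] applies. *)
Let count_triples :
  \sum_i \sum_j \sum_l triples i j l <= (8 ^ K + K)%:R * (N%:R ^+ 2 * rho).
Proof.
have n0R : n%:R != 0 :> R by rewrite pnatr_eq0 -lt0n.
rewrite /triples; under eq_bigr do under eq_bigr do rewrite big_split /=.
under eq_bigr do rewrite big_split /=.
rewrite big_split natrD mulrDl lerD//.
  under eq_bigr do under eq_bigr do rewrite exchange_big /=.
  under eq_bigr do rewrite exchange_big /=.
  rewrite exchange_big /=.
  apply: (@le_trans _ _ (\sum_(p : {set 'I_K} * {set 'I_K} * {ffun 'I_K -> bool})
      (N%:R ^+ 2 * rho))).
    apply: ler_sum => p _; rewrite /Q1; set A := p.1.1; set B := p.1.2.
    have [Ah|_] := boolP (#|A| <= h)%N; last first.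
      by rewrite /= big1 ?mulr_ge0 ?crowding_ge0// => i _; rewrite big1// => j _; rewrite big1.
    have [Bh|_] := boolP (#|B| <= h)%N; last first.
      by rewrite /= big1 ?mulr_ge0 ?crowding_ge0// => i _; rewrite big1// => j _; rewrite big1.
    case: eqP => [ABh|_]; last first.
      by rewrite /= big1 ?mulr_ge0 ?crowding_ge0// => i _; rewrite big1// => j _; rewrite big1.
    under eq_bigr => i _.
      under eq_bigr => j _.
        under eq_bigr => l _ do rewrite !andTb -mulnb natrM.
        rewrite -mulr_sumr count_agree//.
        over.
      rewrite -mulr_suml count_agree//.
      over.
    rewrite sumr_const card_ord /rho /crowding -ABh exprD -mulr_natl.
    by rewrite invfM expr2 le_eqVlt; apply/orP; left; apply/eqP; ring.
  rewrite sumr_const -[leLHS]mulr_natl ler_wpM2r ?mulr_ge0 ?crowding_ge0//.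
  rewrite ler_nat !card_prod card_ffun card_bool card_ord.
  rewrite -cardsT -powersetT card_powerset cardsT card_ord.
  by rewrite -!expnMn.
apply: (@le_trans _ _ (\sum_(i < N) \sum_(k < K) (N%:R * n%:R^-1))).
  apply: ler_sum => i _; rewrite (bigD1 i)//= [X in _ + X]big1 ?addr0; last first.
    move=> j /negbTE ij; rewrite big1// => l _; rewrite big1// => k _.
    by rewrite /Q2 eq_sym ij.
  rewrite exchange_big /=; apply: ler_sum => k _.
  under eq_bigr => l _.
    rewrite /Q2 eqxx andTb.
    rewrite (_ : (H l k == H i k) = [forall k' in [set k]%SET, H l k' == row_of H i k']).
      over.
    apply/idP/forall_inP => [e k'|/(_ k)]; last by rewrite !inE eqxx ffunE; exact.
    by rewrite inE => /eqP ->; rewrite ffunE.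
  by rewrite count_agree ?cards1// expr1.
rewrite !sumr_const !card_ord -mulrnA -[leLHS]mulr_natl natrM.
rewrite (_ : _ * _ = K%:R * (N%:R ^+ 2 * n%:R^-1)); last by ring.
by rewrite !ler_wpM2l// (crowding_ge R n0 HOA).
Qed.

(** The quadruples that can contribute to a fourth moment: a row not covered by the other three
    averages out, and the case of two equal pairs is handled apart. *)
Definition quad k i j l m :=
  [&& H i k == H j k, H l k == H m k, covered i j l m, covered j i l m,
      covered l i j m, covered m i j l & ~~ ((i == j) && (l == m))].


(** The pair with the larger agreement pays for the other. Row [l] is covered and meets [m] in no
    more columns than [i] meets [j], so the columns missing to [h.+1] are found where [l] meets [i]
    or [j]. If [i = j], then [l] and [m] differ and agree on at most [h] columns, so some further
    column joins [l] to [i]. *)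
Let quad_half k i j l m : quad k i j l m ->
  (#|agree H l m| <= #|agree H i j|)%N ->
  (exists p, Q1 i j l p) \/ (exists k', Q2 i j l k').
Proof.
case/and5P => Hij Hlm _ _ /and3P[cl _ ne] le_lm.
have [ij|ij] := eqVneq i j.
  right; move: ne; rewrite ij eqxx /= => lm.
  have lmh := agree_le Hfree lm.
  have /fintype.subsetPn[k' ] : ~~ (agree H l i :|: agree H l j :|: agree H l m
      \subset agree H l m).
    apply/negP => /subset_leq_card; rewrite leqNgt => /negP; apply.
    by rewrite (leq_ltn_trans lmh).
  rewrite !inE -ij orbb => /orP[Hk _|->//].
  by exists k'; rewrite /Q2 ij eqxx -ij.
left; have ijh := agree_le Hfree ij.
(* Column [k] makes the agreement set nonempty, which keeps the size of [B] at most [h]. *)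
have A0 : (0 < #|agree H i j|)%N by apply/card_gt0P; exists k; rewrite inE.
have [B BS Bh] : exists2 B : {set 'I_K}, B \subset agree H l i :|: agree H l j &
    #|B| = (h.+1 - #|agree H i j|)%N.
  apply: card_subset_exists; rewrite leq_subLR addnC.
  apply: leq_trans cl _; apply: leq_trans (leq_card_setU _ _) _.
  by rewrite leq_add2l.
exists (agree H i j, B, [ffun k' => H l k' == H i k']).
rewrite /Q1; apply/and5P; split => //=.
- by rewrite Bh leq_subLR -add1n leq_add2r.
- by rewrite Bh subnKC// ltnW.
- by apply/forall_inP => k'; rewrite inE ffunE eq_sym.
- apply/forall_inP => k' /(fintype.subsetP BS); rewrite !inE !ffunE.
  by case: (H l k' =P H i k') => [->|_].
Qed.

Let quad_half_triples k i j l m : quad k i j l m ->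
  (#|agree H l m| <= #|agree H i j|)%N -> 1 <= triples i j l.
Proof.
move=> q le_lm; rewrite /triples.
have [[p Hp]|[k' Hk]] := quad_half q le_lm.
  by rewrite (bigD1 p)//= Hp -addrA lerDl addr_ge0// ?sumr_ge0.
by rewrite [X in _ + X](bigD1 k')//= Hk addrCA lerDl addr_ge0// ?sumr_ge0.
Qed.

Lemma quadC k i j l m : quad k i j l m = quad k l m i j.
Proof.
have cC a b c d : covered a b c d = covered a c d b.
  by rewrite /covered [in RHS]finset.setUC finset.setUA.
rewrite /quad (cC l m i j) (cC m l i j) (cC i l m j) (cC i m j l) (cC j l m i).
rewrite (cC j m i l) [(l == m) && _]andbC.
by case: (H i k == _); case: (H l k == _); case: (covered i j l m);
  case: (covered j i l m); case: (covered l i j m); case: (covered m i j l).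
Qed.

Let exchange4 (F : 'I_N -> 'I_N -> 'I_N -> 'I_N -> R) :
  \sum_i \sum_j \sum_l \sum_m F l m i j = \sum_i \sum_j \sum_l \sum_m F i j l m.
Proof.
under eq_bigr => i _.
  rewrite exchange_big /=; under eq_bigr do rewrite exchange_big /=.
  over.
rewrite exchange_big /=; apply: eq_bigr => l _.
by rewrite exchange_big.
Qed.

(** By [quadC] the pair with the larger agreement may come first, which costs the factor 2. The
    triple is then counted through its certificate and the fourth row by [count_covered]. *)
Lemma count_quad k : \sum_i \sum_j \sum_l \sum_m (quad k i j l m)%:R <=
  2 * (2 ^ K * 3 ^ K * (8 ^ K + K))%:R * (N%:R ^+ 2 * rho) :> R.
Proof.
pose C4 : R := (2 ^ K * 3 ^ K)%:R.
pose c i j l m : R := triples i j l * (covered m i j l)%:R.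
have cle i j l m : quad k i j l m -> (#|agree H l m| <= #|agree H i j|)%N ->
    1 <= c i j l m.
  move=> q /(quad_half_triples q) t1; rewrite /c.
  by case/and5P : q => _ _ _ _ /and3P[_ -> _]; rewrite mulr1.
have c_ge0 i j l m : 0 <= c i j l m by rewrite mulr_ge0.
have ql i j l m : (quad k i j l m)%:R <= c i j l m + c l m i j.
  have [q|_] := boolP (quad k i j l m); last by rewrite addr_ge0.
  have [le|/ltnW le] := leqP #|agree H l m| #|agree H i j|.
    by rewrite (le_trans (cle _ _ _ _ q le))// lerDl.
  by rewrite quadC in q; rewrite (le_trans (cle _ _ _ _ q le))// lerDr.
have sc : \sum_i \sum_j \sum_l \sum_m c i j l m <=
    C4 * ((8 ^ K + K)%:R * (N%:R ^+ 2 * rho)).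
  apply: le_trans (ler_wpM2l _ count_triples); last exact: ler0n.
  rewrite mulr_sumr ler_sum// => i _; rewrite mulr_sumr ler_sum// => j _.
  rewrite mulr_sumr ler_sum// => l _; rewrite -mulr_sumr mulrC.
  by rewrite ler_wpM2r// count_covered.
apply: (@le_trans _ _ (\sum_i \sum_j \sum_l \sum_m (c i j l m + c l m i j))).
  by do 4 (apply: ler_sum => ? _).
under eq_bigr do under eq_bigr do under eq_bigr do rewrite big_split /=.
under eq_bigr do under eq_bigr do rewrite big_split /=.
under eq_bigr do rewrite big_split /=.
rewrite big_split /= (exchange4 c) (le_trans (lerD sc sc))//.
by rewrite le_eqVlt; apply/orP; left; apply/eqP; rewrite /C4 [in RHS]natrM; ring.
Qed.

End counting.

(** * Lindeberg replacement with independent labels *)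

Section lindeberg.
Variables (R : realType) (X S : finType) (n : nat).
Hypothesis S0 : (0 < #|S|)%N.
Notation sample := {ffun X -> S}.
Variables (site : 'I_n -> X) (T : sample -> R) (D : 'I_n -> sample -> R).
Let J a : pred X := pred1 (site a).
Hypothesis Tfree : forall a, free_of (J a) T.
Hypothesis Dfree : forall a b, a != b -> free_of (J b) (D a).
Hypothesis Dmean : forall a U, resample (J a) (D a) U = 0.

(** The variance of [D a] given everything but the label at [site a]. It is still random through the
    other labels, and is spent as time in [w]. *)
Definition cond_var a : sample -> R := resample (J a) (fun U => D a U ^+ 2).

(** [w1] and [w2] stand for the first two space derivatives of [w], and [w2 / 2] for its time
    derivative: the two expansions below encode the heat equation together with its Taylor
    remainders, for times bounded away from 0. *)
Variables (w w1 w2 : R -> R -> R) (C t0 : R).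
Hypothesis C0 : 0 <= C.
Hypothesis w_space : forall t x d, t0 <= t ->
  `|w t (x + d) - w t x - d * w1 t x - d ^+ 2 / 2 * w2 t x| <= C * `|d| ^+ 3.
Hypothesis w_time : forall t x v, t0 <= t -> 0 <= v ->
  `|w (t + v) x - w t x - v / 2 * w2 t x| <= C * v ^+ 2.

(** Even moments of the increments can be computed by pairing rows, so the cubic Taylor remainder is
    traded for the second and the fourth moment; [e] balances the two. *)
Lemma cube_le (e d : R) : 0 < e -> `|d| ^+ 3 <= e * d ^+ 2 + e^-1 * d ^+ 4.
Proof.
move=> e0; rewrite (_ : d ^+ 4 = (d ^+ 2) ^+ 2); last by rewrite -exprM.
rewrite -(real_normK (num_real d)); move: (normr_ge0 d); set y := `|d| => y0.
have -> : e * y ^+ 2 + e^-1 * (y ^+ 2) ^+ 2 =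
    y ^+ 3 + e * y ^+ 2 * ((1 - y / e / 2) ^+ 2 + 3 / 4 * (y / e) ^+ 2).
  by field; rewrite gt_eqF.
rewrite lerDl mulr_ge0//; first by rewrite mulr_ge0 ?sqr_ge0// ltW.
by rewrite addr_ge0 ?sqr_ge0// mulr_ge0 ?sqr_ge0.
Qed.

Lemma cond_var_ge0 a U : 0 <= cond_var a U.
Proof. by apply: avg_ge0 => U'; rewrite sqr_ge0. Qed.

(** For [a = b] the site has been averaged out, otherwise [D a] does not see it. Hence the time
    argument stays frozen while any increment is swapped. *)
Lemma cond_var_free a b : free_of (J b) (cond_var a).
Proof.
have [->|ab] := eqVneq a b; first exact: free_of_resample.
by apply: free_of_resampleW => c d; rewrite Dfree.
Qed.

Lemma avg_cond_var_sqr a :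
  avg (fun U => cond_var a U ^+ 2) <= avg (fun U => D a U ^+ 4).
Proof.
rewrite -[leRHS](avg_resample S0 (J a)); apply: ler_avg => U.
rewrite /cond_var /resample (le_trans (sqr_avg_le _))//.
by apply: ler_avg => U'; rewrite -exprM.
Qed.

(** Hybrid of stage [j]: the increments before [j] enter the space argument, the remaining ones
    enter the time argument through their conditional variances. *)
Let x j U := T U + \sum_(a < n | (a < j)%N) D a U.
Let s j t U := t + \sum_(a < n | (j <= a)%N) cond_var a U.
Let Psi j t U := w (s j t U) (x j U).

Let mid_free (a : 'I_n) t (F : R -> R -> R) :
  free_of (J a) (fun U => F (s a.+1 t U) (x a U)).
Proof.
move=> c d; rewrite /s /x Tfree; congr (F (_ + _) (_ + _)).
  by apply: eq_bigr => b _; rewrite cond_var_free.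
by apply: eq_bigr => b ba; rewrite Dfree// neq_ltn ba.
Qed.

Let step (e t : R) (a : 'I_n) : 0 < e -> t0 <= t ->
  `|avg (Psi a.+1 t) - avg (Psi a t)| <=
  C * (e * avg (fun U => D a U ^+ 2) + (e^-1 + 1) * avg (fun U => D a U ^+ 4)).
Proof.
move=> e0 t0t.
pose st U := s a.+1 t U; pose xt U := x a U.
have sE U : s a t U = st U + cond_var a U.
  rewrite /st /s -addrA; congr (_ + _).
  rewrite (bigD1 a)//= addrC; congr (_ + _); apply: eq_bigl => b.
  by rewrite andbC [in RHS]ltn_neqAle eq_sym.
have xE U : x a.+1 U = xt U + D a U.
  rewrite /xt /x -addrA; congr (_ + _).
  rewrite (bigD1 a)//= addrC; congr (_ + _); apply: eq_bigl => b.
  by rewrite ltnS andbC [in RHS]ltn_neqAle.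
pose r1 U := w (st U) (xt U + D a U) - w (st U) (xt U) - D a U * w1 (st U) (xt U)
  - D a U ^+ 2 / 2 * w2 (st U) (xt U).
pose r2 U := w (st U + cond_var a U) (xt U) - w (st U) (xt U)
  - cond_var a U / 2 * w2 (st U) (xt U).
have st0 U : t0 <= st U.
  by rewrite (le_trans t0t)// lerDl sumr_ge0// => b _; exact: cond_var_ge0.
(* First order: [w1] at the intermediate point does not depend on the site of [a], and [D a] has
   conditional mean zero. *)
have zero1 : avg (fun U => D a U * w1 (st U) (xt U)) = 0.
  rewrite -(avg_resample S0 (J a)) -[RHS](avg0 R {ffun X -> S}); apply: eq_avg => U.
  by rewrite resample_mulr ?Dmean ?mul0r//; exact: mid_free.
(* Second order: the space and time terms differ by [D a ^+ 2] minus its conditional mean, so they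
   cancel once the site is redrawn. *)
have zero2 : avg (fun U => (D a U ^+ 2 - cond_var a U) * (w2 (st U) (xt U) / 2)) = 0.
  rewrite -(avg_resample S0 (J a)) -[RHS](avg0 R {ffun X -> S}); apply: eq_avg => U.
  rewrite resample_mulr; last exact: (mid_free _ _ (fun y z => w2 y z / 2)).
  rewrite resampleB -[X in X - _]/(cond_var a U).
  by rewrite (resample_free S0 (@cond_var_free a a)) subrr mul0r.
have -> : avg (Psi a.+1 t) - avg (Psi a t) = avg (fun U => r1 U - r2 U).
  rewrite -avgB -[LHS]subr0 -zero1 -avgB -[LHS]subr0 -zero2 -avgB; apply: eq_avg => U.
  by rewrite /Psi sE xE /r1 /r2; field.
apply: le_trans (ler_norm_avg _) _.
apply: (@le_trans _ _ (avg (fun U =>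
    C * (e * D a U ^+ 2 + e^-1 * D a U ^+ 4) + C * cond_var a U ^+ 2))).
  apply: ler_avg => U; rewrite (le_trans (ler_normB _ _))// lerD//.
    rewrite (le_trans (w_space _ _ _))// ler_wpM2l//; exact: cube_le.
  by rewrite w_time// cond_var_ge0.
rewrite avgD !avgZ avgD !avgZ -mulrDr ler_wpM2l// -addrA lerD2l mulrDl mul1r lerD2l.
exact: avg_cond_var_sqr.
Qed.

(** The steps telescope over the hybrids. The total variance is left random in the time argument,
    and [e] is left free for the balance made in [stage]. *)
Lemma lindeberg (e t : R) : 0 < e -> t0 <= t ->
  `|avg (fun U => w t (T U + \sum_a D a U)) -
    avg (fun U => w (t + \sum_a cond_var a U) (T U))| <=
  C * (e * (\sum_a avg (fun U => D a U ^+ 2)) +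
       (e^-1 + 1) * \sum_a avg (fun U => D a U ^+ 4)).
Proof.
move=> e0 t0t.
pose err (a : 'I_n) : R :=
  C * (e * avg (fun U => D a U ^+ 2) + (e^-1 + 1) * avg (fun U => D a U ^+ 4)).
have tele j : (j <= n)%N ->
    `|avg (Psi j t) - avg (Psi 0 t)| <= \sum_(a < n | (a < j)%N) err a.
  elim: j => [_|j IH jn]; first by rewrite subrr normr0 big1.
  rewrite -(subrK (avg (Psi j t)) (avg (Psi j.+1 t))) -addrA.
  rewrite (le_trans (ler_normD _ _))// (bigD1 (Ordinal jn))//= lerD//.
    exact: (step (Ordinal jn)).
  rewrite (le_trans (IH (ltnW jn)))// le_eqVlt; apply/orP; left; apply/eqP.
  by apply: eq_bigl => b; rewrite ltnS andbC [in LHS]ltn_neqAle.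
have -> : avg (fun U => w t (T U + \sum_a D a U)) = avg (Psi n t).
  apply: eq_avg => U; rewrite /Psi /s /x [X in t + X]big1 ?addr0; last first.
    by move=> a; rewrite leqNgt ltn_ord.
  by congr (w _ (_ + _)); apply: eq_bigl => a; rewrite ltn_ord.
have -> : avg (fun U => w (t + \sum_a cond_var a U) (T U)) = avg (Psi 0 t).
  by apply: eq_avg => U; rewrite /Psi /s /x [X in T U + X]big1 ?addr0.
apply: le_trans (tele n (leqnn n)) _.
rewrite !mulr_sumr -big_split /= mulr_sumr le_eqVlt; apply/orP; left; apply/eqP.
by apply: eq_bigl => a; rewrite ltn_ord.
Qed.

End lindeberg.

(** * Moments of the sums over rows that share a symbol *)

Section moments.
Variables (R : realType) (N K n h : nat) (H : 'M['I_n]_(N, K)).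
Hypotheses (N0 : (0 < N)%N) (n0 : (0 < n)%N) (h0 : (0 < h)%N) (hK : (h <= K)%N).
Hypotheses (HOA : is_OA h H) (Hfree : coincidence_free h H).
Notation labels := {ffun 'I_K * 'I_n -> 'I_n}.
Notation cell := {ffun 'I_K -> 'I_n}.
Implicit Types (A : {set 'I_K}) (i j l m : 'I_N) (U : labels) (g : cell -> R).

Let In0 : (0 < #|'I_n|)%N. Proof. by rewrite card_ord. Qed.

(** Degeneracy in the sense of U-statistics, up to order [h]; the remainder of the discrete ANOVA
    has it by [dremainder_degenerate]. *)
Definition degenerate g := forall A, (#|A| <= h)%N ->
  forall c, resample [pred k | k \notin A] g c = 0.

(* U carries an independent uniform label for every pair of a column and a
   symbol, instead of a permutation of the symbols in each column. *)
Definition label_row U i : cell := [ffun k => U (k, H i k)].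

Lemma label_row_mix (J : pred ('I_K * 'I_n)) U U' i :
  label_row (mix J U U') i =
  mix [pred k | J (k, H i k)] (label_row U i) (label_row U' i).
Proof. by apply/ffunP => k; rewrite !ffunE. Qed.

Let site_inj i : injective (fun k => (k, H i k)).
Proof. by move=> k l []. Qed.

Lemma avg_label_row g i : avg (fun U => g (label_row U i)) = avg g.
Proof. exact: (avg_comp_inj g In0 (@site_inj i)). Qed.

Lemma resample_label_row (J : pred ('I_K * 'I_n)) g U i :
  resample J (fun U => g (label_row U i)) U =
  resample [pred k | J (k, H i k)] g (label_row U i).
Proof.
rewrite /resample; under eq_avg do rewrite label_row_mix.
exact: (avg_label_row (fun d => g (mix _ (label_row U i) d))).
Qed.

Lemma eq_resample_pred (X S : finType) (J J' : pred X) (F : {ffun X -> S} -> R) :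
  J =1 J' -> resample J F =1 resample J' F.
Proof. by move=> JJ c; apply: eq_avg => d; congr F; apply/ffunP => x; rewrite !ffunE JJ. Qed.

Variables (g : cell -> R) (b : R) (k : 'I_K).
Hypotheses (g_deg : degenerate g) (b0 : 0 <= b) (g_bound : forall c, `|g c| <= b).

Let G U i := g (label_row U i).

(** Typical cases are the identity and the overwriting of one label of column [k]. They let a single
    vanishing lemma serve both fourth moments and products of conditional second moments, in which
    the two pairs see different redraws of column [k]. *)
Let column_map (m : labels -> labels) := forall J : pred ('I_K * 'I_n),
  (forall x, J x -> x.1 != k) -> forall U U', m (mix J U U') = mix J (m U) U'.

(** Redraw the labels carried by row [i] in the columns where it meets none of the other rows. These
    rows do not move, and at most [h] columns of row [i] stay fixed, so degeneracy makes its
    conditional mean zero. As [H i k = H j k], column [k] is not redrawn, and both maps commute with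
    the redraw. *)
Let vanish i j l m (m1 m2 : labels -> labels) :
  column_map m1 -> column_map m2 -> H i k = H j k -> ~~ covered h H i j l m ->
  avg (fun U => G (m1 U) i * G (m1 U) j * (G (m2 U) l * G (m2 U) m)) = 0.
Proof.
move=> cm1 cm2 ij; rewrite /covered -leqNgt; set A := _ :|: _ => Ah.
have kA : k \in A by rewrite !inE ij eqxx.
pose J : pred ('I_K * 'I_n) := [pred x | (x.1 \notin A) && (x.2 == H i x.1)].
have Jk x : J x -> x.1 != k by case/andP => xA _; apply: contraNneq xA => ->.
have row_fixed U U' q : (forall k', k' \notin A -> H i k' != H q k') ->
    label_row (mix J U U') q = label_row U q.
  move=> hq; apply/ffunP => k'; rewrite !ffunE /=; case: ifP => // /andP[k'A].
  by rewrite eq_sym (negbTE (hq _ k'A)).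
have avoid q : q \in [:: j; l; m] -> forall k', k' \notin A -> H i k' != H q k'.
  move=> + k'; rewrite !inE !negb_or => + /andP[/andP[hj hl] hm].
  by case/or3P => /eqP ->.
have [fj fl fm] : [/\ forall k', k' \notin A -> H i k' != H j k',
    forall k', k' \notin A -> H i k' != H l k' &
    forall k', k' \notin A -> H i k' != H m k'].
  by split; apply: avoid; rewrite !inE eqxx ?orbT.
rewrite -(avg_resample In0 J) -[RHS](avg0 R labels); apply: eq_avg => U.
rewrite /resample; under eq_avg => U'.
  rewrite !cm1 // !cm2 // /G (row_fixed _ _ j fj) (row_fixed _ _ l fl).
  rewrite (row_fixed _ _ m fm) -mulrA; over.
rewrite /= avgZr (_ : avg _ = 0) ?mul0r//.
rewrite -[LHS]/(resample J (fun U => G U i) (m1 U)) resample_label_row.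
rewrite -(g_deg Ah (label_row (m1 U) i)); apply: eq_resample_pred => k' /=.
by rewrite /J /= eqxx andbT.
Qed.

Let prod4_bound i j l m (U U' : labels) : `|G U i * G U j * (G U' l * G U' m)| <= b ^+ 4.
Proof.
rewrite !normrM (_ : b ^+ 4 = b * b * (b * b)); last by ring.
by rewrite /G !ler_pM ?mulr_ge0 ?g_bound.
Qed.

Let coveredC i j l m : covered h H i j l m = covered h H i l m j.
Proof. by rewrite /covered [in RHS]finset.setUC finset.setUA. Qed.

Let vanish_quad i j l m (m1 m2 : labels -> labels) :
  column_map m1 -> column_map m2 -> H i k = H j k -> H l k = H m k ->
  ~~ ((i == j) && (l == m)) -> ~~ quad h H k i j l m ->
  avg (fun U => G (m1 U) i * G (m1 U) j * (G (m2 U) l * G (m2 U) m)) = 0.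
Proof.
move=> cm1 cm2 ij lm ne; rewrite /quad ij lm !eqxx ne /= andbT !negb_and.
case/or4P => nc.
- exact: vanish.
- under eq_avg do rewrite [_ i * _]mulrC; exact: vanish.
- under eq_avg do rewrite mulrC; apply: vanish => //.
  by rewrite coveredC.
- under eq_avg do rewrite mulrC [_ l * _]mulrC; apply: vanish => //.
  by rewrite coveredC.
Qed.

Let rho : R := crowding R N n h.
Let C4 : R := 2 * (2 ^ K * 3 ^ K * (8 ^ K + K))%:R.

Let count_pairs k' : \sum_i \sum_l (H i k' == H l k')%:R = N%:R ^+ 2 * n%:R^-1 :> R.
Proof.
transitivity (\sum_(i < N) (N%:R * n%:R ^- 1) : R); last first.
  by rewrite sumr_const card_ord -[LHS]mulr_natl expr1 mulrA -expr2.
apply: eq_bigr => i _; rewrite -[1%N](cards1 k').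
rewrite -(@count_agree R N K n h H n0 HOA [set k']%SET (row_of H i)) ?cards1//.
apply: eq_bigr => l _; congr (_ (nat_of_bool _)).
apply/eqP/forall_inP => [e q|/(_ k')]; last by rewrite !inE eqxx ffunE => /(_ isT) /eqP.
by rewrite inE => /eqP ->; rewrite ffunE e.
Qed.

Let count_pairs_le k' : \sum_i \sum_l (H i k' == H l k')%:R <= N%:R ^+ 2 * rho.
Proof. by rewrite count_pairs ler_wpM2l ?sqr_ge0// (crowding_ge R n0 HOA). Qed.

Definition increment a U : R :=
  (Num.sqrt N%:R)^-1 * \sum_(i | H i k == a) G U i.

Let sqrtN2 : (Num.sqrt N%:R)^-1 ^+ 2 = N%:R^-1 :> R.
Proof. by rewrite exprVn sqr_sqrtr. Qed.

Let NR0 : N%:R != 0 :> R. Proof. by rewrite pnatr_eq0 -lt0n. Qed.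

Let sum_block (F : 'I_N -> 'I_N -> R) :
  \sum_a \sum_(i | H i k == a) \sum_(j | H j k == a) F i j =
  \sum_i \sum_(j | H j k == H i k) F i j.
Proof.
rewrite (partition_big (fun i => H i k) predT)//=; apply: eq_bigr => a _.
by apply: eq_bigr => i /eqP <-.
Qed.

Let sqr_increment a U : increment a U ^+ 2 =
  N%:R^-1 * \sum_(i | H i k == a) \sum_(j | H j k == a) G U i * G U j.
Proof.
rewrite /increment exprMn sqrtN2 expr2 big_distrl /=; congr (_ * _).
by apply: eq_bigr => i _; rewrite big_distrr.
Qed.

(** Distinct rows agree on at most [h] columns; redrawing the labels of row [i] elsewhere leaves row
    [j] fixed and averages row [i] to zero. *)
Lemma row_product_avg i j : i != j -> avg (fun U => G U i * G U j) = 0.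
Proof.
move=> ij; have Ah := agree_le Hfree ij; set A := agree H i j in Ah.
pose J : pred ('I_K * 'I_n) := [pred x | (x.1 \notin A) && (x.2 == H i x.1)].
rewrite -(avg_resample In0 J) -[RHS](avg0 R labels); apply: eq_avg => U.
rewrite resample_mulr; last first.
  move=> U1 U2; rewrite /G; congr g; apply/ffunP => k'; rewrite !ffunE /=.
  by case: ifP => // /andP[]; rewrite inE eq_sym => /negbTE ->.
rewrite resample_label_row.
rewrite (@eq_resample_pred _ _ _ [pred k' | k' \notin A]); last first.
  by move=> k' /=; rewrite /J /= eqxx andbT.
by rewrite g_deg// mul0r.
Qed.

Lemma avg_sqr_row i : avg (fun U => G U i * G U i) = avg (fun c => g c ^+ 2).
Proof. exact: (avg_label_row (fun c => g c ^+ 2)). Qed.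

Lemma increment_second_moment :
  \sum_a avg (fun U => increment a U ^+ 2) = avg (fun c => g c ^+ 2).
Proof.
rewrite -avg_sum; under eq_avg => U.
  under eq_bigr do rewrite sqr_increment.
  rewrite -mulr_sumr sum_block; over.
rewrite avgZ avg_sum (eq_bigr (fun=> avg (fun c => g c ^+ 2))).
  by rewrite sumr_const card_ord -[X in _ * X]mulr_natl mulrA mulVf// mul1r.
move=> i _; rewrite avg_sum (bigD1 i)//= avg_sqr_row big1 ?addr0// => j /andP[_ ij].
by rewrite row_product_avg// eq_sym.
Qed.

Lemma increment_free a a' : a != a' -> free_of (pred1 (k, a')) (increment a).
Proof.
move=> aa' U U'; rewrite /increment; congr (_ * _); apply: eq_bigr => i /eqP ia.
rewrite /G label_row_mix; congr g; apply/ffunP => k'; rewrite !ffunE /=.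
by case: eqP => // -[-> ia']; rewrite -ia -ia' eqxx in aa'.
Qed.

Lemma increment_mean (g_mean : forall c, resample (pred1 k) g c = 0) a U :
  resample (pred1 (k, a)) (increment a) U = 0.
Proof.
rewrite /increment resampleZ resample_sum big1 ?mulr0// => i /eqP ia.
rewrite resample_label_row -[RHS](g_mean (label_row U i)).
by apply: eq_resample_pred => k' /=; rewrite -ia xpair_eqE; case: eqP => // ->; rewrite eqxx.
Qed.

Let sum_diag (F : 'I_N -> 'I_N -> R) :
  \sum_i \sum_j \sum_l \sum_m ((i == j) && (l == m))%:R * F i l =
  \sum_i \sum_l F i l.
Proof.
apply: eq_bigr => i _; rewrite (bigD1 i)//= eqxx [X in _ + X]big1 ?addr0; last first.
  by move=> j /negbTE ij; rewrite eq_sym ij big1// => l _; rewrite big1// => m _; rewrite mul0r.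
apply: eq_bigr => l _; rewrite (bigD1 l)//= eqxx mul1r big1 ?addr0// => m /negbTE lm.
by rewrite eq_sym lm mul0r.
Qed.

(** Expanding the fourth power gives quadruples of rows with a common symbol in column [k]. By
    [vanish_quad] those in [quad] and those with [i = j] and [l = m] remain. Both kinds number O(N^2
    rho), the second because [i] and [l] share a symbol. *)
Lemma increment_fourth_moment :
  \sum_a avg (fun U => increment a U ^+ 4) <= b ^+ 4 * (C4 + 1) * rho.
Proof.
have E a : avg (fun U => increment a U ^+ 4) = N%:R^-1 ^+ 2 *
    \sum_(i | H i k == a) \sum_(j | H j k == a) \sum_(l | H l k == a)
      \sum_(m | H m k == a) avg (fun U => G U i * G U j * (G U l * G U m)).
  under eq_avg => U.
    rewrite (_ : _ ^+ 4 = (increment a U ^+ 2) ^+ 2); last by rewrite -exprM.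
    rewrite sqr_increment exprMn [X in _ * X]expr2 big_distrl /=; over.
  rewrite avgZ avg_sum; congr (_ * _); apply: eq_bigr => i _.
  under eq_avg => U do rewrite big_distrl /=.
  rewrite avg_sum; apply: eq_bigr => j _.
  under eq_avg => U do rewrite big_distrr /=.
  rewrite avg_sum; apply: eq_bigr => l _.
  under eq_avg => U do rewrite big_distrr /=.
  by rewrite avg_sum.
rewrite (eq_bigr _ (fun a _ => E a)) -mulr_sumr exprVn mulrC ler_pdivrMr ?exprn_gt0 ?ltr0n//.
apply: (@le_trans _ _ (b ^+ 4 * (\sum_i \sum_j \sum_l \sum_m (quad h H k i j l m)%:R
     + \sum_i \sum_l (H i k == H l k)%:R))); last first.
  apply: (@le_trans _ _ (b ^+ 4 * (C4 * (N%:R ^+ 2 * rho) + N%:R ^+ 2 * rho))).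
    rewrite ler_wpM2l ?exprn_ge0// lerD// ?count_pairs_le//.
    exact: (count_quad R N0 n0 h0 hK HOA Hfree).
  by rewrite le_eqVlt; apply/orP; left; apply/eqP; ring.
have -> : \sum_a \sum_(i | H i k == a) \sum_(j | H j k == a) \sum_(l | H l k == a)
      \sum_(m | H m k == a) avg (fun U => G U i * G U j * (G U l * G U m)) =
    \sum_i \sum_(j | H j k == H i k) \sum_(l | H l k == H i k)
      \sum_(m | H m k == H i k) avg (fun U => G U i * G U j * (G U l * G U m)).
  rewrite [RHS](partition_big (fun i => H i k) predT)//=; apply: eq_bigr => a _.
  by apply: eq_bigr => i /eqP <-.
rewrite -(sum_diag (fun i l => (H i k == H l k)%:R)) -big_split /= mulr_sumr ler_sum// => i _.
rewrite -big_split /= mulr_sumr big_mkcond ler_sum// => j _.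
have quad_ge0 l m : 0 <= b ^+ 4 * ((quad h H k i j l m)%:R +
    ((i == j) && (l == m))%:R * (H i k == H l k)%:R).
  by rewrite mulr_ge0 ?exprn_ge0// addr_ge0// mulr_ge0.
rewrite -big_split /= mulr_sumr; case: eqP => ij; last first.
  apply: sumr_ge0 => l _; rewrite -big_split /= mulr_sumr.
  by apply: sumr_ge0 => m _; exact: quad_ge0.
rewrite big_mkcond ler_sum// => l _; rewrite -big_split /= mulr_sumr.
case: eqP => li; last by apply: sumr_ge0 => m _; exact: quad_ge0.
rewrite big_mkcond ler_sum// => m _; case: eqP => mi; last exact: quad_ge0.
rewrite -li eqxx mulr1.
have le4 : avg (fun U => G U i * G U j * (G U l * G U m)) <= b ^+ 4.
  apply: avg_le_cst; first by rewrite exprn_ge0.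
  by move=> U; rewrite (le_trans (ler_norm _)).
have [dg|ndg] := boolP ((i == j) && (l == m)).
  by rewrite (le_trans le4)// ler_peMr ?exprn_ge0// lerDr.
have [q|nq] := boolP (quad h H k i j l m); first by rewrite addr0 mulr1.
rewrite addr0 mulr0 (@vanish_quad i j l m id id)//.
by rewrite li mi.
Qed.

Let cond_product i j U :=
  resample (pred1 (k, H i k)) (fun U => G U i * G U j) U.

Lemma cond_var_increment a U :
  cond_var (pair k) increment a U =
  N%:R^-1 * \sum_(i | H i k == a) \sum_(j | H j k == a) cond_product i j U.
Proof.
rewrite /cond_var; under eq_resample do rewrite sqr_increment.
rewrite resampleZ resample_sum; congr (_ * _); apply: eq_bigr => i /eqP ia.
by rewrite resample_sum /cond_product ia.
Qed.

(** For [i = j] and [l = m], rows that meet in no column read disjoint labels and the mean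
    factorizes into the squared variance; rows that meet are charged to the last sum. Otherwise the
    two conditional means are averages over separate samples [U1] and [U2]; once these are fixed,
    [vanish_quad] applies. *)
Let cond_product_avg i j l m : H i k = H j k -> H l k = H m k ->
  avg (fun U => cond_product i j U * cond_product l m U) <=
  b ^+ 4 * (quad h H k i j l m)%:R + ((i == j) && (l == m))%:R *
    (avg (fun c => g c ^+ 2) ^+ 2 + b ^+ 4 * \sum_k' (H i k' == H l k')%:R).
Proof.
move=> ij lm.
have b4 : 0 <= b ^+ 4 by rewrite exprn_ge0.
have s40 : 0 <= avg (fun c => g c ^+ 2) ^+ 2 by exact: sqr_ge0.
have q0 i' j' l' m' : 0 <= b ^+ 4 * (quad h H k i' j' l' m')%:R by rewrite mulr_ge0.
have cb i' j' U : `|cond_product i' j' U| <= b ^+ 2.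
  apply: resample_bound => [|U']; first by rewrite sqr_ge0.
  by rewrite normrM expr2 ler_pM ?g_bound.
have le4 : avg (fun U => cond_product i j U * cond_product l m U) <= b ^+ 4.
  apply: avg_le_cst => // U; rewrite (le_trans (ler_norm _))// normrM.
  by rewrite (_ : b ^+ 4 = b ^+ 2 * b ^+ 2) ?ler_pM -?exprD.
have [dg|ndg] := boolP ((i == j) && (l == m)).
  rewrite mul1r; case: (boolP [exists k', H i k' == H l k']) => [/existsP[k' hk']|nk].
    rewrite (le_trans le4)// (bigD1 k')//= hk' mulrDr mulr1.
    set S := \sum_(_ < _ | _) _; have S0 : 0 <= b ^+ 4 * S by rewrite mulr_ge0 ?sumr_ge0.
    by move: (q0 i j l m) s40 S0; lra.
  case/andP : dg => /eqP <- /eqP <-.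
  pose J : pred ('I_K * 'I_n) := [pred x | x.2 == H i x.1].
  rewrite (eq_avg (G := fun U => cond_product l l U * cond_product i i U)); last first.
    by move=> U; rewrite mulrC.
  have disj k' : (H l k' == H i k') = false.
    by apply/negbTE; move: nk; rewrite negb_exists => /forallP/(_ k'); rewrite eq_sym.
  rewrite (@avg_mul_indep _ _ _ In0 J).
  - rewrite /cond_product !avg_resample// !avg_sqr_row -expr2.
    set S := \sum_(_ < _) _; have S0 : 0 <= b ^+ 4 * S by rewrite mulr_ge0 ?sumr_ge0.
    by move: (q0 i i l l) S0; lra.
  - apply: free_of_resampleW => U U'; rewrite /G; congr (g _ * g _);
      by apply/ffunP => k'; rewrite !ffunE /J /= disj.
  - apply: free_of_resampleW => U U'; rewrite /G; congr (g _ * g _);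
      by apply/ffunP => k'; rewrite !ffunE /J /= eqxx.
rewrite mul0r addr0.
have [q|nq] := boolP (quad h H k i j l m); first by rewrite mulr1.
rewrite mulr0 /cond_product /resample.
under eq_avg => U.
  rewrite -avgZr; under eq_avg do rewrite -avgZ.
  over.
rewrite avg_exchange; under eq_avg do rewrite avg_exchange.
rewrite (eq_avg (G := fun=> 0)) ?avg0// => U1.
rewrite (eq_avg (G := fun=> 0)) ?avg0// => U2.
have cm a U' : column_map (fun U => mix (pred1 (k, a)) U U').
  move=> J Jk U U''; apply/ffunP => x; rewrite !ffunE /=.
  by case: ifP => [/eqP ->|//]; case: ifP => // /Jk; rewrite /= eqxx.
exact: (vanish_quad (cm (H i k) U1) (cm (H l k) U2)).
Qed.

(** The first term is the square of the mean of the summed variance, so the sum fluctuates by O(rho)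
    in mean square. This is what permits replacing the random time by its mean. *)
Lemma cond_var_second_moment :
  avg (fun U => (\sum_a cond_var (pair k) increment a U) ^+ 2) <=
  avg (fun c => g c ^+ 2) ^+ 2 + b ^+ 4 * (C4 + K%:R) * rho.
Proof.
under eq_avg => U.
  under eq_bigr do rewrite cond_var_increment.
  rewrite -mulr_sumr sum_block exprMn [X in _ * X]expr2 big_distrl /=; over.
rewrite avgZ avg_sum exprVn mulrC ler_pdivrMr ?exprn_gt0 ?ltr0n//.
set s4 := avg (fun c => g c ^+ 2) ^+ 2.
apply: (@le_trans _ _ (b ^+ 4 * (\sum_i \sum_j \sum_l \sum_m (quad h H k i j l m)%:R)
     + \sum_i \sum_l (s4 + b ^+ 4 * \sum_k' (H i k' == H l k')%:R))); last first.
  apply: (@le_trans _ _ (b ^+ 4 * (C4 * (N%:R ^+ 2 * rho)) +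
      (N%:R ^+ 2 * s4 + b ^+ 4 * (K%:R * (N%:R ^+ 2 * rho))))); last first.
    by rewrite le_eqVlt; apply/orP; left; apply/eqP; ring.
  rewrite lerD//.
    rewrite ler_wpM2l ?exprn_ge0//.
    exact: (count_quad R N0 n0 h0 hK HOA Hfree).
  under eq_bigr do rewrite big_split /= sumr_const card_ord -mulr_sumr.
  rewrite big_split /= -[X in _ + X]mulr_sumr lerD//.
    by rewrite sumr_const card_ord -mulrnA -[s4 *+ _]mulr_natl natrM -expr2.
  rewrite ler_wpM2l ?exprn_ge0//; under eq_bigr do rewrite exchange_big /=.
  rewrite exchange_big /= (le_trans (ler_sum _ (fun k' _ => count_pairs_le k')))//.
  by rewrite sumr_const card_ord -[leLHS]mulr_natl.
rewrite -(sum_diag (fun i l => s4 + b ^+ 4 * \sum_k' (H i k' == H l k')%:R)) mulr_sumr.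
rewrite -big_split /= ler_sum// => i _.
have RHS_ge0 j l m : 0 <= b ^+ 4 * (quad h H k i j l m)%:R +
    ((i == j) && (l == m))%:R * (s4 + b ^+ 4 * \sum_k' (H i k' == H l k')%:R).
  rewrite addr_ge0 ?mulr_ge0 ?exprn_ge0// addr_ge0 ?sqr_ge0// mulr_ge0 ?exprn_ge0//.
  by rewrite sumr_ge0.
under eq_avg => U do rewrite big_distrl /=.
rewrite avg_sum mulr_sumr -big_split /= big_mkcond ler_sum// => j _.
rewrite mulr_sumr -big_split /=; case: eqP => ij; last first.
  apply: sumr_ge0 => l _; rewrite mulr_sumr -big_split /=.
  by apply: sumr_ge0 => m _; exact: RHS_ge0.
under eq_avg => U do rewrite big_distrr /=.
rewrite avg_sum ler_sum// => l _; rewrite mulr_sumr -big_split /=.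
under eq_avg => U do rewrite big_distrr /=.
rewrite avg_sum big_mkcond ler_sum// => m _; case: eqP => lm; last exact: RHS_ge0.
exact: cond_product_avg.
Qed.

End moments.

(** * Lindeberg replacement over all columns *)

Section iid_labels.
Variables (R : realType) (N K n h : nat) (H : 'M['I_n]_(N, K)).
Hypotheses (N0 : (0 < N)%N) (n0 : (0 < n)%N) (h0 : (0 < h)%N) (hK : (h <= K)%N).
Hypotheses (HOA : is_OA h H) (Hfree : coincidence_free h H).
Notation labels := {ffun 'I_K * 'I_n -> 'I_n}.
Notation cell := {ffun 'I_K -> 'I_n}.
Variables (g : cell -> R) (B : R).
Hypotheses (g_deg : degenerate h g) (B0 : 0 <= B) (g_bound : forall c, `|g c| <= B).

Let In0 : (0 < #|'I_n|)%N. Proof. by rewrite card_ord. Qed.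
Let rho : R := crowding R N n h.
Let C4 : R := 2 * (2 ^ K * 3 ^ K * (8 ^ K + K))%:R.

Let rho_gt0 : 0 < rho.
Proof. by rewrite divr_gt0 ?exprn_gt0 ?ltr0n. Qed.

Definition label_sum (r : cell -> R) (U : labels) : R :=
  (Num.sqrt N%:R)^-1 * \sum_i r (label_row H U i).

(* Averaging out the columns from j on: the differences over j are martingale
   differences, so Lindeberg's replacement can proceed one column at a time. *)
Definition truncate (j : nat) : cell -> R := resample [pred l : 'I_K | (j <= l)%N] g.

Let diff (k : 'I_K) (c : cell) := truncate k.+1 c - truncate k c.

Let truncate_bound j c : `|truncate j c| <= B.
Proof. exact: resample_bound. Qed.

Let diff_bound k c : `|diff k c| <= 2 * B.
Proof. by rewrite (le_trans (ler_normB _ _))// mulr_natl mulr2n lerD. Qed.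

Let truncate_deg j : degenerate h (truncate j).
Proof.
move=> A Ah c; rewrite /truncate resampleU//.
rewrite (@eq_resample_pred _ _ _ _ (predU [pred l : 'I_K | (j <= l)%N] [pred k | k \notin A])).
  rewrite -resampleU//; rewrite (eq_resample _ (G := fun=> 0)); last exact: g_deg.
  exact: resample_cst.
by move=> k /=; rewrite orbC.
Qed.

Let diff_deg k : degenerate h (diff k).
Proof. by move=> A Ah c; rewrite resampleB !truncate_deg// subrr. Qed.

Let diff_mean k c : resample (pred1 k) (diff k) c = 0.
Proof.
rewrite resampleB /truncate resampleU// resample_absorb ?subrr//; last first.
  by move=> l /eqP ->; exact: leqnn.
rewrite (@eq_resample_pred _ _ _ _ [pred l : 'I_K | (k <= l)%N]) ?subrr// => l /=.
by rewrite [in RHS]leq_eqVlt eq_sym.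
Qed.

Let truncate_free (k : 'I_K) : free_of [pred l : 'I_K | (k <= l)%N] (truncate k).
Proof. exact: free_of_resample. Qed.

(** [diff k] averages to zero over the columns from [k] on, while [truncate k] does not depend on
    them; the cross term vanishes, and the variances of the stages add up to that of [g]. *)
Let pythagoras (k : 'I_K) : avg (fun c => truncate k.+1 c ^+ 2) =
  avg (fun c => diff k c ^+ 2) + avg (fun c => truncate k c ^+ 2).
Proof.
have orth : avg (fun c => diff k c * truncate k c) = 0.
  rewrite -(avg_resample In0 [pred l : 'I_K | (k <= l)%N]) -[RHS](avg0 R cell).
  apply: eq_avg => c; rewrite resample_mulr; last exact: truncate_free.
  rewrite resampleB /truncate resampleU// resample_absorb// -[X in X * _]/(_ - _).
  rewrite (@eq_resample_pred _ _ _ _ [pred l : 'I_K | (k <= l)%N]) ?subrr ?mul0r//.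
  by move=> l /=; apply/orb_idr => /ltnW.
rewrite -[RHS]addr0 -(mulr0 2) -orth -avgZ -!avgD; apply: eq_avg => c.
by rewrite /diff; ring.
Qed.

Variables (w w1 w2 : R -> R -> R) (C t0 : R).
Hypothesis C0 : 0 <= C.
Hypothesis w_space : forall t x d, t0 <= t ->
  `|w t (x + d) - w t x - d * w1 t x - d ^+ 2 / 2 * w2 t x| <= C * `|d| ^+ 3.
Hypothesis w_time : forall t x v, t0 <= t -> 0 <= v ->
  `|w (t + v) x - w t x - v / 2 * w2 t x| <= C * v ^+ 2.
Hypothesis w_lip : forall t t' x, t0 <= t -> t0 <= t' ->
  `|w t x - w t' x| <= C * `|t - t'|.

Let b : R := 2 * B.
Let b0 : 0 <= b. Proof. by rewrite mulr_ge0. Qed.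

(** In this order: the second and the fourth moment in the Lindeberg error, and the standard
    deviation of the summed conditional variances. *)
Let stage_error : R := b ^+ 2 + 2 * (b ^+ 4 * (C4 + 1)) + Num.sqrt (b ^+ 4 * (C4 + K%:R)).

Let sum_increment k U : \sum_a increment H (diff k) k a U =
  label_sum (diff k) U.
Proof.
rewrite /increment -mulr_sumr /label_sum; congr (_ * _).
by rewrite [RHS](partition_big (fun i => H i k) predT).
Qed.

Let label_sumD (r1 r2 : cell -> R) U :
  label_sum (fun c => r1 c - r2 c) U = label_sum r1 U - label_sum r2 U.
Proof. by rewrite /label_sum sumrB mulrBr. Qed.

Let stage (k : 'I_K) t : rho <= 1 -> t0 <= t ->
  `|avg (fun U => w t (label_sum (truncate k.+1) U)) -
    avg (fun U => w (t + avg (fun c => diff k c ^+ 2)) (label_sum (truncate k) U))| <=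
  C * stage_error * Num.sqrt rho.
Proof.
move=> rho1 t0t; set s2 := avg (fun c => diff k c ^+ 2).
have s20 : 0 <= s2 by apply: avg_ge0 => c; rewrite sqr_ge0.
set T := label_sum (truncate k); set D := increment H (diff k) k.
have srho : 0 < Num.sqrt rho by rewrite sqrtr_gt0.
have Tfree a : free_of (pred1 (k, a)) T.
  move=> U U'; rewrite /T /label_sum; congr (_ * _); apply: eq_bigr => i _.
  rewrite label_row_mix -[LHS](truncate_free k _ (label_row H U i)); congr truncate.
  apply/ffunP => l; rewrite !ffunE /=; case: leqP => // lk.
  by rewrite xpair_eqE; case: eqP => // lk'; rewrite lk' ltnn in lk.
(* The choice [e = Num.sqrt rho] balances [e] times the second moment, which is O(1), against [e^-1]
   times the fourth, which is O(rho). *)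
have lin := lindeberg In0 Tfree (increment_free H (diff k) k)
  (increment_mean H n0 (diff_mean k)) C0 w_space w_time srho t0t.
rewrite -/D in lin.
set V := fun U => \sum_a cond_var (pair k) D a U in lin.
have V0 U : 0 <= V U by rewrite sumr_ge0// => a _; exact: cond_var_ge0.
have avgV : avg V = s2.
  rewrite avg_sum /s2 -(increment_second_moment N0 n0 Hfree k (diff_deg k)).
  by apply: eq_bigr => a _; rewrite avg_resample.
have VV : avg (fun U => (V U - s2) ^+ 2) <= b ^+ 4 * (C4 + K%:R) * rho.
  under eq_avg do rewrite sqrrB.
  rewrite avgD avgB avg_cst ?card_ffun_gt0//.
  under [X in _ - X + _]eq_avg do rewrite -mulr_natr.
  rewrite !avgZr avgV.
  have := cond_var_second_moment N0 n0 h0 hK HOA Hfree k (diff_deg k) b0 (diff_bound k).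
  rewrite -/D -/V -/s2 -/rho -/C4; move: (_ * rho) => z; lra.
have Vs : avg (fun U => `|V U - s2|) <= Num.sqrt (b ^+ 4 * (C4 + K%:R)) * Num.sqrt rho.
  rewrite -sqrtrM; last by rewrite mulr_ge0 ?exprn_ge0// addr_ge0// mulr_ge0.
  rewrite -[leLHS]ger0_norm; last by apply: avg_ge0.
  rewrite -sqrtr_sqr ler_wsqrtr// (le_trans _ VV)// (le_trans (sqr_avg_le _))//.
  by apply: ler_avg => U; rewrite real_normK// num_real.
have -> : avg (fun U => w t (label_sum (truncate k.+1) U)) =
    avg (fun U => w t (T U + \sum_a D a U)).
  apply: eq_avg => U; rewrite sum_increment label_sumD /T; congr (w _ _); ring.
(* The comparison passes through the random time [t + V U]; the Lipschitz bound in time then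
   replaces [V U] by [s2]. *)
rewrite -(subrK (avg (fun U => w (t + V U) (T U))) (avg (fun U => w t _))) -addrA.
have -> : C * stage_error * Num.sqrt rho =
    C * (b ^+ 2 * Num.sqrt rho + 2 * (b ^+ 4 * (C4 + 1)) * Num.sqrt rho) +
    C * (Num.sqrt (b ^+ 4 * (C4 + K%:R)) * Num.sqrt rho).
  by rewrite /stage_error; ring.
rewrite (le_trans (ler_normD _ _))// lerD//.
  apply: le_trans lin _; rewrite ler_wpM2l//.
  have m2 : \sum_a avg (fun U => D a U ^+ 2) <= b ^+ 2.
    rewrite (increment_second_moment N0 n0 Hfree k (diff_deg k)).
    apply: avg_le_cst => [|c]; first by rewrite exprn_ge0.
    by rewrite -real_normK ?num_real// !expr2 ler_pM ?diff_bound.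
  have m4 := increment_fourth_moment N0 n0 h0 hK HOA Hfree k (diff_deg k) b0 (diff_bound k).
  rewrite -/D -/rho -/C4 in m4.
  rewrite lerD//; first by rewrite mulrC ler_wpM2r ?sqrtr_ge0.
  have c0 : 0 <= (Num.sqrt rho)^-1 + 1 by rewrite addr_ge0// invr_ge0 sqrtr_ge0.
  rewrite (le_trans (ler_wpM2l c0 m4))//.
  have M0 : 0 <= b ^+ 4 * (C4 + 1) by rewrite mulr_ge0 ?exprn_ge0// addr_ge0// mulr_ge0.
  have rhoE : rho = Num.sqrt rho * Num.sqrt rho by rewrite -expr2 sqr_sqrtr// ltW.
  have -> : b ^+ 4 * (C4 + 1) * rho =
      b ^+ 4 * (C4 + 1) * (Num.sqrt rho * Num.sqrt rho) by rewrite -rhoE.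
  move: M0 srho; set M := b ^+ 4 * _.
  set q := Num.sqrt rho => M0 q0.
  have -> : (q^-1 + 1) * (M * (q * q)) = M * (1 + q) * q by field; rewrite gt_eqF.
  rewrite (ler_wpM2r (ltW q0))// [leRHS]mulrC ler_wpM2l// -[2]/(1 + 1) lerD2l.
  by rewrite /q -sqrtr1 ler_wsqrtr.
rewrite -avgB (le_trans (ler_norm_avg _))//.
apply: (@le_trans _ _ (avg (fun U => C * `|V U - s2|))).
  apply: ler_avg => U; rewrite (le_trans (w_lip _ _ _))//.
  - by rewrite (le_trans t0t)// lerDl.
  - by rewrite (le_trans t0t)// lerDl.
  by rewrite opprD addrACA subrr add0r.
by rewrite avgZ ler_wpM2l.
Qed.

Definition iid_error : R := K%:R * stage_error.

(** Each column exchanges its part of the sum for a deterministic amount of time. When no column is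
    left, degeneracy for the empty set makes the sum zero, and by [pythagoras] the time spent is the
    whole variance. *)
Lemma iid_lindeberg t : rho <= 1 -> t0 <= t ->
  `|avg (fun U => w t (label_sum g U)) - w (t + avg (fun c => g c ^+ 2)) 0| <=
  C * iid_error * Num.sqrt rho.
Proof.
move=> rho1 t0t.
have main j : (j <= K)%N -> forall t, t0 <= t ->
    `|avg (fun U => w t (label_sum (truncate j) U)) -
      w (t + avg (fun c => truncate j c ^+ 2)) 0| <=
    j%:R * (C * stage_error * Num.sqrt rho).
  elim: j => [_|j IH jK] {t t0t}t t0t.
    have z c : truncate 0 c = 0.
      rewrite -(g_deg (A := finset.set0) _ c) ?cards0//.
      by apply: eq_resample_pred => k /=; rewrite finset.in_set0.
    rewrite mul0r; under [X in w (t + X)]eq_avg do rewrite z expr0n.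
    under eq_avg do rewrite /label_sum (eq_bigr (fun=> 0)) ?big1// mulr0.
    by rewrite avg0 addr0 avg_cst ?card_ffun_gt0// subrr normr0.
  have s0 : 0 <= avg (fun c => diff (Ordinal jK) c ^+ 2).
    by apply: avg_ge0 => c; rewrite sqr_ge0.
  have := IH (ltnW jK) (t + avg (fun c => diff (Ordinal jK) c ^+ 2)).
  rewrite (le_trans t0t) ?lerDl// -addrA -(pythagoras (Ordinal jK)) => /(_ isT) IHt.
  have := stage (Ordinal jK) rho1 t0t; rewrite /= => st.
  by rewrite -natr1 mulrDl mul1r [leRHS]addrC (le_trans _ (lerD st IHt))// ler_distD.
have := main K (leqnn K) t t0t.
have tK : truncate K = g.
  apply/funext => c; rewrite /truncate.
  rewrite (@eq_resample_pred _ _ _ _ pred0); last by move=> k /=; rewrite leqNgt ltn_ord.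
  by apply: resample_free => // c1 c2; congr g; apply/ffunP => k; rewrite !ffunE.
by rewrite tK /iid_error -!mulrA mulrCA.
Qed.

End iid_labels.

(** * From permutations to independent labels *)

Section product_average.
Variables (R : realType) (X S : finType).
Hypothesis S0 : (0 < #|S|)%N.

Lemma avg_prod (F : X -> S -> R) :
  avg (fun c : {ffun X -> S} => \prod_x F x (c x)) = \prod_x avg (F x).
Proof.
rewrite /avg -(bigA_distr_bigA F) big_split /= prodr_const; congr (_ * _).
by rewrite card_ffun natrX exprVn.
Qed.

Lemma avg_coord (F : S -> R) x :
  avg (fun c : {ffun X -> S} => F (c x)) = avg F.
Proof.
pose G y s := if y == x then F s else 1.
transitivity (avg (fun c : {ffun X -> S} => \prod_y G y (c y))).
  apply: eq_avg => c; rewrite (bigD1 x)//= /G eqxx big1 ?mulr1//.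
  by move=> y /negbTE ->.
rewrite avg_prod (bigD1 x)//= big1 ?mulr1.
  by apply: eq_avg => s; rewrite /G eqxx.
by move=> y /negbTE yx; rewrite (eq_avg (G := fun=> 1)) ?avg_cst// => s; rewrite /G yx.
Qed.

Lemma avg_coord_indep (F G : S -> R) x y : x != y -> avg F = 0 ->
  avg (fun c : {ffun X -> S} => F (c x) * G (c y)) = 0.
Proof.
move=> xy F0; rewrite (@avg_mul_indep _ _ _ S0 (pred1 y)).
- by rewrite avg_coord F0 mul0r.
- by move=> c d; rewrite ffunE /= (negbTE xy).
- by move=> c d; rewrite ffunE /= eqxx.
Qed.

End product_average.

(** * Order statistics of iid labels *)

Section sorting.
Variables (R : realType) (n : nat).
Hypothesis n0 : (0 < n)%N.
Notation column := {ffun 'I_n -> 'I_n}.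

Let In0 : (0 < #|'I_n|)%N. Proof. by rewrite card_ord. Qed.

Lemma sorting_perm_exists (u : column) : exists s : 'S_n,
  [forall a : 'I_n, forall b : 'I_n, (a <= b)%N ==> (u (s a) <= u (s b))%N].
Proof.
pose le (x y : 'I_n) := (x <= y)%N.
pose t := [tuple u a | a < n]; pose t' := sort_tuple le t.
have /tuple_permP[s st] : perm_eq t' t by rewrite perm_sort.
have nthE (a : 'I_n) : tnth t' a = u (s a).
  by rewrite (tnth_nth (u a)) st nth_mktuple tnth_mktuple.
exists s; apply/forallP => a; apply/forallP => b; apply/implyP => ab.
rewrite -!nthE !(tnth_nth (u a)).
have le_trans : transitive le by move=> x y z; exact: leq_trans.
have le_refl : reflexive le by move=> x; exact: leqnn.
have srt : sorted le t' by apply: sort_sorted => x y; exact: leq_total.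
by apply: (sorted_leq_nth le_trans le_refl (u a) srt); rewrite ?inE ?size_tuple ?ltn_ord.
Qed.

Definition sorting_perm (u : column) : 'S_n := xchoose (sorting_perm_exists u).

Lemma sorting_permP (u : column) (a b : 'I_n) : (a <= b)%N ->
  (u (sorting_perm u a) <= u (sorting_perm u b))%N.
Proof.
by have /forallP/(_ a)/forallP/(_ b)/implyP := xchooseP (sorting_perm_exists u).
Qed.

Let count_below (t : nat) (u : column) := #|[pred b | (u b <= t)%N]|.

Let count_below_sort t u :
  count_below t u = #|[pred a | (u (sorting_perm u a) <= t)%N]|.
Proof.
rewrite /count_below -[RHS](fintype.card_image (@perm_inj _ (sorting_perm u))).
apply: eq_card => b; rewrite !inE; apply/idP/fintype.imageP => [bt|[a]].
  by exists ((sorting_perm u)^-1 b)%g; rewrite ?inE permKV.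
by rewrite inE => ? ->.
Qed.

Let card_below q : (q <= n)%N -> #|[pred a : 'I_n | (a < q)%N]| = q.
Proof.
move=> qn; rewrite -sum1_card (eq_bigl (fun a : 'I_n => (a < q)%N))//.
by rewrite -(big_ord_widen n (fun=> 1%N) qn) sum1_card card_ord.
Qed.

Let fluctuation t (u : column) : R := (count_below t u)%:R - t.+1%:R.

(** The count is a sum of indicators of independent labels with mean (t+1)/n; once centred, they are
    uncorrelated and have squares at most 1. *)
Let fluctuation_variance t : (t < n)%N -> avg (fun u => fluctuation t u ^+ 2) <= n%:R.
Proof.
move=> tn; pose xi (v : 'I_n) : R := (v <= t)%N%:R - t.+1%:R / n%:R.
have nR : n%:R != 0 :> R by rewrite pnatr_eq0 -lt0n.
have xi0 : avg xi = 0.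
  rewrite avgB avg_cst// avg_indicator card_ord (_ : #|_| = t.+1) ?subrr//.
  by rewrite -(card_below tn); apply: eq_card => v; rewrite !inE.
have xi1 v : xi v * xi v <= 1.
  have t1 : 0 <= (t.+1%:R / n%:R : R) <= 1.
    by rewrite divr_ge0//= ler_pdivrMr ?ltr0n// mul1r ler_nat.
  rewrite /xi; move: t1; set p := t.+1%:R / n%:R; case: (v <= t)%N => /=; nra.
have flE u : fluctuation t u = \sum_b xi (u b).
  rewrite /xi sumrB sumr_const card_ord -[_ *+ n]mulr_natr divfK//.
  congr (_ - _); rewrite /count_below -sum1_card natr_sum big_mkcond /=.
  by apply: eq_bigr => b _; rewrite inE; case: ifP.
under eq_avg => u do rewrite flE expr2 big_distrl /=.
rewrite avg_sum; apply: (@le_trans _ _ (\sum_(b < n) 1)); last by rewrite sumr_const card_ord.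
apply: ler_sum => b _; under eq_avg => u do rewrite big_distrr /=.
rewrite avg_sum (bigD1 b)//= big1 ?addr0.
  by apply: avg_le_cst => // u; exact: xi1.
by move=> b' bb'; apply: avg_coord_indep => //; rewrite eq_sym.
Qed.

Let count_above (a : 'I_n) t (u : column) :
  (t < u (sorting_perm u a))%N -> (count_below t u <= a)%N.
Proof.
move=> ta; rewrite count_below_sort -[leqRHS](card_below (ltnW (ltn_ord a))).
apply: subset_leq_card; apply/fintype.subsetP => b; rewrite !inE => bt.
by rewrite ltnNge; apply/negP => /(sorting_permP u) ab; move: bt; rewrite leqNgt (leq_trans ta ab).
Qed.

Let count_below_ge (a : 'I_n) t (u : column) :
  (u (sorting_perm u a) <= t)%N -> (a < count_below t u)%N.
Proof.
move=> ta; rewrite count_below_sort -[X in (X <= _)%N](card_below (ltn_ord a)).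
apply: subset_leq_card; apply/fintype.subsetP => b; rewrite !inE ltnS => ba.
by rewrite (leq_trans _ ta)// sorting_permP.
Qed.

Let chebyshev_count t q (P : pred column) : (0 < q)%N -> (t < n)%N ->
  (forall u, P u -> q%:R <= `|fluctuation t u|) ->
  avg (fun u => (P u)%:R : R) <= n%:R / q%:R ^+ 2.
Proof.
move=> q0 tn Pq; rewrite ler_pdivlMr ?exprn_gt0 ?ltr0n// -avgZr.
rewrite (le_trans _ (fluctuation_variance tn))//; apply: ler_avg => u.
case: (boolP (P u)) => [/Pq le|_]; last by rewrite mul0r sqr_ge0.
by rewrite mul1r -[leRHS]real_normK ?num_real// ler_pXn2r// nnegrE.
Qed.

(** If the label at sorted position [a] exceeds a + q, at most [a] labels are at most a + q, where a
    + q + 1 are expected; the other side uses the threshold a - q - 1. Chebyshev bounds either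
    deviation by n/q^2. *)
Lemma sorted_far (a : 'I_n) q : (0 < q)%N ->
  avg (fun u : column => ((a + q < u (sorting_perm u a)) ||
                          (u (sorting_perm u a) + q < a))%N%:R : R) <=
  2 * (n%:R / q%:R ^+ 2).
Proof.
move=> q0; have nq0 : 0 <= n%:R / q%:R ^+ 2 :> R by rewrite divr_ge0 ?exprn_ge0.
apply: (@le_trans _ _ (avg (fun u : column => (a + q < u (sorting_perm u a))%N%:R +
    (u (sorting_perm u a) + q < a)%N%:R))).
  by apply: ler_avg => u; case: ltnP => _ /=; rewrite ?lerDl ?add0r.
rewrite avgD mulr_natl mulr2n lerD//.
  have [aq|aq] := ltnP (a + q) n; last first.
    rewrite (eq_avg (G := fun=> 0)) ?avg0// => u.
    by rewrite ltnNge (leq_trans _ aq)// ltnW.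
  apply: (chebyshev_count q0 aq) => u /count_above le.
  rewrite /fluctuation distrC ger0_norm; last first.
    by rewrite subr_ge0 ler_nat (leq_trans le)// -addnS leq_addr.
  rewrite -natrB; first by rewrite ler_nat leq_subRL; lia.
  by rewrite (leq_trans le)// -addnS leq_addr.
have [qa|qa] := leqP a q.
  rewrite (eq_avg (G := fun=> 0)) ?avg0// => u.
  by rewrite ltnNge (leq_trans qa)// leq_addl.
have tn : (a - q.+1 < n)%N by have := ltn_ord a; lia.
apply: (chebyshev_count q0 tn) => u uq.
have /count_below_ge le : (u (sorting_perm u a) <= a - q.+1)%N by lia.
rewrite /fluctuation ger0_norm; last by rewrite subr_ge0 ler_nat; lia.
by rewrite -natrB ?ler_nat; lia.
Qed.

End sorting.

(** * Joint law of two permuted rows *)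

Section permuted_rows.
Variables (R : realType) (N K n h : nat) (H : 'M['I_n]_(N, K)).
Hypotheses (N0 : (0 < N)%N) (n1 : (1 < n)%N).
Hypotheses (HOA : is_OA h H) (Hfree : coincidence_free h H).
Notation labels := {ffun 'I_K * 'I_n -> 'I_n}.
Notation cell := {ffun 'I_K -> 'I_n}.
Notation perms := {ffun 'I_K -> 'S_n}.
Implicit Types (p : perms) (x y c d : cell) (A J : {set 'I_K}).

Let n0 : (0 < n)%N. Proof. exact: ltnW. Qed.
Let In0 : (0 < #|'I_n|)%N. Proof. by rewrite card_ord. Qed.
Let Sn0 : (0 < #|'S_n|)%N. Proof. by apply/card_gt0P; exists 1%g. Qed.
Let nR : 0 < n%:R :> R. Proof. by rewrite ltr0n. Qed.

Definition perm_row p x : cell := [ffun k => p k (x k)].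

Lemma perm_row_bij p : bijective (perm_row p).
Proof.
exists (perm_row [ffun k => (p k)^-1%g]) => x; apply/ffunP => k.
  by rewrite !ffunE permK.
by rewrite !ffunE permKV.
Qed.

Let mul_perms (q : perms) p : perms := [ffun k => q k * p k]%g.

Let mul_perms_bij q : bijective (mul_perms q).
Proof.
exists (mul_perms [ffun k => (q k)^-1%g]) => p; apply/ffunP => k.
  by rewrite !ffunE mulKg.
by rewrite !ffunE mulKVg.
Qed.

Let perm_row_mul q p x : perm_row (mul_perms q p) x = perm_row p (perm_row q x).
Proof. by apply/ffunP => k; rewrite !ffunE permM. Qed.

(* Composing p with the transpositions of x k and x' k moves x to x' and fixes y. *)
Let avg_perm_pair_eq (F : cell -> cell -> R) x x' y :
  (forall k, x' k = x k \/ y k != x k /\ y k != x' k) ->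
  avg (fun p => F (perm_row p x') (perm_row p y)) =
  avg (fun p => F (perm_row p x) (perm_row p y)).
Proof.
move=> xy; pose q : perms := [ffun k => tperm (x k) (x' k)].
rewrite -[RHS](avg_reindex _ (mul_perms_bij q)); apply: eq_avg => p.
rewrite !perm_row_mul; congr (F (perm_row p _) (perm_row p _)).
  by apply/ffunP => k; rewrite !ffunE tpermL.
apply/ffunP => k; rewrite !ffunE; case: (xy k) => [->|[yx yx']].
  by rewrite tperm1 perm1.
by rewrite tpermD// eq_sym.
Qed.

(** Composing [p] with transpositions shows that the average is the same for every [x]; averaging
    over [x] then gives the uniform law, each [perm_row p] being a bijection. *)
Lemma avg_perm_row (F : cell -> R) x : avg (fun p => F (perm_row p x)) = avg F.
Proof.
transitivity (avg (fun x' : cell => avg (fun p => F (perm_row p x')))).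
  rewrite -[LHS](avg_cst _ (card_ffun_gt0 'I_K In0)); apply: eq_avg => x'.
  pose q : perms := [ffun k => tperm (x' k) (x k)].
  rewrite -(avg_reindex _ (mul_perms_bij q)); apply: eq_avg => p.
  rewrite perm_row_mul; congr (F (perm_row p _)).
  by apply/ffunP => k; rewrite !ffunE tpermR.
rewrite avg_exchange -[RHS](avg_cst _ (card_ffun_gt0 'I_K Sn0)); apply: eq_avg => p.
exact: (avg_reindex F (perm_row_bij p)).
Qed.

Section pair_bound.
Variables (g G : cell -> R) (B B' : R).
Hypotheses (g_deg : degenerate h g) (B0 : 0 <= B) (g_bound : forall c, `|g c| <= B).
Hypotheses (B'0 : 0 <= B') (G_bound : forall c, `|G c| <= B').

(** The indicator that the agreement set of [c] and [d] is exactly [A], in product form so that it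
    can be expanded and averaged factor by factor. *)
Let exact_weight A d c : R := \prod_k (if k \in A then (c k == d k)%:R
                                       else 1 - (c k == d k)%:R).

Let avg_agree_mul J d : avg (fun c => [forall k in J, c k == d k]%:R * g c) =
  n%:R ^- #|J| * resample [pred k | k \notin J] g d.
Proof.
rewrite -(avg_agree R n0 J d) -avgZr -(avg_resample In0 [pred k | k \notin J]).
apply: eq_avg => c; under eq_resample do rewrite mulrC.
rewrite resample_mulr; last first.
  move=> c1 c2; congr (_ (nat_of_bool _)); apply: eq_forallb_in => k kJ.
  by rewrite ffunE /= kJ.
rewrite mulrC; case: (boolP [forall k in J, _]) => [/forall_inP cd|_]; last by rewrite !mul0r.
rewrite !mul1r; apply: eq_avg => e; congr g; apply/ffunP => k; rewrite !ffunE /=.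
by case: ifP => // /negbFE /cd /eqP.
Qed.

(** Inclusion-exclusion over the sets [J] containing [A]: those of size at most [h] contribute
    nothing by degeneracy, and each of the others fixes at least [h.+1] coordinates. *)
Let avg_exact_weight A d :
  `|avg (fun c => exact_weight A d c * g c)| <= 2 ^+ K * (n%:R ^- h.+1 * B).
Proof.
have E c : exact_weight A d c = \sum_(J : {set 'I_K})
    ((A \subset J)%:R * (-1) ^+ #|J :\: A|) * [forall k in J, c k == d k]%:R.
  rewrite /exact_weight (eq_bigr (fun k =>
    (if k \in A then (c k == d k)%:R else - (c k == d k)%:R) + (k \notin A)%:R)).
    rewrite bigA_distr; apply: eq_bigr => J _.
    rewrite (indicator_forall_in R J (fun k => c k == d k)).
    have [AJ|/fintype.subsetPn[k kA kJ]] := boolP (A \subset J); last first.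
      by rewrite !mul0r (bigD1 k)//= (negbTE kJ) kA mul0r.
    rewrite mul1r -prodr_const [X in X * _]big_mkcond -big_split /=.
    apply: eq_bigr => k _; rewrite finset.in_setD andbC.
    case: (boolP (k \in J)) => kJ /=; first by case: (k \in A); rewrite ?mul1r ?mulN1r.
    by rewrite mulr1; case: (boolP (k \in A)) => // /(fintype.subsetP AJ); rewrite (negbTE kJ).
  by move=> k _; case: (k \in A); rewrite ?addr0// addrC.
under eq_avg do rewrite E mulr_suml.
rewrite avg_sum (le_trans (ler_norm_sum _ _ _))//.
apply: (@le_trans _ _ (\sum_(J : {set 'I_K}) n%:R ^- h.+1 * B)); last first.
  rewrite sumr_const -cardsT -powersetT card_powerset cardsT card_ord.
  by rewrite -[leLHS]mulr_natl natrX.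
apply: ler_sum => J _; under eq_avg do rewrite -[_ * _ * g _]mulrA.
rewrite avgZ avg_agree_mul normrM [X in X * _]normrM normrX normrN1 expr1n mulr1.
rewrite [X in _ * X]normrM.
have [Jh|hJ] := leqP #|J| h.
  by rewrite g_deg// normr0 !mulr0 mulr_ge0 ?invr_ge0 ?exprn_ge0.
rewrite -[leRHS]mul1r ler_pM ?normr_ge0 ?mulr_ge0//.
  by case: (_ \subset _); rewrite ?normr1 ?normr0.
rewrite ler_pM ?normr_ge0//; last exact: resample_bound.
rewrite ger0_norm ?invr_ge0 ?exprn_ge0// lef_pV2 ?posrE ?exprn_gt0//.
by rewrite ler_eXn2l ?ltr1n.
Qed.

(** Given the image of [y], the image of [x] is uniform over the cells that agree with it exactly on
    [A]. The mean is thus a ratio, with numerator bounded by [avg_exact_weight] and denominator at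
    least n^-|A| 2^-K, since 1 - 1/n is at least 1/2. The two factors 2^K make 4^K. *)
Lemma avg_perm_pair_bound x y A : A = [set k | x k == y k]%SET ->
  `|avg (fun p => g (perm_row p x) * G (perm_row p y))| <=
  4 ^+ K * B * B' * (n%:R ^+ #|A| / n%:R ^+ h.+1).
Proof.
move=> AE; set E := avg _.
have key : avg (exact_weight A y) * E =
    avg (fun p => G (perm_row p y) * avg (fun c => exact_weight A (perm_row p y) c * g c)).
  transitivity (avg (fun x' => exact_weight A y x' *
      avg (fun p => g (perm_row p x') * G (perm_row p y)))).
    rewrite -avgZr; apply: eq_avg => x'.
    have [->|w0] := eqVneq (exact_weight A y x') 0; first by rewrite !mul0r.
    congr (_ * _); apply/esym/(avg_perm_pair_eq (fun a b => g a * G b)) => k.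
    move: w0; rewrite /exact_weight (bigD1 k)//= mulf_eq0 negb_or => /andP[+ _].
    rewrite AE inE; case: (x k =P y k) => [->|/eqP xy].
      by rewrite pnatr_eq0 eqb0 negbK => /eqP ->; left.
    case: (x' k =P y k) => [_|/eqP x'y _]; first by rewrite subrr eqxx.
    by right; rewrite eq_sym xy eq_sym.
  under eq_avg => x'.
    rewrite -avgZ; over.
  rewrite avg_exchange; apply: eq_avg => p.
  rewrite -avgZ -[RHS](avg_reindex _ (perm_row_bij p)); apply: eq_avg => x'.
  have -> : exact_weight A (perm_row p y) (perm_row p x') = exact_weight A y x'.
    by apply: eq_bigr => k _; rewrite !ffunE (inj_eq perm_inj).
  by rewrite mulrA mulrC.
have weightE : avg (exact_weight A y) = n%:R ^- #|A| * (1 - n%:R^-1) ^+ #|~: A|.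
  have avg_eq k : avg (fun s : 'I_n => (s == y k)%:R) = n%:R^-1 :> R.
    by rewrite (avg_indicator R (pred1 (y k))) card1 card_ord div1r.
  rewrite (avg_prod (fun k (s : 'I_n) => if k \in A then (s == y k)%:R else 1 - (s == y k)%:R : R)).
  rewrite -exprVn -!prodr_const [X in _ = X * _]big_mkcond [X in _ = _ * X]big_mkcond.
  rewrite -big_split /=; apply: eq_bigr => k _; rewrite finset.in_setC.
  case: (k \in A) => /=; first by rewrite mulr1 avg_eq.
  by rewrite mul1r avgB avg_eq avg_cst.
have half : 2^-1 <= 1 - n%:R^-1 :> R.
  rewrite lerBrDr -lerBrDl (_ : 1 - 2^-1 = 2^-1); last by field.
  by rewrite lef_pV2 ?posrE// ler_nat.
have weight_ge : n%:R ^- #|A| * 2 ^- K <= avg (exact_weight A y).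
  rewrite weightE ler_wpM2l ?invr_ge0 ?exprn_ge0// -exprVn.
  apply: (@le_trans _ _ (2^-1 ^+ #|~: A|)).
    by rewrite ler_wiXn2l ?invr_ge0// ?invf_le1 ?ler1n// -[leqRHS]card_ord max_card.
  by rewrite lerXn2r ?nnegrE ?invr_ge0// (le_trans _ half)// invr_ge0.
have weight_gt0 : 0 < n%:R ^- #|A| * 2 ^- K :> R by rewrite mulr_gt0 ?invr_gt0 ?exprn_gt0.
have bound : `|avg (exact_weight A y) * E| <= 2 ^+ K * (n%:R ^- h.+1 * B) * B'.
  rewrite key norm_avg_le_cst ?mulr_ge0 ?invr_ge0 ?exprn_ge0// => p.
  by rewrite normrM [leRHS]mulrC ler_pM ?avg_exact_weight.
have : n%:R ^- #|A| * 2 ^- K * `|E| <= 2 ^+ K * (n%:R ^- h.+1 * B) * B'.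
  rewrite (le_trans _ bound)// [leRHS]normrM ler_wpM2r// (le_trans weight_ge)//.
  exact: ler_norm.
rewrite -ler_pdivlMl// => /le_trans; apply; rewrite le_eqVlt; apply/orP; left; apply/eqP.
rewrite (_ : 4 = 2 * 2) ?exprMn; last by rewrite -natrM.
by field; rewrite ?expf_neq0// ?pnatr_eq0 -?lt0n ?n0.
Qed.

End pair_bound.
End permuted_rows.

(** * Coupling of permutations with iid labels *)

Section coupling.
Variables (R : realType) (N K n h : nat) (H : 'M['I_n]_(N, K)).
Hypotheses (N0 : (0 < N)%N) (n1 : (1 < n)%N).
Hypotheses (HOA : is_OA h H) (Hfree : coincidence_free h H).
Notation labels := {ffun 'I_K * 'I_n -> 'I_n}.
Notation cell := {ffun 'I_K -> 'I_n}.
Notation perms := {ffun 'I_K -> 'S_n}.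
Implicit Types (p : perms) (x y c d : cell) (U : labels) (A : {set 'I_K}).

Let n0 : (0 < n)%N. Proof. exact: ltnW. Qed.
Let In0 : (0 < #|'I_n|)%N. Proof. by rewrite card_ord. Qed.
Let Sn0 : (0 < #|'S_n|)%N. Proof. by apply/card_gt0P; exists 1%g. Qed.
Let rho : R := crowding R N n h.
Let NR : N%:R != 0 :> R. Proof. by rewrite pnatr_eq0 -lt0n. Qed.

Definition perm_sum (r : cell -> R) p : R :=
  (Num.sqrt N%:R)^-1 * \sum_i r (perm_row p (row_of H i)).

Let sqrtN2 : (Num.sqrt N%:R)^-1 * (Num.sqrt N%:R)^-1 = N%:R^-1 :> R.
Proof. by rewrite -expr2 exprVn sqr_sqrtr. Qed.

Lemma label_sum_second_moment (g : cell -> R) : degenerate h g ->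
  avg (fun U => label_sum H g U ^+ 2) = avg (fun c => g c ^+ 2).
Proof.
move=> g_deg; rewrite /label_sum.
under eq_avg do rewrite exprMn exprVn sqr_sqrtr// expr2 big_distrl /=.
rewrite avgZ avg_sum (eq_bigr (fun=> avg (fun c => g c ^+ 2))).
  by rewrite sumr_const card_ord -[X in _ * X]mulr_natl mulKf.
move=> i _; under eq_avg do rewrite big_distrr /=.
rewrite avg_sum (bigD1 i)//= (avg_sqr_row H n0 g i) big1 ?addr0// => j ij.
by rewrite (row_product_avg n0 Hfree g_deg)// eq_sym.
Qed.

Section product_moment.
Variables (g G : cell -> R) (B B' : R).
Hypotheses (g_deg : degenerate h g) (B0 : 0 <= B) (g_bound : forall c, `|g c| <= B).
Hypotheses (B'0 : 0 <= B') (G_bound : forall c, `|G c| <= B').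

(** The diagonal gives the main term exactly, by [avg_perm_row]. Off it, N/n^|A| rows agree with [i]
    on [A], against n^|A|/n^(h+1) from [avg_perm_pair_bound]: each of at most 2^K sets costs 4^K B
    B' rho. Degeneracy is asked of [g] alone because [G] will also be [g] composed with order
    statistics. *)
Lemma perm_sum_product :
  `|avg (fun p => perm_sum g p * perm_sum G p) - avg (fun c => g c * G c)| <=
  8 ^+ K * B * B' * rho.
Proof.
pose m i j := avg (fun p => g (perm_row p (row_of H i)) * G (perm_row p (row_of H j))).
have row_bound i : `|\sum_j m i j - avg (fun c => g c * G c)| <= 8 ^+ K * B * B' * rho.
  rewrite (bigD1 i)//= {1}/m (avg_perm_row n1 (fun c => g c * G c)).
  rewrite addrAC subrr add0r.
  rewrite (le_trans (ler_norm_sum _ _ _))//.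
  pose w (A : {set 'I_K}) : R := n%:R ^+ #|A| / n%:R ^+ h.+1.
  have w0 A : 0 <= w A by rewrite divr_ge0 ?exprn_ge0.
  apply: (@le_trans _ _ (\sum_j \sum_(A : {set 'I_K} | (#|A| <= h)%N)
     4 ^+ K * B * B' * ([forall k in A, H j k == row_of H i k]%:R * w A))).
    rewrite big_mkcond ler_sum// => j _; case: eqP => [_|/eqP ij] /=.
      by apply: sumr_ge0 => A _; rewrite !mulr_ge0 ?exprn_ge0.
    have Ah : (#|agree H i j| <= h)%N by rewrite agree_le// eq_sym.
    rewrite (bigD1 (agree H i j))//= (_ : [forall k in _, _]); last first.
      by apply/forall_inP => k; rewrite inE ffunE eq_sym.
    rewrite mul1r (le_trans (avg_perm_pair_bound n1 g_deg B0 g_bound B'0 G_bound (erefl _)))//.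
    rewrite (_ : [set k | _]%SET = agree H i j); last first.
      by apply/setP => k; rewrite !inE !ffunE.
    by rewrite lerDl sumr_ge0// => A _; rewrite !mulr_ge0 ?exprn_ge0.
  rewrite exchange_big /=; apply: (@le_trans _ _
      (\sum_(A : {set 'I_K} | (#|A| <= h)%N) 4 ^+ K * B * B' * rho)).
    apply: ler_sum => A Ah; rewrite -mulr_sumr -mulr_suml (count_agree R n0 HOA)//.
    rewrite le_eqVlt; apply/orP; left; apply/eqP; congr (_ * _).
    by rewrite /w /rho /crowding -mulrA mulKf// expf_neq0// pnatr_eq0 -lt0n.
  rewrite sumr_const -[leLHS]mulr_natl (_ : 8 = 2 * 4); last by rewrite -natrM.
  rewrite exprMn -!mulrA ler_wpM2r ?mulr_ge0 ?exprn_ge0 ?crowding_ge0//.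
  rewrite -natrX ler_nat (leq_trans (max_card _))//.
  by rewrite -cardsT -powersetT card_powerset cardsT card_ord.
have -> : avg (fun p => perm_sum g p * perm_sum G p) = N%:R^-1 * \sum_i \sum_j m i j.
  rewrite /perm_sum; under eq_avg do rewrite mulrACA sqrtN2 big_distrl /=.
  rewrite avgZ avg_sum; congr (_ * _); apply: eq_bigr => i _.
  under eq_avg do rewrite big_distrr /=.
  by rewrite avg_sum.
rewrite [X in _ - X](_ : _ = N%:R^-1 * \sum_(i < N) avg (fun c => g c * G c)); last first.
  by rewrite sumr_const card_ord -[X in _ * X]mulr_natl mulKf.
rewrite -mulrBr -sumrB normrM ger0_norm ?invr_ge0// mulrC ler_pdivrMr ?ltr0n//.
rewrite (le_trans (ler_norm_sum _ _ _))// (le_trans (ler_sum _ (fun i _ => row_bound i)))//.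
by rewrite sumr_const card_ord -[leLHS]mulr_natr.
Qed.

End product_moment.

Definition column_of U k : {ffun 'I_n -> 'I_n} := [ffun a => U (k, a)].

(* A uniform permutation followed by order_stat U has the law of iid labels, while
   order_stat U itself moves symbols by little: this couples the two schemes. *)
Definition order_stat U : cell -> cell :=
  fun c => [ffun k => U (k, sorting_perm (column_of U k) (c k))].

Let permute_labels U p : labels := [ffun x => U (x.1, p x.1 x.2)].

(** For fixed [U], following a permutation by the sorting permutation is a bijection on
    permutations, which removes the sorting; for a fixed permutation, permuting the labels is a
    bijection on labels. *)
Lemma avg_permuted_order_stat (Phi : labels -> R) :
  avg (fun U => avg (fun p =>
    Phi [ffun x => U (x.1, sorting_perm (column_of U x.1) (p x.1 x.2))])) = avg Phi.
Proof.
transitivity (avg (fun U => avg (fun p : perms => Phi (permute_labels U p)))).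
  apply: eq_avg => U.
  pose s : perms := [ffun k => sorting_perm (column_of U k)].
  have bs : bijective (fun p : perms => [ffun k => p k * s k]%g : perms).
    exists (fun p : perms => [ffun k => p k * (s k)^-1]%g : perms) => p;
      by apply/ffunP => k; rewrite !ffunE ?mulgK ?mulgKV.
  rewrite -[RHS](avg_reindex _ bs); apply: eq_avg => p; congr Phi.
  by apply/ffunP => x; rewrite !ffunE permM.
rewrite avg_exchange -[RHS](avg_cst _ (card_ffun_gt0 'I_K Sn0)); apply: eq_avg => p.
apply: (avg_reindex Phi).
exists (fun U => permute_labels U [ffun k => (p k)^-1%g]) => U; apply/ffunP => -[k a].
  by rewrite !ffunE /= permKV.
by rewrite !ffunE /= permK.
Qed.

Variables (g : cell -> R) (B eta : R) (q : nat).
Hypotheses (g_deg : degenerate h g) (B0 : 0 <= B) (g_bound : forall c, `|g c| <= B).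
Hypotheses (q0 : (0 < q)%N) (eta0 : 0 <= eta).
Hypothesis g_modulus : forall c d,
  (forall k, (c k <= d k + q)%N && (d k <= c k + q)%N) -> `|g c - g d| <= eta.

Definition coupling_error : R :=
  2 * B * (eta + 2 * B * (K%:R * (2 * (n%:R / q%:R ^+ 2)))) + 3 * (8 ^+ K * B * B * rho).

(** The modulus [eta] serves unless some column moves its symbol by more than [q], which
    [sorted_far] and a union bound over the [K] columns make unlikely. *)
Let order_stat_close c :
  avg (fun U => `|g c - g (order_stat U c)|) <=
  eta + 2 * B * (K%:R * (2 * (n%:R / q%:R ^+ 2))).
Proof.
pose far (a v : 'I_n) : bool := (a + q < v)%N || (v + q < a)%N.
apply: (@le_trans _ _ (avg (fun U => eta + 2 * B * \sum_k (far (c k) (order_stat U c k))%:R))).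
  apply: ler_avg => U; case: (boolP [exists k, far (c k) (order_stat U c k)]).
    move=> /existsP[k fk]; rewrite -[leLHS]add0r lerD//.
    rewrite (@le_trans _ _ (2 * B))//.
      by rewrite (le_trans (ler_normB _ _))// mulr_natl mulr2n lerD.
    rewrite ler_peMr ?mulr_ge0// (bigD1 k)//= fk lerDl sumr_ge0//.
  rewrite negb_exists => /forallP nf.
  rewrite -[leLHS]addr0 lerD ?mulr_ge0 ?sumr_ge0// g_modulus// => k.
  by have := nf k; rewrite negb_or -!leqNgt andbC.
rewrite avgD avg_cst ?card_ffun_gt0// lerD2l avgZ ler_wpM2l ?mulr_ge0//.
rewrite avg_sum (le_trans (ler_sum _ (G := fun=> 2 * (n%:R / q%:R ^+ 2)) _))//; last first.
  by rewrite sumr_const card_ord -[leLHS]mulr_natl.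
move=> k _; apply: le_trans _ (sorted_far R n0 (c k) q0).
pose F (u : {ffun 'I_n -> 'I_n}) : R := (far (c k) (u (sorting_perm u (c k))))%:R.
have inj : injective (fun a : 'I_n => (k, a)) by move=> a b [].
rewrite le_eqVlt -(avg_comp_inj F In0 inj); apply/orP; left; apply/eqP.
by apply: eq_avg => U; rewrite /F /order_stat !ffunE.
Qed.

Let coupled U p := perm_sum g p - perm_sum (fun c => g (order_stat U c)) p.

(** In the expanded square, the second moment of the coupled sum is exactly that of [g] by
    [avg_permuted_order_stat]. The other square and the doubled cross term come from
    [perm_sum_product], whose error is thus counted three times. *)
Lemma coupling_bound : avg (fun U => avg (fun p => coupled U p ^+ 2)) <= coupling_error.
Proof.
pose W := perm_sum g; pose W' U := perm_sum (fun c => g (order_stat U c)).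
have E : avg (fun U => avg (fun p => coupled U p ^+ 2)) =
    avg (fun p => W p * W p) - 2 * avg (fun U => avg (fun p => W p * W' U p)) +
    avg (fun U => avg (fun p => W' U p ^+ 2)).
  rewrite -[X in X - _ + _](avg_cst _ (card_ffun_gt0 ('I_K * 'I_n)%type In0)).
  rewrite -avgZ -avgB -avgD; apply: eq_avg => U.
  by rewrite -avgZ -avgB -avgD; apply: eq_avg => p; rewrite /coupled -/(W p) -/(W' U p); ring.
have W'2 : avg (fun U => avg (fun p => W' U p ^+ 2)) = avg (fun c => g c ^+ 2).
  rewrite -(label_sum_second_moment g_deg).
  rewrite -(avg_permuted_order_stat (fun U => label_sum H g U ^+ 2)).
  apply: eq_avg => U; apply: eq_avg => p; congr (_ ^+ 2); congr (_ * _).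
  apply: eq_bigr => i _; congr g; apply/ffunP => k; by rewrite !ffunE.
have W2 : avg (fun p => W p * W p) <= avg (fun c => g c ^+ 2) + 8 ^+ K * B * B * rho.
  have := perm_sum_product g_deg B0 g_bound B0 g_bound.
  by rewrite ler_norml => /andP[_]; rewrite lerBlDl.
have WW' : avg (fun c => g c ^+ 2) - (eta + 2 * B * (K%:R * (2 * (n%:R / q%:R ^+ 2)))) * B -
    8 ^+ K * B * B * rho <= avg (fun U => avg (fun p => W p * W' U p)).
  apply: (@le_trans _ _ (avg (fun U => avg (fun c => g c * g (order_stat U c)) -
      8 ^+ K * B * B * rho))); last first.
    apply: ler_avg => U.
    have := perm_sum_product g_deg B0 g_bound B0 (fun c => g_bound (order_stat U c)).
    by rewrite ler_norml => /andP[+ _]; rewrite lerNl opprB lerBlDl -lerBlDr lerBlDl -lerBlDr.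
  rewrite avgB avg_cst ?card_ffun_gt0// lerD2r avg_exchange lerBlDr.
  rewrite -[X in _ + X](avg_cst _ (card_ffun_gt0 'I_K In0)) -avgD; apply: ler_avg => c.
  rewrite -lerBlDl expr2 -[X in X * _ - _](avg_cst _ (card_ffun_gt0 ('I_K * 'I_n)%type In0)).
  rewrite -avgZr -avgB (le_trans (ler_norm _))// (le_trans (ler_norm_avg _))//.
  apply: (@le_trans _ _ (avg (fun U => `|g c - g (order_stat U c)| * B))).
    by apply: ler_avg => U; rewrite -mulrBr normrM mulrC ler_wpM2l.
  by rewrite avgZr ler_wpM2r.
rewrite E W'2 /coupling_error; move: W2 WW'; set z := 8 ^+ K * B * B * rho.
set s := avg _; set y := eta + _; lra.
Qed.

Lemma perm_label_coupling (phi : R -> R) (L : R) : 0 <= L ->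
  (forall s t : R, `|phi s - phi t| <= L * `|s - t|) ->
  `|avg (fun p => phi (perm_sum g p)) - avg (fun U => phi (label_sum H g U))| <=
  L * Num.sqrt coupling_error.
Proof.
move=> L0 phiL.
have -> : avg (fun U => phi (label_sum H g U)) =
    avg (fun U => avg (fun p => phi (perm_sum (fun c => g (order_stat U c)) p))).
  rewrite -(avg_permuted_order_stat (fun U => phi (label_sum H g U))).
  apply: eq_avg => U; apply: eq_avg => p; congr phi; congr (_ * _).
  by apply: eq_bigr => i _; congr g; apply/ffunP => k; rewrite !ffunE.
rewrite -[X in X - _](avg_cst _ (card_ffun_gt0 ('I_K * 'I_n)%type In0)) -avgB.
rewrite (le_trans (ler_norm_avg _))//.
apply: (@le_trans _ _ (L * avg (fun U => avg (fun p => `|coupled U p|)))).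
  rewrite -avgZ; apply: ler_avg => U; rewrite -avgZ -avgB (le_trans (ler_norm_avg _))//.
  by apply: ler_avg => p; exact: phiL.
rewrite ler_wpM2l// -[leLHS]ger0_norm; last first.
  by apply: avg_ge0 => U; apply: avg_ge0.
rewrite -sqrtr_sqr ler_wsqrtr// (le_trans _ coupling_bound)// (le_trans (sqr_avg_le _))//.
apply: ler_avg => U; rewrite (le_trans (sqr_avg_le _))//.
by apply: ler_avg => p; rewrite real_normK ?num_real.
Qed.

End coupling.

(** * ANOVA of functions of the cell *)

Section discrete_anova.
Variables (R : realType) (K n : nat).
Hypothesis n0 : (0 < n)%N.
Notation cell := {ffun 'I_K -> 'I_n}.
Variable F : cell -> R.
Implicit Types (u v A : {set 'I_K}) (c : cell).

Let In0 : (0 < #|'I_n|)%N. Proof. by rewrite card_ord. Qed.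

Definition marginal A (G : cell -> R) : cell -> R := resample [pred k | k \notin A] G.

Fixpoint danova_rec (d : nat) u : cell -> R :=
  marginal u (fun c => F c - match d with
    | 0 => 0
    | d'.+1 => \sum_(v : {set 'I_K} | v \proper u) danova_rec d' v c
    end).

(* The recursion of the functional ANOVA on the cells of side 1/n. *)
Definition danova u : cell -> R := danova_rec #|u| u.

Lemma danova_rec_stable d u : (#|u| <= d)%N -> danova_rec d u =1 danova u.
Proof.
rewrite /danova; elim/ltn_ind: d u => -[|d] IH u ud c.
  by move: ud; rewrite leqn0 => /eqP ->.
have [u0|u0] := posnP #|u|.
  rewrite u0 /=; apply: eq_resample => {}c; congr (_ - _).
  by rewrite big_pred0// => v; apply/negbTE/negP => /proper_card; rewrite u0.
case cu : #|u| u0 => [//|e] _ /=; apply: eq_resample => {}c; congr (_ - _).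
apply: eq_bigr => v /proper_card; rewrite cu ltnS => ve.
have ed : (e <= d)%N by rewrite -ltnS -cu.
by rewrite (IH d) ?(leq_trans ve)// (IH e).
Qed.

Lemma danovaE u c : danova u c =
  marginal u (fun c => F c - \sum_(v : {set 'I_K} | v \proper u) danova v c) c.
Proof.
rewrite -(@danova_rec_stable #|u|.+1) //=; apply: eq_resample => {}c.
congr (_ - _); apply: eq_bigr => v vu; rewrite danova_rec_stable//.
by rewrite ltnW// proper_card.
Qed.

Lemma marginalI A u (G : cell -> R) c :
  marginal A (marginal u G) c = marginal (A :&: u) G c.
Proof.
rewrite /marginal resampleU//; apply: eq_resample_pred => k /=.
by rewrite finset.in_setI negb_and.
Qed.

Lemma danova_free u : free_of [pred k | k \notin u] (danova u).
Proof.
move=> c d; rewrite !danovaE; exact: free_of_resample.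
Qed.

Lemma marginal_free A u c : u \subset A -> marginal A (danova u) c = danova u c.
Proof.
move=> uA; apply: resample_free => // c1 c2.
rewrite -[LHS](@danova_free u _ c1); congr danova; apply/ffunP => k; rewrite !ffunE /=.
case: (boolP (k \in u)) => //= ku; case: ifP => //.
by rewrite (fintype.subsetP uA).
Qed.

(** The recursion for [danova A] is this identity solved for the term [v = A]: the components of
    proper subsets are unchanged by the marginal. *)
Lemma marginal_sum A c :
  marginal A F c = \sum_(v : {set 'I_K} | v \subset A) danova v c.
Proof.
rewrite (bigD1 A)//= danovaE [X in _ = X + _]/marginal resampleB resample_sum.
rewrite -[X in X - _]/(marginal A F c).
have -> : \sum_(v : {set 'I_K} | v \proper A) resample [pred k | k \notin A] (danova v) c =
    \sum_(v : {set 'I_K} | (v \subset A) && (v != A)) danova v c.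
  apply: eq_big => [v|v /fintype.proper_sub vA]; first by rewrite finset.properEneq andbC.
  exact: marginal_free.
by rewrite subrK.
Qed.

(** Strong induction on |u|. In the marginal on [A :&: u] of the recursion, [marginal_sum] yields
    the components inside [A :&: u], which the subtracted sum cancels; the other subtracted
    components vanish by induction. *)
Lemma marginal_danova0 A u c : ~~ (u \subset A) -> marginal A (danova u) c = 0.
Proof.
have [m] := ubnP #|u|; elim: m u c A => // m IH u c A um uA.
have -> : marginal A (danova u) c = marginal A
    (marginal u (fun c => F c - \sum_(v : {set 'I_K} | v \proper u) danova v c)) c.
  by apply: eq_resample => d; exact: danovaE.
rewrite marginalI {1}/marginal resampleB resample_sum.
rewrite -[X in X - _]/(marginal _ _ _) marginal_sum.
rewrite [X in _ - X](bigID (fun v : {set 'I_K} => v \subset A :&: u))/=.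
rewrite [X in _ - (_ + X)]big1 ?addr0 => [|v /andP[vu vA]]; last first.
  by apply: IH => //; rewrite (leq_trans (proper_card vu)).
apply/eqP; rewrite subr_eq0; apply/eqP; apply: eq_big => [v|v vA]; last first.
  by rewrite -[RHS]/(marginal (A :&: u) (danova v) c) marginal_free.
have [vA|_] := boolP (v \subset A :&: u); last by rewrite andbF.
rewrite andbT; apply/esym; rewrite properE (fintype.subset_trans vA) ?finset.subsetIr//=.
by apply: contra uA => uv; apply: fintype.subset_trans (finset.subsetIl A u); exact: fintype.subset_trans vA.
Qed.

Variable h : nat.

Definition dremainder c : R :=
  F c - avg F - \sum_(u : {set 'I_K} | (0 < #|u| <= h)%N) danova u c.

Lemma marginal0 (G : cell -> R) c : marginal finset.set0 G c = avg G.
Proof.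
rewrite -(resample_all G c); apply: eq_resample_pred => k /=.
by rewrite finset.in_set0.
Qed.

Lemma danova0 c : danova finset.set0 c = avg F.
Proof.
rewrite danovaE marginal0; apply: eq_avg => d.
by rewrite big_pred0 ?subr0// => v; rewrite properE finset.sub0set andbF.
Qed.

Lemma avg_danova u : u != finset.set0 -> avg (danova u) = 0.
Proof.
move=> u0; rewrite -(marginal0 _ [ffun=> Ordinal n0]) marginal_danova0//.
by rewrite finset.subset0.
Qed.

Lemma dremainderE c : dremainder c =
  F c - \sum_(u : {set 'I_K} | (#|u| <= h)%N) danova u c.
Proof.
rewrite /dremainder [in RHS](bigD1 finset.set0) ?cards0//= danova0 opprD addrA.
congr (_ - _); apply: eq_bigl => u.
by rewrite -card_gt0 andbC.
Qed.

(** The marginal of [F] on [A] consists of components within [A], all of order at most [h] and hence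
    subtracted; the marginals of the other components vanish. *)
Lemma dremainder_degenerate : degenerate h dremainder.
Proof.
move=> A Ah c; rewrite (eq_resample _ dremainderE) resampleB resample_sum.
rewrite -[X in X - _]/(marginal A F c) marginal_sum.
rewrite [X in _ - X](bigID (fun v : {set 'I_K} => v \subset A))/=.
rewrite [X in _ - (_ + X)]big1 ?addr0 => [|v /andP[_ vA]]; last exact: marginal_danova0.
apply/eqP; rewrite subr_eq0; apply/eqP; apply: eq_big => [v|v vA].
  case: (boolP (v \subset A)) => [vA|_]; last by rewrite andbF.
  by rewrite andbT (leq_trans (subset_leq_card vA)).
by rewrite -[RHS]/(marginal A (danova v) c) marginal_free.
Qed.

(** The array integrates a component of order at most [h] exactly, for each fixed [p], and the
    component has mean zero. This is the variance reduction of the design. *)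
Lemma sum_danova (N : nat) (H : 'M['I_n]_(N, K)) (p : {ffun 'I_K -> 'S_n}) u :
  is_OA h H -> (0 < #|u| <= h)%N ->
  \sum_i danova u (perm_row p (row_of H i)) = 0.
Proof.
move=> HOA /andP[u0 uh].
rewrite (OA_balance n0 HOA (A := u) (G := fun x => danova u (perm_row p x)))//.
  rewrite (avg_reindex _ (perm_row_bij p)) avg_danova ?mulr0//.
  by rewrite -card_gt0.
move=> c d; rewrite -[RHS](danova_free u (perm_row p c) (perm_row p d)); congr danova.
by apply/ffunP => k; rewrite !ffunE /=; case: ifP.
Qed.

Lemma perm_sum_dremainder (N : nat) (H : 'M['I_n]_(N, K)) (p : {ffun 'I_K -> 'S_n}) :
  is_OA h H ->
  perm_sum H dremainder p = perm_sum H (fun c => F c - avg F) p.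
Proof.
move=> HOA; congr (_ * _).
rewrite [LHS]sumrB exchange_big /= [X in _ - X]big1 ?subr0// => u uh.
exact: sum_danova.
Qed.

(** A level of the recursion subtracts at most 2^K components from [F], so sup norms and moduli grow
    by at most this factor per level. *)
Definition anova_factor : R := 1 + 2 ^+ K.

Let factor_ge1 : 1 <= anova_factor.
Proof. by rewrite lerDl exprn_ge0. Qed.

Let sum_proper_le (u : {set 'I_K}) (a : R) : 0 <= a ->
  \sum_(v : {set 'I_K} | v \proper u) a <= 2 ^+ K * a.
Proof.
move=> a0; rewrite sumr_const -[leLHS]mulr_natl ler_wpM2r// -natrX ler_nat.
by rewrite (leq_trans (max_card _))// -cardsT -powersetT card_powerset cardsT card_ord.
Qed.

Lemma danova_rec_bound (B : R) d u c : 0 <= B -> (forall c, `|F c| <= B) ->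
  `|danova_rec d u c| <= anova_factor ^+ d.+1 * B.
Proof.
move=> B0 FB; elim: d u c => [|d IH] u c.
  apply: resample_bound => [|e]; first by rewrite mulr_ge0 ?exprn_ge0// addr_ge0 ?exprn_ge0.
  by rewrite subr0 (le_trans (FB _))// expr1 ler_peMl.
have f0 : 0 <= anova_factor by rewrite (le_trans _ factor_ge1).
apply: resample_bound => [|e]; first by rewrite mulr_ge0 ?exprn_ge0.
rewrite (le_trans (ler_normB _ _))// exprS -mulrA mulrDl mul1r lerD//.
  by rewrite (le_trans (FB _))// ler_peMl// exprn_ege1.
rewrite (le_trans (ler_norm_sum _ _ _))// (le_trans (ler_sum _ (fun v _ => IH v e)))//.
by rewrite sum_proper_le ?mulr_ge0 ?exprn_ge0.
Qed.

Lemma danova_rec_modulus (w : R) (q : nat) d u c c' : 0 <= w ->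
  (forall c c', (forall k, (c k <= c' k + q)%N && (c' k <= c k + q)%N) ->
     `|F c - F c'| <= w) ->
  (forall k, (c k <= c' k + q)%N && (c' k <= c k + q)%N) ->
  `|danova_rec d u c - danova_rec d u c'| <= anova_factor ^+ d.+1 * w.
Proof.
have f0 : 0 <= anova_factor by rewrite (le_trans _ factor_ge1).
move=> w0 Fw; elim: d u c c' => [|d IH] u c c' cc'.
  rewrite /= /marginal /resample -avgB; apply: norm_avg_le_cst => [|e].
    by rewrite mulr_ge0 ?exprn_ge0.
  rewrite !subr0 expr1 (le_trans (Fw _ _ _)) ?ler_peMl// => k.
  by rewrite !ffunE; case: ifP => _; rewrite ?leq_addr.
rewrite /= /marginal /resample -avgB; apply: norm_avg_le_cst => [|e].
  by rewrite mulr_ge0 ?exprn_ge0.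
have mm k : (mix [pred k | k \notin u] c e k <= mix [pred k | k \notin u] c' e k + q)%N &&
    (mix [pred k | k \notin u] c' e k <= mix [pred k | k \notin u] c e k + q)%N.
  by rewrite !ffunE; case: ifP => _; rewrite ?leq_addr.
set z := mix _ c e in mm *; set z' := mix _ c' e in mm *.
rewrite (_ : _ - _ - _ = F z - F z' -
    \sum_(v : {set 'I_K} | v \proper u) (danova_rec d v z - danova_rec d v z')); last first.
  by rewrite sumrB; ring.
rewrite (le_trans (ler_normB _ _))// exprS -mulrA mulrDl mul1r lerD//.
  by rewrite (le_trans (Fw _ _ mm))// ler_peMl// exprn_ege1.
rewrite (le_trans (ler_norm_sum _ _ _))// (le_trans (ler_sum _ (fun v _ => IH v _ _ mm)))//.
by rewrite sum_proper_le ?mulr_ge0 ?exprn_ge0.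
Qed.

Let factor_le u : anova_factor ^+ #|u|.+1 <= anova_factor ^+ K.+1.
Proof.
rewrite ler_weXn2l// ltnS (leq_trans (max_card _))//.
by rewrite card_ord.
Qed.

Let sum_all_le (P : pred {set 'I_K}) (a : R) (E : {set 'I_K} -> R) : 0 <= a ->
  (forall u, `|E u| <= anova_factor ^+ K.+1 * a) ->
  `|\sum_(u : {set 'I_K} | P u) E u| <= 2 ^+ K * (anova_factor ^+ K.+1 * a).
Proof.
move=> a0 Ea; have f0 : 0 <= anova_factor by rewrite (le_trans _ factor_ge1).
rewrite (le_trans (ler_norm_sum _ _ _))// (le_trans (ler_sum _ (fun u _ => Ea u)))//.
rewrite sumr_const -[leLHS]mulr_natl ler_wpM2r ?mulr_ge0 ?exprn_ge0// -natrX ler_nat.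
by rewrite (leq_trans (max_card _))// -cardsT -powersetT card_powerset cardsT card_ord.
Qed.

Let factor_split (a : R) : 0 <= a ->
  a + 2 ^+ K * (anova_factor ^+ K.+1 * a) <= anova_factor ^+ K.+2 * a.
Proof.
move=> a0; rewrite [anova_factor ^+ K.+2]exprS -mulrA {2}/anova_factor mulrDl mul1r.
by rewrite lerD2r ler_peMl// exprn_ege1.
Qed.

Lemma dremainder_bound (B : R) c : 0 <= B -> (forall c, `|F c| <= B) ->
  `|dremainder c| <= anova_factor ^+ K.+2 * B.
Proof.
move=> B0 FB; rewrite dremainderE (le_trans _ (factor_split B0))//.
rewrite (le_trans (ler_normB _ _))// lerD// sum_all_le// => u.
by rewrite (le_trans (danova_rec_bound _ _ _ B0 FB))// ler_wpM2r.
Qed.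

Lemma dremainder_modulus (w : R) (q : nat) c c' : 0 <= w ->
  (forall c c', (forall k, (c k <= c' k + q)%N && (c' k <= c k + q)%N) ->
     `|F c - F c'| <= w) ->
  (forall k, (c k <= c' k + q)%N && (c' k <= c k + q)%N) ->
  `|dremainder c - dremainder c'| <= anova_factor ^+ K.+2 * w.
Proof.
move=> w0 Fw cc'; rewrite !dremainderE (le_trans _ (factor_split w0))//.
rewrite (_ : _ - _ - _ = F c - F c' -
    \sum_(u : {set 'I_K} | (#|u| <= h)%N) (danova u c - danova u c')); last first.
  by rewrite sumrB; ring.
rewrite (le_trans (ler_normB _ _))// lerD ?Fw// sum_all_le// => u.
by rewrite (le_trans (danova_rec_modulus _ _ w0 Fw cc'))// ler_wpM2r.
Qed.

End discrete_anova.

(** * Noise inside the cells *)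

Section cell_noise.
Variables (R : realType) (N K n M : nat) (H : 'M['I_n]_(N, K)).
Hypotheses (N0 : (0 < N)%N) (n0 : (0 < n)%N) (M0 : (0 < M)%N).
Notation cell := {ffun 'I_K -> 'I_n}.
Notation subcell := {ffun 'I_K -> 'I_M}.
Notation perms := {ffun 'I_K -> 'S_n}.
Notation noise := {ffun 'I_N * 'I_K -> 'I_M}.
Variable f : cell -> subcell -> R.

Let IM0 : (0 < #|'I_M|)%N. Proof. by rewrite card_ord. Qed.
Let SN0 : (0 < #|'S_N|)%N. Proof. by apply/card_gt0P; exists 1%g. Qed.
Definition cell_mean (c : cell) : R := avg (f c).

Definition noise_row (e : noise) i : subcell := [ffun k => e (i, k)].

Definition noisy_sum (s : 'S_N) (p : perms) (e : noise) : R :=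
  (Num.sqrt N%:R)^-1 * \sum_i (f (perm_row p (row_of H (s^-1 i)%g)) (noise_row e i)
                               - avg cell_mean).

Variable w : R.
Hypothesis w0 : 0 <= w.
Hypothesis f_osc : forall c e, `|f c e - cell_mean c| <= w.

Let noise_sum s p e := noisy_sum s p e - perm_sum H (fun c => cell_mean c - avg cell_mean) p.

Let noise_sumE s p e : noise_sum s p e = (Num.sqrt N%:R)^-1 *
  \sum_i (f (perm_row p (row_of H (s^-1 i)%g)) (noise_row e i)
          - cell_mean (perm_row p (row_of H (s^-1 i)%g))).
Proof.
rewrite /noise_sum /noisy_sum /perm_sum -mulrBr; congr (_ * _).
(* A sum over all rows absorbs the row permutation [s]. *)
rewrite [X in _ - X](reindex_inj (@perm_inj _ s^-1%g)) /= -sumrB.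
by apply: eq_bigr => i _; ring.
Qed.

Let avg_noise_row (F : subcell -> R) i :
  avg (fun e : noise => F (noise_row e i)) = avg F.
Proof.
have inj : injective (fun k : 'I_K => (i, k)) by move=> k l [].
exact: (avg_comp_inj F IM0 inj).
Qed.

(** For fixed [s] and [p] the terms of distinct rows read disjoint noise and are centred,
    [cell_mean] being the average over the noise. *)
Let noise_variance s p : avg (fun e => noise_sum s p e ^+ 2) <= w ^+ 2.
Proof.
pose xi i (d : subcell) := f (perm_row p (row_of H (s^-1 i)%g)) d
  - cell_mean (perm_row p (row_of H (s^-1 i)%g)).
have xi0 i : avg (xi i) = 0.
  by rewrite /xi avgB avg_cst ?card_ffun_gt0// subrr.
under eq_avg do rewrite noise_sumE exprMn exprVn sqr_sqrtr// expr2 big_distrl /=.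
rewrite avgZ avg_sum mulrC ler_pdivrMr ?ltr0n//.
apply: (@le_trans _ _ (\sum_(i < N) w ^+ 2)); last first.
  by rewrite sumr_const card_ord -[leLHS]mulr_natr.
apply: ler_sum => i _; under eq_avg do rewrite big_distrr /=.
rewrite avg_sum (bigD1 i)//= big1 ?addr0 => [|j ji].
  apply: avg_le_cst => [|e]; first by rewrite sqr_ge0.
  by rewrite -expr2 -real_normK ?num_real// ler_pXn2r ?nnegrE ?f_osc.
rewrite (@avg_mul_indep _ _ _ IM0 (fun x => x.1 == j) (fun e => xi i (noise_row e i))
    (fun e => xi j (noise_row e j))).
- by rewrite (avg_noise_row (xi i)) xi0 mul0r.
- move=> e e'; congr xi; apply/ffunP => k; rewrite !ffunE /=.
  by rewrite eq_sym (negbTE ji).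
- by move=> e e'; congr xi; apply/ffunP => k; rewrite !ffunE /= eqxx.
Qed.

Lemma noise_smoothing (phi : R -> R) (L : R) : 0 <= L ->
  (forall x y : R, `|phi x - phi y| <= L * `|x - y|) ->
  `|avg (fun t : 'S_N * perms * noise => phi (noisy_sum t.1.1 t.1.2 t.2)) -
    avg (fun p => phi (perm_sum H (fun c => cell_mean c - avg cell_mean) p))| <= L * w.
Proof.
move=> L0 phiL; set W := perm_sum H _.
have -> : avg (fun p => phi (W p)) =
    avg (fun t : 'S_N * perms * noise => phi (W t.1.2)).
  rewrite avg_pair /=; under [RHS]eq_avg do rewrite avg_cst ?card_ffun_gt0//.
  by rewrite avg_pair /= avg_cst.
rewrite -avgB (le_trans (ler_norm_avg _))// avg_pair; apply: avg_le_cst => [|[s p]].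
  exact: mulr_ge0.
apply: (@le_trans _ _ (L * avg (fun e => `|noise_sum s p e|))).
  by rewrite -avgZ; apply: ler_avg => e; exact: phiL.
rewrite ler_wpM2l// -(ler_pXn2r (n := 2))// ?nnegrE//; last by apply: avg_ge0.
rewrite (le_trans _ (noise_variance s p))// (le_trans (sqr_avg_le _))//.
by apply: ler_avg => e; rewrite real_normK ?num_real.
Qed.

End cell_noise.

(** * Gaussian smoothing *)

Section taylor.
Variable R : realType.
Implicit Types (f df : R -> R) (x y z d v : R).

Lemma mvt_le f df (a b B : R) : a <= b ->
  (forall y, a <= y <= b -> is_derive y 1 f (df y)) ->
  (forall y, a <= y <= b -> `|df y| <= B) ->
  `|f b - f a| <= B * (b - a).
Proof.
move=> ab dfE dfB.
have [||c] := @MVT_segment R f df a b ab.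
- by move=> y; rewrite in_itv/= => /andP[ay yb]; apply: dfE; rewrite !ltW.
- apply: derivable_within_continuous => y; rewrite in_itv/= => yab.
  by have [] := dfE y yab.
rewrite in_itv/= => cab ->.
by rewrite normrM [`|b - a|]ger0_norm ?subr_ge0// ler_wpM2r ?subr_ge0// dfB.
Qed.

Lemma mvt_ball f df (x y r B : R) : `|y - x| <= r ->
  (forall z, `|z - x| <= r -> is_derive z 1 f (df z)) ->
  (forall z, `|z - x| <= r -> `|df z| <= B) ->
  `|f y - f x| <= B * `|y - x|.
Proof.
move=> yxr dfE dfB; have [xy|yx] := leP x y.
  have xr z : x <= z <= y -> `|z - x| <= r.
    move=> /andP[xz zy]; rewrite (le_trans _ yxr)// !ger0_norm ?subr_ge0// ?lerB//.
  rewrite [`|y - x|]ger0_norm ?subr_ge0//.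
  by apply: (@mvt_le f df) => // z /xr zr; [exact: dfE|exact: dfB].
have xr z : y <= z <= x -> `|z - x| <= r.
  move=> /andP[yz zx]; rewrite (le_trans _ yxr)// distrC [leRHS]distrC.
  by rewrite !ger0_norm ?subr_ge0 ?lerB ?(ltW yx).
rewrite distrC [`|y - x|]distrC [X in _ * X]ger0_norm ?subr_ge0 ?(ltW yx)//.
by apply: (@mvt_le f df); rewrite ?(ltW yx)// => z /xr zr; [exact: dfE|exact: dfB].
Qed.

(** Three uses of the mean value bound, one per derivative; they gain no factorial, hence [C] in
    place of C/6. *)
Lemma taylor2 f f1 f2 f3 (C : R) :
  (forall x, is_derive x 1 f (f1 x)) -> (forall x, is_derive x 1 f1 (f2 x)) ->
  (forall x, is_derive x 1 f2 (f3 x)) -> (forall x, `|f3 x| <= C) ->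
  forall x d, `|f (x + d) - f x - d * f1 x - d ^+ 2 / 2 * f2 x| <= C * `|d| ^+ 3.
Proof.
move=> d1 d2 d3 f3C x d.
have C0 : 0 <= C by rewrite (le_trans _ (f3C x)).
have f2_le y : `|y - x| <= `|d| -> `|f2 y - f2 x| <= C * `|d|.
  move=> yd; apply: le_trans (ler_wpM2l C0 yd).
  exact: (@mvt_ball f2 f3 x y `|d|).
pose g1 y := f1 y - f1 x - (y - x) * f2 x.
have g1_le y : `|y - x| <= `|d| -> `|g1 y| <= C * `|d| * `|d|.
  move=> yd; have -> : g1 y = g1 y - g1 x by rewrite /g1 !subrr mul0r !subr0.
  apply: (@le_trans _ _ (C * `|d| * `|y - x|)); last by rewrite ler_wpM2l ?mulr_ge0.
  apply: (@mvt_ball g1 (fun y => f2 y - f2 x) x y `|d|) => // z _.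
  rewrite /g1; apply: is_derive_eq.
  by rewrite /GRing.scale /=; ring.
pose g0 y := f y - f x - (y - x) * f1 x - (y - x) ^+ 2 / 2 * f2 x.
have dE : x + d - x = d by ring.
have : `|g0 (x + d) - g0 x| <= C * `|d| * `|d| * `|x + d - x|.
  apply: (@mvt_ball g0 g1 x (x + d) `|d|) => [|z _|z zd]; rewrite ?dE//; last exact: g1_le.
  by rewrite /g1; apply: is_derive_eq; rewrite /GRing.scale /=; field.
rewrite (_ : g0 (x + d) - g0 x = f (x + d) - f x - d * f1 x - d ^+ 2 / 2 * f2 x).
  by rewrite dE => /le_trans; apply; rewrite le_eqVlt; apply/orP; left; apply/eqP; ring.
by rewrite /g0; field.
Qed.

Lemma taylor1 f f1 f2 (a C : R) :
  (forall x, a <= x -> is_derive x 1 f (f1 x)) ->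
  (forall x, a <= x -> is_derive x 1 f1 (f2 x)) ->
  (forall x, a <= x -> `|f2 x| <= C) ->
  forall x v, a <= x -> 0 <= v -> `|f (x + v) - f x - v * f1 x| <= C * v ^+ 2.
Proof.
move=> d1 d2 f2C x v ax v0.
have xv : x <= x + v by rewrite lerDl.
pose g y := f y - f x - (y - x) * f1 x.
have f1_le y : x <= y <= x + v -> `|f1 y - f1 x| <= C * v.
  move=> /andP[xy yv]; have C0 : 0 <= C by rewrite (le_trans _ (f2C x ax)).
  apply: (@le_trans _ _ (C * (y - x))); last by rewrite ler_wpM2l// lerBlDl.
  by apply: (@mvt_le f1 f2) => // z /andP[xz _];
    [apply: d2|apply: f2C]; exact: le_trans xz.
have : `|g (x + v) - g x| <= C * v * (x + v - x).
  apply: (@mvt_le g (fun y => f1 y - f1 x)) => // z /andP[xz _].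
  have dz := d1 z (le_trans ax xz); apply: is_derive_eq.
  by rewrite /GRing.scale /=; ring.
rewrite (_ : g (x + v) - g x = f (x + v) - f x - v * f1 x); last by rewrite /g; ring.
by rewrite (_ : C * v * (x + v - x) = C * v ^+ 2); last by ring.
Qed.

End taylor.

(** * The normal distribution function *)

Section normal_cdf.
Variable R : realType.
Implicit Types (s x y z t e : R).
Local Open Scope classical_set_scope.
Notation mu := lebesgue_measure.

Definition normal_cdf s x : R := fine (normal_prob 0 s `]-oo, x]).

Lemma normal_cdfE s x : (normal_cdf s x)%:E = normal_prob 0 s `]-oo, x].
Proof. by rewrite /normal_cdf fineK// fin_num_measure. Qed.

Lemma normal_cdf_ge0 s x : 0 <= normal_cdf s x.
Proof. by rewrite -lee_fin normal_cdfE. Qed.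

Lemma normal_cdf_le1 s x : normal_cdf s x <= 1.
Proof. by rewrite -lee_fin normal_cdfE probability_le1. Qed.

Lemma normal_cdf_nondecreasing s x y : x <= y -> normal_cdf s x <= normal_cdf s y.
Proof.
move=> xy; rewrite -lee_fin !normal_cdfE le_measure ?inE//.
exact: subset_itvl.
Qed.

(** The identity as a random variable under the normal law, so that the limits of distribution
    functions at both infinities apply. *)
Let idTR : measurableTypeR R -> R := idfun.

#[local] HB.instance Definition _ :=
  @isMeasurableFun.Build _ _ _ _ idTR (@measurable_id _ _ setT).

Lemma normal_cdf_upper s e : 0 < e -> exists x, 1 - e <= normal_cdf s x.
Proof.
move=> e0; pose X : {RV (normal_prob 0 s) >-> R} := idTR.
have := cvg_cdfy1 X => /fine_cvgP[_ /cvgrPdist_le/(_ e e0)] [M [_ HM]].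
exists (M + 1); have := HM (M + 1); rewrite ltrDl => /(_ ltr01) /=.
rewrite /cdf /distribution /pushforward /= => /ler_normlW.
by rewrite lerBlDr -lerBlDl.
Qed.

Lemma normal_cdf_lower s e : 0 < e -> exists x, normal_cdf s x <= e.
Proof.
move=> e0; pose X : {RV (normal_prob 0 s) >-> R} := idTR.
have := cvg_cdfNy0 X => /fine_cvgP[_ /cvgrPdist_le/(_ e e0)] [M [_ HM]].
exists (M - 1); have := HM (M - 1); rewrite gtrBl => /(_ ltr01) /=.
rewrite /cdf /distribution /pushforward /= sub0r normrN.
by rewrite ger0_norm// fine_ge0.
Qed.

Lemma is_derive_normal_cdf s x : s != 0 ->
  is_derive x (1 : R) (normal_cdf s) (normal_pdf 0 s x).
Proof.
move=> s0.
have [||||dF F'] := @continuous_FTC1 R (normal_pdf 0 s) -oo%O x (x + 1).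
- by rewrite ltrDl.
- by apply: (integrableS _ _ _ (integrable_normal_pdf 0 s)).
- by rewrite ltNyr.
- exact: continuous_normal_pdf.
by apply: DeriveDef => //; rewrite -derive1E.
Qed.

Lemma normal_pdf_scale s x : 0 < s -> normal_pdf 0 s x = normal_pdf 0 1 (x / s) / s.
Proof.
move=> s0; rewrite !normal_pdfE ?oner_eq0 ?gt_eqF// /normal_peak /normal_fun.
rewrite !subr0 expr1n mul1r -mulrnAr sqrtrM ?sqr_ge0// sqrtr_sqr gtr0_norm//.
rewrite invfM (_ : - x ^+ 2 / (s ^+ 2 *+ 2) = - (x / s) ^+ 2 / (1 *+ 2)).
  by rewrite [RHS]mulrC mulrA.
by field; rewrite gt_eqF.
Qed.

(** Both sides have the same derivative, so their difference is constant; both are small far to the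
    left, so the constant is zero. *)
Lemma normal_cdf_scale s x : 0 < s -> normal_cdf s x = normal_cdf 1 (x / s).
Proof.
move=> s0; have s00 : s != 0 by rewrite gt_eqF.
pose G y := normal_cdf s y - normal_cdf 1 (y / s).
have dG y : is_derive y (1 : R) G 0.
  have d1 := is_derive_normal_cdf (y / s) (oner_neq0 R).
  have d2 := is_derive_normal_cdf y s00.
  have d3 : is_derive y (1 : R) (fun z => z / s) s^-1.
    by apply: is_derive_eq; rewrite /GRing.scale /=; ring.
  have d4 : is_derive y (1 : R) (normal_cdf 1 \o (fun z => z / s))
      (normal_pdf 0 1 (y / s) * s^-1) by exact: is_derive1_comp.
  have -> : G = normal_cdf s - (normal_cdf 1 \o (fun z => z / s)) by [].
  by apply: is_derive_eq; rewrite normal_pdf_scale// subrr.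
have Gc y z : G y = G z.
  wlog yz : y z / y <= z.
    by move=> W; have [|/ltW] := leP y z; [exact: W|move/W].
  apply/eqP; rewrite eq_sym -subr_eq0 -normr_le0.
  rewrite (le_trans (@mvt_le R G (fun=> 0) y z 0 yz (fun w _ => dG w) _)) ?mul0r//.
  by move=> w _; rewrite normr0.
suff : `|G x| <= 0 by rewrite normr_le0 subr_eq0 => /eqP.
apply/ler_addgt0Pl => e e0; rewrite addr0.
have [a ae] := normal_cdf_lower s e0.
have [b be] := normal_cdf_lower 1 e0.
pose c := Num.min a (b * s).
have ca : c <= a by rewrite ge_min lexx.
have cb : c / s <= b by rewrite ler_pdivrMr// ge_min lexx orbT.
rewrite (Gc x c) ler_norml /G.
have := normal_cdf_nondecreasing 1 cb; have := normal_cdf_nondecreasing s ca.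
have := normal_cdf_ge0 s c; have := normal_cdf_ge0 1 (c / s).
by move=> h1 h2 h3 h4; apply/andP; split; lra.
Qed.

End normal_cdf.

(** * The heat flow started from an indicator *)

Section heat.
Variable R : realType.
Implicit Types (s x y z t e v d : R).

Let rho : R -> R := normal_pdf 0 1.
Let rho1 s : R := - s * rho s.
Let rho2 s : R := (s ^+ 2 - 1) * rho s.

Let peak : R := normal_peak 1.

Let peak0 : 0 <= peak. Proof. exact: normal_peak_ge0. Qed.

Let rhoE : rho = fun s => peak * expR (- s ^+ 2 / 2).
Proof.
apply/funext => s; rewrite /rho normal_pdfE ?oner_neq0// /normal_fun subr0.
by rewrite expr1n.
Qed.

Let rho_ge0 s : 0 <= rho s. Proof. exact: normal_pdf_ge0. Qed.

Let d_rho s : is_derive s (1 : R) rho (rho1 s).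
Proof.
have dq : is_derive s (1 : R) (fun s => - s ^+ 2 / 2) (- s).
  by apply: is_derive_eq; rewrite /GRing.scale /=; field.
have dE : is_derive s (1 : R) (expR \o (fun s => - s ^+ 2 / 2)) (expR (- s ^+ 2 / 2) * - s).
  exact: is_derive1_comp.
rewrite /rho1 rhoE (_ : (fun s => _) = peak *: (expR \o (fun s => - s ^+ 2 / 2)))//.
by apply: is_derive_eq; rewrite /GRing.scale /=; ring.
Qed.

Let d_rho1 s : is_derive s (1 : R) rho1 (rho2 s).
Proof.
have dr := d_rho s; have -> : rho1 = - (id * rho) by apply/funext => z; rewrite /rho1 mulNr.
by apply: is_derive_eq; rewrite /rho2 /rho1 /GRing.scale /=; ring.
Qed.

(** From [1 + z <= expR z] at z = s^2/8, squared; 64 is the square of 8. *)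
Let rho_decay s : (1 + s ^+ 2) ^+ 2 * rho s <= 64 * peak.
Proof.
have e8 : (1 + s ^+ 2) / 8 <= expR (s ^+ 2 / 8).
  by apply: le_trans (expR_ge1Dx _); have := sqr_ge0 s; lra.
have e4 : ((1 + s ^+ 2) / 8) ^+ 2 <= expR (s ^+ 2 / 2).
  apply: (@le_trans _ _ (expR (s ^+ 2 / 8) ^+ 2)).
    by rewrite ler_pXn2r// nnegrE ?expR_ge0// divr_ge0// addr_ge0 ?sqr_ge0.
  by rewrite -expRM_natr ler_expR; have := sqr_ge0 s; lra.
rewrite rhoE mulrCA [64 * _]mulrC ler_wpM2l// mulNr expRN ler_pdivrMr ?expR_gt0//.
rewrite -ler_pdivrMl// (le_trans _ e4)// le_eqVlt; apply/orP; left; apply/eqP.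
by field.
Qed.

(** The derivatives of the density in use are [rho] times polynomials bounded by four times (1 +
    s^2)^2, and 256 is 4 times 64. *)
Let C0 : R := 256 * peak.

Let decay_bound (p : R) s : `|p| <= 4 * (1 + s ^+ 2) ^+ 2 -> `|p * rho s| <= C0.
Proof.
move=> ps; rewrite normrM [`|rho s|]ger0_norm//.
apply: (le_trans (ler_wpM2r (rho_ge0 s) ps)); rewrite -mulrA.
by apply: (le_trans (ler_wpM2l _ (rho_decay s))); rewrite // /C0; lra.
Qed.

Let C00 : 0 <= C0. Proof. by rewrite mulr_ge0. Qed.

Let rho_bound s : `|rho s| <= C0.
Proof.
rewrite -[rho s]mul1r decay_bound// normr1.
have := sqr_ge0 s; set q := s ^+ 2; nra.
Qed.

Let rho1_bound s : `|rho1 s| <= C0.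
Proof.
rewrite /rho1 decay_bound// normrN.
rewrite -[s ^+ 2]real_normK ?num_real//; have := normr_ge0 s; set q := `|s|; nra.
Qed.

Let rho2_bound s : `|rho2 s| <= C0.
Proof.
rewrite /rho2 decay_bound// ler_norml.
have := sqr_ge0 s; set q := s ^+ 2 => q0; apply/andP; split; nra.
Qed.

Let rho3_bound s : `|(3 * s - s ^+ 3) * rho s| <= C0.
Proof.
rewrite decay_bound// (le_trans (ler_normB _ _))// normrM normrX ger0_norm//.
rewrite -[s ^+ 2]real_normK ?num_real//; have := normr_ge0 s; set q := `|s| => q0.
have -> : q ^+ 3 = q * q ^+ 2 by rewrite exprS.
have := sqr_ge0 (q - 1); have := sqr_ge0 q; nra.
Qed.

(* heat y t x = P(x + sqrt t Z <= y) solves the heat equation. *)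
Definition heat y t x : R := normal_cdf 1 ((y - x) / Num.sqrt t).
Definition heat_x y t x : R := - (rho ((y - x) / Num.sqrt t) / Num.sqrt t).
Definition heat_xx y t x : R := rho1 ((y - x) / Num.sqrt t) / t.

Variable t0 : R.
Hypothesis t0_gt0 : 0 < t0.

(** The four scales bound, in this order, the first derivative in space, the first in time, the
    third in space and the second in time. *)
Definition heat_const : R :=
  C0 * ((Num.sqrt t0)^-1 + t0^-1 + (Num.sqrt t0)^-1 ^+ 3 + t0^-1 ^+ 2).

Let r0 : R := (Num.sqrt t0)^-1.
Let r00 : 0 <= r0. Proof. by rewrite invr_ge0 sqrtr_ge0. Qed.
Let i00 : 0 <= t0^-1. Proof. by rewrite invr_ge0 ltW. Qed.

Lemma heat_const_ge0 : 0 <= heat_const.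
Proof. by rewrite mulr_ge0// !addr_ge0 ?exprn_ge0. Qed.

Let const_le (a b : R) : `|a| <= C0 ->
  0 <= b -> b <= r0 + t0^-1 + r0 ^+ 3 + t0^-1 ^+ 2 -> `|a * b| <= heat_const.
Proof. by move=> aC b0 bb; rewrite normrM (ger0_norm b0) ler_pM. Qed.

Let rt_le t : t0 <= t -> 0 <= (Num.sqrt t)^-1 <= r0.
Proof.
move=> t0t; have tp : 0 < t := lt_le_trans t0_gt0 t0t.
by rewrite invr_ge0 sqrtr_ge0/= lef_pV2 ?posrE ?sqrtr_gt0// ler_wsqrtr.
Qed.

Let it_le t : t0 <= t -> 0 <= t^-1 <= t0^-1.
Proof.
move=> t0t; have tp : 0 < t := lt_le_trans t0_gt0 t0t.
by rewrite invr_ge0 ltW//= lef_pV2 ?posrE.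
Qed.

Let rt_sqr t : t0 <= t -> (Num.sqrt t)^-1 ^+ 2 = t^-1.
Proof. by move=> t0t; rewrite exprVn sqr_sqrtr// ltW// (lt_le_trans t0_gt0). Qed.

Let d_lin (r z : R) : is_derive z (1 : R) (fun z => z * r) r.
Proof. by apply: is_derive_eq; rewrite /GRing.scale /=; ring. Qed.

Let d_scaled (F F' : R -> R) (r z : R) : (forall u : R, is_derive u (1 : R) F (F' u)) ->
  is_derive z (1 : R) (F \o (fun z => z * r)) (F' (z * r) * r).
Proof.
by move=> dF; have e1 := dF (z * r); have e2 := d_lin r z; exact: is_derive1_comp.
Qed.

Let d_cdf u : is_derive u (1 : R) (normal_cdf 1) (rho u).
Proof. by apply: is_derive_normal_cdf; exact: oner_neq0. Qed.

Lemma heat_space y t x d : t0 <= t ->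
  `|heat y t (x + d) - heat y t x - d * heat_x y t x - d ^+ 2 / 2 * heat_xx y t x|
  <= heat_const * `|d| ^+ 3.
Proof.
move=> t0t; set r := (Num.sqrt t)^-1.
have d1 z : is_derive z (1 : R) (fun z => normal_cdf 1 (z * r)) (rho (z * r) * r).
  exact: d_scaled d_cdf.
have d2 z : is_derive z (1 : R) (fun z => rho (z * r) * r) (rho1 (z * r) * r ^+ 2).
  have dd := d_scaled r z d_rho.
  have -> : (fun z => rho (z * r) * r) = r *: (rho \o (fun z => z * r)).
    by apply/funext => u /=; rewrite mulrC.
  by apply: is_derive_eq; rewrite /GRing.scale /=; ring.
have d3 z : is_derive z (1 : R) (fun z => rho1 (z * r) * r ^+ 2) (rho2 (z * r) * r ^+ 3).
  have dd := d_scaled r z d_rho1.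
  have -> : (fun z => rho1 (z * r) * r ^+ 2) = r ^+ 2 *: (rho1 \o (fun z => z * r)).
    by apply/funext => u /=; rewrite mulrC.
  by apply: is_derive_eq; rewrite /GRing.scale /=; ring.
have b3 z : `|rho2 (z * r) * r ^+ 3| <= heat_const.
  have /andP[r_ge0 rr0] := rt_le t0t.
  apply: const_le => //; first by rewrite exprn_ge0.
  have : r ^+ 3 <= r0 ^+ 3 by rewrite lerXn2r ?nnegrE.
  have := exprn_ge0 2 i00; have := r00; have := i00; lra.
have := taylor2 d1 d2 d3 b3 (y - x) (- d); rewrite normrN; congr (`|_| <= _).
rewrite /heat /heat_x /heat_xx -/r -(rt_sqr t0t) -/r opprD addrA sqrrN; ring.
Qed.

Let d_arg z t : 0 < t -> is_derive t (1 : R) (fun t => z / Num.sqrt t)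
  (- (z / Num.sqrt t) / (2 * t)).
Proof.
move=> tp; have ds := is_derive1_sqrt tp.
have st : Num.sqrt t != 0 by rewrite gt_eqF// sqrtr_gt0.
have dV := is_deriveV st ds.
have -> : (fun t => z / Num.sqrt t) = z *: (fun t => (Num.sqrt t)^-1) by [].
apply: is_derive_eq; rewrite /GRing.scale /= -[X in _ = _ / (2 * X)]sqr_sqrtr ?ltW//.
by field.
Qed.

Let d_along (F F' : R -> R) (z t : R) : 0 < t ->
  (forall u : R, is_derive u (1 : R) F (F' u)) ->
  is_derive t (1 : R) (F \o (fun t => z / Num.sqrt t))
    (F' (z / Num.sqrt t) * (- (z / Num.sqrt t) / (2 * t))).
Proof.
move=> tp dF; have e1 := dF (z / Num.sqrt t); have e2 := d_arg z tp.
exact: is_derive1_comp.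
Qed.

Let d_heat y x t : 0 < t -> is_derive t (1 : R) (fun t => heat y t x) (heat_xx y t x / 2).
Proof.
move=> tp; apply: (is_derive_eq (d_along (y - x) tp d_cdf)); rewrite /heat_xx /rho1 -/rho.
by field; rewrite !gt_eqF ?sqrtr_gt0.
Qed.

Let d_heat_xx y x t : 0 < t -> is_derive t (1 : R) (fun t => heat_xx y t x / 2)
  ((3 * ((y - x) / Num.sqrt t) - ((y - x) / Num.sqrt t) ^+ 3)
    * rho ((y - x) / Num.sqrt t) / 4 / t ^+ 2).
Proof.
move=> tp; have dd := d_along (y - x) tp d_rho1.
have tn : t != 0 by rewrite gt_eqF.
have dV : is_derive t (1 : R) (fun t => t^-1) (- t ^- 2).
  by apply: (is_derive_eq (is_deriveV tn (is_derive_id t 1))); rewrite /GRing.scale /= mulr1.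
have -> : (fun t => heat_xx y t x / 2) =
    2^-1 *: ((rho1 \o (fun t => (y - x) / Num.sqrt t)) * (fun t => t^-1)).
  by apply/funext => u; rewrite /heat_xx /= mulrC.
apply: is_derive_eq; rewrite /GRing.scale /= /rho2 /rho1.
by field; rewrite tn !gt_eqF ?sqrtr_gt0.
Qed.

Lemma heat_time y t x v : t0 <= t -> 0 <= v ->
  `|heat y (t + v) x - heat y t x - v / 2 * heat_xx y t x| <= heat_const * v ^+ 2.
Proof.
move=> t0t v0.
have pos u : t0 <= u -> 0 < u by exact: lt_le_trans.
have := @taylor1 R (fun t => heat y t x) _ _ t0 heat_const
  (fun u u0 => d_heat y x (pos u u0)) (fun u u0 => d_heat_xx y x (pos u u0)).
move=> H; rewrite [v / 2 * _]mulrAC -mulrA; apply: H => // u u0.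
rewrite -mulrA; apply: const_le => //.
  by rewrite mulr_ge0 ?invr_ge0 ?exprn_ge0// ltW// pos.
have /andP[iu0 iu] := it_le u0.
have : u^-1 ^+ 2 <= t0^-1 ^+ 2 by rewrite lerXn2r ?nnegrE.
have := exprn_ge0 2 iu0; have := exprn_ge0 3 r00; have := exprn_ge0 2 i00.
by rewrite -exprVn; have := r00; have := i00; set a := u^-1 ^+ 2; lra.
Qed.

Lemma heat_lipschitz_time y t t' x : t0 <= t -> t0 <= t' ->
  `|heat y t x - heat y t' x| <= heat_const * `|t - t'|.
Proof.
wlog tt : t t' / t' <= t.
  move=> W t0t t0t'; have [/W|/ltW/W] := leP t' t; first exact.
  by rewrite distrC [`|t - t'|]distrC; apply.
move=> t0t t0t'; rewrite [`|t - t'|]ger0_norm ?subr_ge0//.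
apply: (@mvt_le R (fun t => heat y t x) (fun t => heat_xx y t x / 2)) => // u /andP[tu _].
  by apply: d_heat; rewrite (lt_le_trans t0_gt0)// (le_trans t0t').
have /andP[iu0 iu] := it_le (le_trans t0t' tu).
rewrite /heat_xx -mulrA; apply: const_le => //; first by rewrite divr_ge0.
have := exprn_ge0 3 r00; have := exprn_ge0 2 i00; have := r00; have := i00; have := r00; have := i00; lra.
Qed.

Lemma heat_lipschitz_space y x x' :
  `|heat y t0 x - heat y t0 x'| <= heat_const * `|x - x'|.
Proof.
set r := (Num.sqrt t0)^-1.
have d1 z : is_derive z (1 : R) (fun z => normal_cdf 1 (z * r)) (rho (z * r) * r).
  exact: d_scaled d_cdf.
have -> : x - x' = (y - x') - (y - x) by ring.
rewrite [X in _ * X]distrC.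
apply: (@mvt_ball R _ _ (y - x') (y - x) `|y - x - (y - x')|) (fun z _ => d1 z) _ => //.
move=> z _; apply: const_le; [exact: rho_bound|exact: r00|rewrite /r -/r0].
have := exprn_ge0 3 r00; have := exprn_ge0 2 i00; have := r00; have := i00; lra.
Qed.

End heat.

(** * Integrals over the cube and their grid approximation *)

Section riemann_sums.
Variable R : realType.
Local Open Scope classical_set_scope.

(* The integral is defined through suprema over simple functions, hence it is
   monotone on arbitrary functions, measurable or not. *)
Lemma le_integral_arbitrary d (T : measurableType d)
    (mu : {measure set T -> \bar R}) (D : set T) (f1 f2 : T -> \bar R) :
  (forall x, D x -> (f1 x <= f2 x)%E) ->
  (\int[mu]_(x in D) f1 x <= \int[mu]_(x in D) f2 x)%E.
Proof.
move=> f12; have le x : ((f1 \_ D) x <= (f2 \_ D) x)%E.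
  by rewrite !patchE; case: ifPn => // /set_mem /f12.
rewrite /integral leeB//.
  apply: le_ereal_sup => _ [h hf <-]; exists h => // x.
  by rewrite (le_trans (hf x))// !funeposE le_max2.
apply: le_ereal_sup => _ [h hf <-]; exists h => // x.
by rewrite (le_trans (hf x))// !funenegE le_max2// leeN2.
Qed.

(** The reduction modulo [n] provides an ordinal for every real [u]; on [0, 1[ the truncation is
    already below [n]. *)
Definition bucket (n : nat) (n0 : (0 < n)%N) (u : R) : 'I_n :=
  Ordinal (ltn_pmod (Num.truncn (n%:R * u)) n0).

Lemma bucketP n (n0 : (0 < n)%N) (u : R) : 0 <= u < 1 ->
  (bucket n0 u)%:R / n%:R <= u < (bucket n0 u).+1%:R / n%:R.
Proof.
move=> /andP[u0 u1]; have nR : 0 < n%:R :> R by rewrite ltr0n.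
have nu0 : 0 <= n%:R * u by rewrite mulr_ge0// ltW.
have /andP[tl tr] := Num.Theory.truncn_itv nu0.
have tn : (Num.truncn (n%:R * u) < n)%N.
  by rewrite -(ltr_nat R) (le_lt_trans tl)// gtr_pMr.
by rewrite /bucket /= modn_small// ler_pdivrMr// ltr_pdivlMr// [u * _]mulrC tl tr.
Qed.

Lemma bucket_eq n (n0 : (0 < n)%N) (u : R) (a : 'I_n) : 
  a%:R / n%:R <= u < a.+1%:R / n%:R -> bucket n0 u = a.
Proof.
move=> /andP[al ar]; have nR : 0 < n%:R :> R by rewrite ltr0n.
rewrite ler_pdivrMr// [u * _]mulrC in al; rewrite ltr_pdivlMr// [u * _]mulrC in ar.
apply: val_inj; rewrite /= (_ : Num.truncn _ = a) ?modn_small//.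
by apply: Num.Theory.truncn_def; rewrite al ar.
Qed.


Lemma uniform_prob_bucket n (a : 'I_n) :
  uniform_prob (@ltr01 R) `[a%:R / n%:R, a.+1%:R / n%:R[ = (n%:R^-1)%:E.
Proof.
have n0 : (0 < n)%N by rewrite (leq_ltn_trans _ (ltn_ord a)).
have nR : 0 < n%:R :> R by rewrite ltr0n.
have lt : a%:R / n%:R < a.+1%:R / n%:R :> R by rewrite ltr_pM2r ?invr_gt0// ltr_nat.
rewrite /uniform_prob integral_uniform_pdf.
rewrite (_ : _ `&` _ = `[a%:R / n%:R, a.+1%:R / n%:R[); last first.
  apply/setIidl => x /=; rewrite !in_itv/= => /andP[ax xa].
  rewrite (le_trans _ ax) ?divr_ge0//= (le_trans (ltW xa))//.
  by rewrite ler_pdivrMr// mul1r ler_nat.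
rewrite (eq_integral (cst 1%E)).
  rewrite integral_cst//= mul1e lebesgue_measure_itv /= lte_fin lt -EFinD.
  by rewrite -mulrBl -natrB// subSnn div1r.
move=> x; rewrite inE/= in_itv/= => /andP[ax xa].
rewrite /uniform_pdf subr0 invr1 ifT//.
rewrite (le_trans _ ax) ?divr_ge0//= (le_trans (ltW xa))//.
by rewrite ler_pdivrMr// mul1r ler_nat.
Qed.

Variables (K n : nat).
Hypothesis n0 : (0 < n)%N.
Notation cell := {ffun 'I_K -> 'I_n}.

Let D : set (K.-tuple R) := [set t | forall k, 0 <= tnth t k < 1].

Let box (c : cell) : set (K.-tuple R) :=
  [set t | forall k, `[(c k)%:R / n%:R, (c k).+1%:R / n%:R[ (tnth t k)].

Let measurable_tuple_box (A : 'I_K -> set R) : (forall k, measurable (A k)) ->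
  measurable [set t : K.-tuple R | forall k, A k (tnth t k)].
Proof.
move=> mA; rewrite [X in measurable X](_ : _ = \bigcap_(k in [set: 'I_K])
    ((fun t : K.-tuple R => tnth t k) @^-1` A k)); last first.
  by apply/seteqP; split=> t /= At k; [move=> _|]; apply: At.
apply: fin_bigcap_measurable => [|k _]; first exact: finite_finset.
by rewrite -[X in measurable X]setTI; apply: measurable_tnth.
Qed.

Let mD : measurable D.
Proof.
rewrite (_ : D = [set t | forall k, `[0, 1[ (tnth t k)]); last first.
  by apply/seteqP; split=> t /= Dt k; have := Dt k; rewrite ?in_itv.
exact: (@measurable_tuple_box (fun=> `[0, 1[) (fun k => measurable_itv _)).
Qed.

Let mbox c : measurable (box c).
Proof.
exact: (@measurable_tuple_box (fun k => `[(c k)%:R / n%:R, (c k).+1%:R / n%:R[)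
  (fun k => measurable_itv _)).
Qed.

Let boxD c : box c `<=` D.
Proof.
move=> t tc k; have := tc k; rewrite /= in_itv/= => /andP[cl cr].
have nR : 0 < n%:R :> R by rewrite ltr0n.
rewrite (le_trans _ cl) ?divr_ge0//= (lt_le_trans cr)//.
by rewrite ler_pdivrMr// mul1r ler_nat.
Qed.

Let unif_box c : unif_cube R K (box c) = ((n%:R^-1) ^+ K)%:E.
Proof.
rewrite /box (unif_cube_box (A := fun k => `[(c k)%:R / n%:R, (c k).+1%:R / n%:R[))//.
rewrite (eq_bigr (fun=> (n%:R^-1)%:E)) => [|k _]; last exact: uniform_prob_bucket.
by rewrite prodEFin prodr_const card_ord.
Qed.

Definition cell_of (x : 'rV[R]_K) : cell := [ffun k => bucket n0 (x ord0 k)].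

Let step_integral (Q : cell -> R) :
  (\int[unif_cube R K]_(t in D) (Q (cell_of (\row_k tnth t k)))%:E = (avg Q)%:E)%E.
Proof.
transitivity (\int[unif_cube R K]_(t in D) (\sum_c (Q c)%:E * (\1_(box c) t)%:E)%E)%E.
  apply: eq_integral => t; rewrite inE => Dt.
  have inb : box (cell_of (\row_k tnth t k)) t.
    by move=> k /=; rewrite in_itv/= !ffunE !mxE; exact: bucketP.
  rewrite (bigD1 (cell_of (\row_k tnth t k)))//= indicE mem_set//= mule1.
  rewrite big1 ?adde0// => c /eqP cne; rewrite indicE memNset ?mule0// => ct.
  apply: cne; apply/ffunP => k; rewrite !ffunE !mxE.
  by apply/esym/bucket_eq; have := ct k; rewrite /= in_itv.
rewrite integral_sum//; last first.
  move=> c; apply: integrableZl => //.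
  by apply: (integrableS measurableT) => //; exact: integrable_indic.
under eq_bigr => c _.
  rewrite integralZl//; last first.
    by apply: (integrableS measurableT) => //; exact: integrable_indic.
  rewrite integral_indic// setIidl// [X in (_ * X)%E](unif_box c) -EFinM; over.
rewrite sumEFin; congr (_%:E); rewrite /avg -mulr_suml mulrC; congr (_ * _).
by rewrite card_ffun !card_ord natrX exprVn.
Qed.

(** Step functions have exact integrals, and [le_integral_arbitrary] squeezes [q] between two of
    them, which also excludes infinite integrals. The nested ANOVA integrals can thus be treated as
    arbitrary functions. *)
Lemma cube_int_step (q : 'rV[R]_K -> R) (Q : cell -> R) (e : R) :
  (forall z : 'rV[R]_K, (forall k, 0 <= z ord0 k < 1) -> `|q z - Q (cell_of z)| <= e) ->
  `|cube_int q - avg Q| <= e.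
Proof.
move=> qQ.
have In0 : (0 < #|{ffun 'I_K -> 'I_n}|)%N by apply: card_ffun_gt0; rewrite card_ord.
have bnd (t : K.-tuple R) : D t -> `|q (\row_k tnth t k) - Q (cell_of (\row_k tnth t k))| <= e.
  by move=> Dt; apply: qQ => k; rewrite mxE.
have hi : (\int[unif_cube R K]_(t in D) (q (\row_k tnth t k))%:E <= (avg Q + e)%:E)%E.
  rewrite -(avg_cst e In0) -avgD -step_integral; apply: le_integral_arbitrary => t /bnd.
  by rewrite lee_fin ler_norml => /andP[_]; rewrite lerBlDl.
have lo : ((avg Q - e)%:E <= \int[unif_cube R K]_(t in D) (q (\row_k tnth t k))%:E)%E.
  rewrite -(avg_cst e In0) -avgB -step_integral; apply: le_integral_arbitrary => t /bnd.
  by rewrite lee_fin ler_norml => /andP[+ _]; rewrite lerBrDl.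
rewrite /cube_int /Rintegral -/D; move: lo hi; case: (integral _ _ _) => [r| |]//=.
by rewrite !lee_fin ler_norml => lo hi; apply/andP; split; lra.
Qed.

End riemann_sums.

(** * Continuous against discrete ANOVA *)

Section anova_cells.
Variables (R : realType) (K n : nat).
Hypothesis n0 : (0 < n)%N.
Notation cell := {ffun 'I_K -> 'I_n}.
Notation cell_of := (@cell_of R K n n0).
Implicit Types (x y z : 'rV[R]_K) (u : {set 'I_K}).

Definition in_cube x := forall k, 0 <= x ord0 k < 1.

Lemma in_cube_glue u x y : in_cube x -> in_cube y -> in_cube (Defs.glue u x y).
Proof. by move=> hx hy k; rewrite mxE; case: ifP. Qed.

Lemma cell_of_glue u x y :
  cell_of (Defs.glue u x y) = mix [pred k | k \notin u] (cell_of x) (cell_of y).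
Proof. by apply/ffunP => k; rewrite !ffunE mxE /=; case: (k \in u). Qed.

Variables (f : 'rV[R]_K -> R) (F : cell -> R) (e : R).
Hypothesis e0 : 0 <= e.
Hypothesis fF : forall z, in_cube z -> `|f z - F (cell_of z)| <= e.

Let factor := anova_factor R K.

Let factor_ge1 : 1 <= factor.
Proof. by rewrite lerDl exprn_ge0. Qed.

Let factor_ge0 : 0 <= factor.
Proof. exact: le_trans factor_ge1. Qed.

Let card_sets_le (P : pred {set 'I_K}) (a : R) : 0 <= a ->
  \sum_(u : {set 'I_K} | P u) a <= 2 ^+ K * a.
Proof.
move=> a0; rewrite sumr_const -[leLHS]mulr_natl ler_wpM2r// -natrX ler_nat.
by rewrite (leq_trans (max_card _))// -cardsT -powersetT card_powerset cardsT card_ord.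
Qed.

(** By [cell_of_glue], integrating out coordinates on the cube corresponds to redrawing them on the
    cells, so the two recursions run in parallel and the error grows by [factor] per level. *)
Lemma anova_rec_close d u x : in_cube x ->
  `|anova_rec f d u x - danova_rec F d u (cell_of x)| <= factor ^+ d.+1 * e.
Proof.
elim: d u x => [|d IH] u x hx; apply: cube_int_step => z hz; rewrite -cell_of_glue.
  by rewrite !subr0 expr1 (le_trans (fF (in_cube_glue u hx hz)))// ler_peMl.
set y := Defs.glue u x z; have hy : in_cube y by exact: in_cube_glue.
rewrite (_ : _ - _ - _ = (f y - F (cell_of y)) - \sum_(v : {set 'I_K} | v \proper u)
   (anova_rec f d v y - danova_rec F d v (cell_of y))); last by rewrite sumrB; ring.
rewrite (le_trans (ler_normB _ _))// exprS -mulrA mulrDl mul1r lerD//.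
  by rewrite (le_trans (fF hy))// ler_peMl// exprn_ege1.
rewrite (le_trans (ler_norm_sum _ _ _))// (le_trans (ler_sum _ (fun v _ => IH v y hy)))//.
by rewrite card_sets_le ?mulr_ge0 ?exprn_ge0.
Qed.

Variable h : nat.

Lemma anova_remainder_close x : in_cube x ->
  `|anova_remainder f h x - dremainder F h (cell_of x)| <= 2 * (factor ^+ K.+2 * e).
Proof.
move=> hx; rewrite /anova_remainder /dremainder.
rewrite (_ : _ - _ - _ - _ = (f x - F (cell_of x)) - (cube_int f - avg F) -
   \sum_(u : {set 'I_K} | (0 < #|u| <= h)%N) (anova f u x - danova F u (cell_of x))); last first.
  by rewrite sumrB; ring.
rewrite (le_trans (ler_normB _ _))//.
have -> : 2 * (factor ^+ K.+2 * e) = factor ^+ K.+1 * e + factor ^+ K.+1 * e +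
    2 ^+ K * (factor ^+ K.+1 * e) + 2 ^+ K * (factor ^+ K.+1 * e).
  by rewrite [factor ^+ K.+2]exprS {1}/factor /anova_factor; ring.
rewrite ler_wpDr ?mulr_ge0 ?exprn_ge0// lerD//.
  rewrite (le_trans (ler_normB _ _))// lerD//.
    by rewrite (le_trans (fF hx))// ler_peMl// exprn_ege1.
  by rewrite (le_trans (cube_int_step fF))// ler_peMl// exprn_ege1.
rewrite (le_trans (ler_norm_sum _ _ _))//.
apply: le_trans (card_sets_le (fun u => (0 < #|u| <= h)%N) _); last first.
  by rewrite mulr_ge0 ?exprn_ge0.
apply: ler_sum => u _; rewrite (le_trans (anova_rec_close _ _ hx))// ler_wpM2r//.
by rewrite ler_weXn2l// ltnS (leq_trans (max_card _))// card_ord.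
Qed.

Lemma variance_close (B : R) : (forall c, `|dremainder F h c| <= B) ->
  `|cube_int (fun x => anova_remainder f h x ^+ 2) - avg (fun c => dremainder F h c ^+ 2)| <=
  2 * (factor ^+ K.+2 * e) * (2 * B + 2 * (factor ^+ K.+2 * e)).
Proof.
move=> gB; apply: cube_int_step => z hz; rewrite subr_sqr normrM.
have := anova_remainder_close hz; set E := 2 * _; set r := anova_remainder f h z.
have := gB (cell_of z); set g := dremainder F h _ => gz rg; rewrite ler_pM//.
rewrite (_ : r + g = 2 * g + (r - g)); last by ring.
by rewrite (le_trans (ler_normD _ _))// lerD// normrM ger0_norm// ler_pM2l.
Qed.

End anova_cells.

Section grid.
Variables (R : realType) (K n M : nat).
Hypotheses (n0 : (0 < n)%N) (M0 : (0 < M)%N).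
Notation cell := {ffun 'I_K -> 'I_n}.
Notation subcell := {ffun 'I_K -> 'I_M}.
Implicit Types (c : cell) (e : subcell).

Let nR : 0 < n%:R :> R. Proof. by rewrite ltr0n. Qed.
Let MR : 0 < M%:R :> R. Proof. by rewrite ltr0n. Qed.
Definition grid_point c e : 'rV[R]_K := \row_k (((c k)%:R + (e k)%:R / M%:R) / n%:R).

Let subcell_lt (a : 'I_M) : 0 <= (a%:R / M%:R : R) < 1.
Proof. by rewrite divr_ge0//= ltr_pdivrMr// mul1r ltr_nat. Qed.

Lemma grid_point_in c e : in_cube (grid_point c e).
Proof.
move=> k; rewrite mxE; have /andP[e0 e1] := subcell_lt (e k).
rewrite divr_ge0 ?addr_ge0//= ltr_pdivrMr// mul1r.
have : (c k).+1%:R <= n%:R :> R by rewrite ler_nat.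
by rewrite -natr1; lra.
Qed.

Lemma grid_point_cell c e e' k :
  `|grid_point c e ord0 k - grid_point c e' ord0 k| <= n%:R^-1.
Proof.
rewrite !mxE -mulrBl opprD addrACA subrr add0r normrM [`|n%:R^-1|]ger0_norm ?invr_ge0//.
rewrite ler_piMl ?invr_ge0//; move: (subcell_lt (e k)) (subcell_lt (e' k)).
by rewrite ler_norml => /andP[? ?] /andP[? ?]; apply/andP; split; lra.
Qed.

Lemma grid_point_shift c c' e q k : (c k <= c' k + q)%N && (c' k <= c k + q)%N ->
  `|grid_point c e ord0 k - grid_point c' e ord0 k| <= q%:R / n%:R.
Proof.
move=> /andP[]; rewrite !mxE -mulrBl opprD addrACA subrr addr0 normrM.
rewrite [`|n%:R^-1|]ger0_norm ?invr_ge0// ler_pM2r ?invr_gt0//.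
rewrite -!(ler_nat R) !natrD ler_norml => h1 h2; apply/andP; split; lra.
Qed.

Lemma grid_point_cell_of (z : 'rV[R]_K) e k : in_cube z ->
  `|z ord0 k - grid_point (cell_of n0 z) e ord0 k| <= n%:R^-1.
Proof.
move=> /(_ k) /(bucketP n0) /andP[]; rewrite !mxE ffunE -natr1 !mulrDl mul1r.
have := subcell_lt (e k); set a := _%:R / M%:R => /andP[a0 a1].
have : 0 <= a / n%:R <= n%:R^-1.
  by rewrite divr_ge0//= ler_piMl ?invr_ge0// ltW.
by move=> /andP[? ?] ? ?; rewrite ler_norml; apply/andP; split; lra.
Qed.

Lemma grid_point_eta (a : 'I_n) (x : R) : 0 <= x < 1 ->
  `|(a%:R / n%:R + x / n%:R) - (a%:R + (bucket M0 x)%:R / M%:R) / n%:R| <=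
  (n * M)%:R^-1.
Proof.
move=> /(bucketP M0) /andP[xl xr].
rewrite -mulrDl -mulrBl opprD addrACA subrr add0r normrM.
rewrite [`|n%:R^-1|]ger0_norm ?invr_ge0// natrM invfM mulrC ler_pM2l ?invr_gt0//.
by move: xr; rewrite -natr1 mulrDl mul1r ler_norml => xr; apply/andP; split; lra.
Qed.

Let fine_lt (a : 'I_n) (b : 'I_M) : (a * M + b < n * M)%N.
Proof. by rewrite (leq_trans (n := a.+1 * M))// ?leq_mul// mulSn addnC ltn_add2r. Qed.

Let fine_cell (p : cell * subcell) : {ffun 'I_K -> 'I_(n * M)} :=
  [ffun k => Ordinal (fine_lt (p.1 k) (p.2 k))].

Let fine_cell_bij : bijective fine_cell.
Proof.
apply: inj_card_bij.
  move=> [c e] [c' e'] /ffunP cc; have E k := congr1 val (cc k).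
  congr pair; apply/ffunP => k; apply: val_inj; have := E k; rewrite !ffunE /= => E1.
    by have := congr1 (divn^~ M) E1; rewrite !divnMDl// !divn_small// !addn0.
  by have := congr1 (modn^~ M) E1; rewrite !modnMDl !modn_small.
by rewrite card_prod !card_ffun !card_ord expnMn.
Qed.

Lemma avg_fine_grid (G : 'rV[R]_K -> R) :
  avg (fun c : cell => avg (fun e : subcell => G (grid_point c e))) =
  avg (fun d : {ffun 'I_K -> 'I_(n * M)} => G (\row_k ((d k)%:R / (n * M)%:R))).
Proof.
rewrite -(avg_reindex _ fine_cell_bij) avg_pair; apply: eq_avg => c; apply: eq_avg => e.
congr G; apply/rowP => k; rewrite !mxE ffunE /= natrD !natrM.
by field; rewrite !gt_eqF.
Qed.

End grid.

(** * Uniform continuity on the cube *)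

Section modulus.
Variables (R : realType) (K : nat) (f : 'rV[R]_K -> R).
Implicit Types (x y z : 'rV[R]_K).
Local Open Scope classical_set_scope.

Definition modulus (dl e : R) := forall x y, in_cube x -> in_cube y ->
  (forall k, `|x ord0 k - y ord0 k| <= dl) -> `|f x - f y| <= e.

Hypothesis fcont : {within [set x : 'rV[R]_K | forall k, 0 <= x ord0 k <= 1], continuous f}.

(** Heine's theorem on the compact closed cube, restricted to the half-open one, where the sample
    points lie. *)
Lemma uniform_continuity e : 0 < e -> exists2 dl, 0 < dl & modulus dl e.
Proof.
move=> e0; pose C := [set x : 'rV[R]_K | forall k, 0 <= x ord0 k <= 1].
have fC : {within C, continuous f} by exact: fcont.
have Ccompact : compact C.
  rewrite (_ : C = [set x : 'rV[R]_K | forall k, `[0, 1] (x ord0 k)]).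
    by apply: (@rV_compact R K (fun=> `[0, 1])) => k; exact: segment_compact.
  by apply/seteqP; split=> x /= Cx k; have := Cx k; rewrite ?in_itv.
have cube_C x : in_cube x -> C x by move=> hx k; have /andP[-> /ltW ->] := hx k.
have /compact_near_coveringP cov := Ccompact.
have := cov R (0^'+) (fun dl x => C x -> forall y, C y ->
  (forall k, `|x ord0 k - y ord0 k| <= dl) -> `|f x - f y| <= e) _.
case.
  move=> x Cx.
  have /subspace_continuousP/(_ x Cx)/cvgrPdist_lt/(_ (e / 2)) := fC.
  rewrite divr_gt0// => /(_ isT); rewrite near_withinE => /nbhs_ballP[r /= r0 xr].
  exists (ball x (r / 2), [set dl | dl < r / 2]).
    split; first by apply: nbhsx_ballx; rewrite divr_gt0.
    by apply: nbhs_right_lt; rewrite divr_gt0.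
  move=> [x' dl] [/= xx' dlr] Cx' y Cy x'y.
  have h1 : `|f x - f x'| < e / 2.
    by apply: xr => //; apply: le_ball xx'; rewrite ler_pdivrMr// ler_peMr ?ler1n// ltW.
  have h2 : `|f x - f y| < e / 2.
    apply: xr => //; rewrite [r]splitr; apply: ball_triangle xx' _.
    split=> [|i k]; first by rewrite divr_gt0.
    by rewrite (ord1 i) /ball /= (le_lt_trans (x'y k)).
  rewrite (le_trans (ler_distD (f x) _ _))// (distrC (f x')) [e]splitr lerD// ltW//.
(* The property holds on an open right neighbourhood of 0, so half of its radius is taken. *)
move=> dl /= dl0 H; exists (dl / 2); first by rewrite divr_gt0.
have dd : dl / 2 < dl by rewrite ltr_pdivrMr// ltr_pMr// ltr1n.
move=> x y hx hy xy; apply: (H (dl / 2)) (cube_C _ hx) _ (cube_C _ hy) xy => //.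
- by rewrite /ball /= sub0r normrN gtr0_norm ?divr_gt0.
- by rewrite divr_gt0.
- exact: cube_C.
Qed.

(** With the modulus for 1, each value of [f] is within 1 of its value at one of finitely many grid
    points. *)
Lemma bounded_on_cube : exists2 B, 0 <= B & forall x, in_cube x -> `|f x| <= B.
Proof.
have [dl dl0 fdl] := uniform_continuity ltr01.
pose n := (Num.truncn dl^-1).+1.
have n0 : (0 < n)%N by [].
have ndl : n%:R^-1 <= dl.
  by rewrite -[dl]invrK lef_pV2 ?posrE ?invr_gt0// ltW// truncnS_gt.
pose p (c : {ffun 'I_K -> 'I_n}) : 'rV[R]_K := grid_point R c [ffun=> ord0 : 'I_1].
exists (1 + \sum_c `|f (p c)|); first by rewrite addr_ge0// sumr_ge0.
move=> x hx; rewrite -[f x](subrK (f (p (cell_of n0 x)))).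
rewrite (le_trans (ler_normD _ _))// lerD//.
  apply: fdl => //; first exact: grid_point_in.
  by move=> k; rewrite (le_trans _ ndl)//; exact: grid_point_cell_of.
by rewrite (bigD1 (cell_of n0 x))//= lerDl sumr_ge0.
Qed.

End modulus.

Section cell_averages.
Variables (R : realType) (K n M : nat) (f : 'rV[R]_K -> R).
Hypotheses (n0 : (0 < n)%N) (M0 : (0 < M)%N).
Notation cell := {ffun 'I_K -> 'I_n}.
Notation subcell := {ffun 'I_K -> 'I_M}.
Variable e : R.
Hypothesis e0 : 0 <= e.

Let IM0 : (0 < #|subcell|)%N. Proof. by apply: card_ffun_gt0; rewrite card_ord. Qed.

Definition grid_value (c : cell) (d : subcell) : R := f (grid_point R c d).

Lemma grid_value_osc c d : modulus f n%:R^-1 e ->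
  `|grid_value c d - cell_mean grid_value c| <= e.
Proof.
move=> fe; rewrite -[X in X - _](avg_cst _ IM0) -avgB; apply: norm_avg_le_cst => // d'.
by apply: fe => [||k]; [exact: grid_point_in|exact: grid_point_in|exact: grid_point_cell].
Qed.

Lemma cell_mean_close z : in_cube z -> modulus f n%:R^-1 e ->
  `|f z - cell_mean grid_value (cell_of n0 z)| <= e.
Proof.
move=> hz fe; rewrite -[X in X - _](avg_cst _ IM0) -avgB; apply: norm_avg_le_cst => // d'.
by apply: fe => // [|k]; [exact: grid_point_in|exact: grid_point_cell_of].
Qed.

Lemma cell_mean_modulus (q : nat) (c c' : cell) : modulus f (q%:R / n%:R) e ->
  (forall k, (c k <= c' k + q)%N && (c' k <= c k + q)%N) ->
  `|cell_mean grid_value c - cell_mean grid_value c'| <= e.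
Proof.
move=> fe cc'; rewrite -avgB; apply: norm_avg_le_cst => // d.
by apply: fe => [||k]; [exact: grid_point_in|exact: grid_point_in|exact: grid_point_shift].
Qed.

Lemma cell_mean_bound (B : R) c : 0 <= B -> (forall x, in_cube x -> `|f x| <= B) ->
  `|cell_mean grid_value c| <= B.
Proof. by move=> B0 fB; apply: norm_avg_le_cst => // d; apply: fB; exact: grid_point_in. Qed.

(** The error is governed by the fine mesh 1/(nM) instead of the cell side 1/n: since it gets
    multiplied by the square root of [N], it must be made small by refining [M] for fixed [n]. *)
Lemma cube_int_grid : modulus f (n * M)%:R^-1 e ->
  `|cube_int f - avg (cell_mean grid_value)| <= e.
Proof.
move=> fe; rewrite (avg_fine_grid n0 M0 f).
have nM0 : (0 < n * M)%N by rewrite muln_gt0 n0.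
apply: (cube_int_step (n0 := nM0)) => z hz.
have nMR : 0 < (n * M)%:R :> R by rewrite ltr0n.
apply: fe => // k; rewrite ?mxE; first by rewrite divr_ge0//= ltr_pdivrMr// mul1r ltr_nat.
have := bucketP nM0 (hz k); rewrite ffunE -natr1 mulrDl mul1r => /andP[? ?].
by rewrite ler_norml; apply/andP; split; lra.
Qed.

End cell_averages.

(** * Law of the discretized randomization *)

Section finite_law.
Variables (d : measure_display) (T : measurableType d) (R : realType).
Variables (P : probability T R) (S : finType) (X : T -> S).
Hypothesis XU : uniform_fin P X.
Local Open Scope classical_set_scope.

Let law_seq (r : seq S) : uniq r ->
  measurable [set w | X w \in r] /\
  P [set w | X w \in r] = ((size r)%:R / #|S|%:R)%:E.
Proof.
elim: r => [_|s r IH /= /andP[sr /IH [mr Pr]]].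
  rewrite (_ : [set w | _] = set0); last by apply/seteqP; split.
  by rewrite measure0 mul0r.
have [ms Ps] := XU s.
have -> : [set w | X w \in s :: r] = X @^-1` [set s] `|` [set w | X w \in r].
  apply/seteqP; split=> w /=; rewrite seq.in_cons.
    by case/orP => [/eqP ->|]; [left|right].
  by case=> [->|->]; rewrite ?eqxx ?orbT.
split; first exact: measurableU.
rewrite measureU//; last first.
  by apply/seteqP; split=> // w [/= -> ]; rewrite (negbTE sr).
rewrite [X in (X + _)%E]Ps [X in (_ + X)%E]Pr -EFinD /= -natr1 mulrDl mul1r.
by rewrite addrC.
Qed.

Lemma uniform_fin_measurable (Q : pred S) : measurable [set w | Q (X w)].
Proof.
have [m _] := law_seq (enum_uniq Q); congr (measurable _): m.
by apply/seteqP; split=> w /=; rewrite mem_enum.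
Qed.

Lemma uniform_fin_law (Q : pred S) :
  P [set w | Q (X w)] = (avg (fun s => (Q s)%:R : R))%:E.
Proof.
have [_] := law_seq (enum_uniq Q); rewrite -cardE -avg_indicator => <-; congr (P _).
by apply/seteqP; split=> w /=; rewrite mem_enum.
Qed.

Lemma uniform_fin_measurable_fun (g : S -> R) : measurable_fun setT (fun w => g (X w)).
Proof.
move=> _ B _; rewrite setTI.
rewrite (_ : _ @^-1` B = [set w | (fun s => g s \in B) (X w)]).
  exact: (uniform_fin_measurable (fun s => g s \in B)).
by apply/seteqP; split=> w /=; rewrite inE.
Qed.

End finite_law.

Section discretization.
Variables (d : measure_display) (T : measurableType d) (R : realType).
Variables (P : probability T R) (N K n M : nat).
Hypothesis M0 : (0 < M)%N.
Variables (gam : T -> 'S_N) (p : 'I_K -> T -> 'S_n) (eta : 'I_N -> 'I_K -> T -> R).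
Hypothesis Hrand : randomization P gam p eta.
Local Open Scope classical_set_scope.
Notation perms := {ffun 'I_K -> 'S_n}.
Notation noise := {ffun 'I_N * 'I_K -> 'I_M}.

Definition discretized (w : T) : 'S_N * perms * noise :=
  ((gam w, [ffun k => p k w]), [ffun x => bucket M0 (eta x.1 x.2 w)]).

(** An outcome amounts to one event per source of randomness, so independence gives it the product
    of the marginal probabilities, the reciprocal of the cardinality. *)
Lemma discretized_uniform : uniform_fin P discretized.
Proof.
case: Hrand => gamU pU etaU indep [[s q] e].
pose E (i : unit + 'I_K + 'I_N * 'I_K) : set T := match i with
  | inl (inl _) => gam @^-1` [set s]
  | inl (inr k) => p k @^-1` [set q k]
  | inr x => eta x.1 x.2 @^-1` `[(e x)%:R / M%:R, (e x).+1%:R / M%:R[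
  end.
have mE i : measurable (E i).
  case: i => [[_|k]|[i k]] /=; first by have [] := gamU s.
    by have [] := pU k (q k).
  by have [m _ _] := etaU i k; rewrite -[X in measurable X]setTI; exact: m.
have PE i : P (E i) = (match i with
    | inl (inl _) => #|'S_N|%:R^-1 | inl (inr _) => #|'S_n|%:R^-1 | inr _ => M%:R^-1
    end : R)%:E.
  case: i => [[_|k]|[i k]] /=; first by have [] := gamU s.
    by have [] := pU k (q k).
  by have [_ _ ->//] := etaU i k; exact: uniform_prob_bucket.
have EE : discretized @^-1` [set (s, q, e)] =
    \bigcap_(i in [set` [set: unit + 'I_K + 'I_N * 'I_K]%SET]) E i.
  apply/seteqP; split=> w /=.
    case=> gw qw ew [[_|k]|[i k]] _ //=; first by rewrite -qw ffunE.
    rewrite in_itv/= -ew ffunE; apply: bucketP.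
    by have [_ ->] := etaU i k.
  move=> wE; have {}wE i : E i w by apply: wE; rewrite /= finset.in_setT.
  congr (_, _, _); first exact: (wE (inl (inl tt))).
    by apply/ffunP => k; rewrite ffunE; exact: (wE (inl (inr k))).
  apply/ffunP => x; rewrite ffunE; apply: bucket_eq.
  by have := wE (inr x); rewrite /= in_itv.
split.
  by rewrite EE; apply: fin_bigcap_measurable => // i _; exact: finite_finset.
rewrite EE indep; last first.
  move=> [[_|k]|[i k]] _ /=.
  - by exists [set s] => //; rewrite setTI.
  - by exists [set q k] => //; rewrite setTI.
  - by exists `[(e (i, k))%:R / M%:R, (e (i, k)).+1%:R / M%:R[ => //; rewrite setTI.
under eq_bigl do rewrite finset.in_setT.
rewrite (eq_bigr _ (fun i _ => PE i)) prodEFin; congr (_%:E).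
rewrite !big_sumType /= (bigD1 tt)//= [X in _ * X * _ * _]big1 ?mulr1; last by case.
rewrite !prodr_const !card_prod !card_ffun !card_prod !card_ord.
by rewrite !natrM !natrX !invfM -!exprVn.
Qed.

End discretization.

(** * The central limit theorem *)

Lemma cube_int_ge0 (R : realType) (K : nat) (g : 'rV[R]_K -> R) :
  (forall x, 0 <= g x) -> 0 <= cube_int g.
Proof.
by move=> g0; rewrite fine_ge0// integral_ge0// => t _; rewrite lee_fin.
Qed.

Lemma iid_error_ge0 (R : realType) (K : nat) (B : R) : 0 <= iid_error K B.
Proof.
rewrite /iid_error mulr_ge0//.
have p4 : 0 <= (2 * B) ^+ 4 by rewrite exprn_even_ge0.
by rewrite !addr_ge0 ?sqrtr_ge0 ?sqr_ge0// mulr_ge0// mulr_ge0// addr_ge0// mulr_ge0.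
Qed.

(** * The quantitative theorem for a single array *)

Section finite_clt.
Variables (R : realType) (N K n M h : nat) (H : 'M['I_n]_(N, K)).
Hypotheses (N0 : (0 < N)%N) (n1 : (1 < n)%N) (M0 : (0 < M)%N).
Hypotheses (h0 : (0 < h)%N) (hK : (h <= K)%N).
Hypotheses (HOA : is_OA h H) (Hfree : coincidence_free h H).
Variables (f : 'rV[R]_K -> R) (B k : R) (q : nat).
Hypotheses (B0 : 0 <= B) (fB : forall x, in_cube x -> `|f x| <= B).
Hypotheses (k0 : 0 < k) (k1 : k <= 1) (q0 : (0 < q)%N).
Hypotheses (f_cell : modulus f n%:R^-1 k) (f_q : modulus f (q%:R / n%:R) k).
Hypotheses (nq : n%:R / q%:R ^+ 2 <= k) (crowded : crowding R N n h <= k).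

Let n0 : (0 < n)%N. Proof. exact: ltnW. Qed.
Let A : R := anova_factor R K ^+ K.+2.
Let G : R := A * B.

(** The summands come from the noise inside the cells, the coupling, the Lindeberg replacement and
    the passage from the discrete variance to that of the remainder of [f]. As [k <= 1], errors of
    order [k] are absorbed into its square root. *)
Definition finite_const : R := 1 +
  Num.sqrt (2 * G * (A + 2 * G * (K%:R * 2)) + 3 * (8 ^+ K * G * G)) +
  iid_error K G + 2 * A * (2 * G + 2 * A).

Let A0 : 0 <= A. Proof. by rewrite exprn_ge0// addr_ge0// exprn_ge0. Qed.
Let G0 : 0 <= G. Proof. exact: mulr_ge0. Qed.

Lemma finite_clt (y t0 : R) : 0 < t0 ->
  `|avg (fun t : 'S_N * {ffun 'I_K -> 'S_n} * {ffun 'I_N * 'I_K -> 'I_M} =>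
        heat y t0 (noisy_sum H (grid_value f) t.1.1 t.1.2 t.2)) -
    heat y (t0 + cube_int (fun x => anova_remainder f h x ^+ 2)) 0| <=
  heat_const t0 * finite_const * Num.sqrt k.
Proof.
move=> t00; set C := heat_const t0; have C0 : 0 <= C := heat_const_ge0 t00.
set F := cell_mean (@grid_value R K n M f); pose g := dremainder F h.
set s := Num.sqrt k; have s0 : 0 <= s by exact: sqrtr_ge0.
have ss : s * s = k by rewrite -expr2 sqr_sqrtr// ltW.
have kk : k <= s.
  have s1 : s <= 1 by rewrite -(sqrtr1 R) ler_wsqrtr.
  by rewrite -ss ler_piMr.
have g_deg : degenerate h g := dremainder_degenerate n0 F (h:=h).
have FB c : `|F c| <= B by apply: cell_mean_bound.
have gB c : `|g c| <= G by exact: dremainder_bound.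
have g_mod (c c' : {ffun 'I_K -> 'I_n}) : (forall k, (c k <= c' k + q)%N && (c' k <= c k + q)%N) ->
    `|g c - g c'| <= A * k.
  by apply: dremainder_modulus => [|c1 c2]; [exact: ltW|apply: cell_mean_modulus => //; exact: ltW].
have lip (a b : R) : `|heat y t0 a - heat y t0 b| <= C * `|a - b|.
  exact: heat_lipschitz_space.
have osc c (e : {ffun 'I_K -> 'I_M}) : `|grid_value f c e - F c| <= k.
  by apply: grid_value_osc => //; exact: ltW.
have T1 := noise_smoothing H N0 M0 (ltW k0) osc C0 lip.
have T2 := perm_label_coupling N0 n1 HOA Hfree g_deg G0 gB q0 (mulr_ge0 A0 (ltW k0)) g_mod C0 lip.
have T3 := iid_lindeberg N0 n0 h0 hK HOA Hfree g_deg G0 gB C0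
  (fun t x e => heat_space t00 y x e) (fun t x v => heat_time t00 y x (v:=v))
  (fun t t' x => heat_lipschitz_time t00 y x) (le_trans crowded k1) (lexx t0).
have T4 : `|heat y (t0 + avg (fun c => g c ^+ 2)) 0 -
    heat y (t0 + cube_int (fun x => anova_remainder f h x ^+ 2)) 0| <= 
    C * (2 * A * (2 * G + 2 * A) * s).
  apply: le_trans (heat_lipschitz_time t00 _ _ _ _) _.
  - by rewrite lerDl avg_ge0// => c; rewrite sqr_ge0.
  - by rewrite lerDl cube_int_ge0// => x; rewrite sqr_ge0.
  rewrite ler_wpM2l// [leLHS](_ : _ = `|cube_int (fun x => anova_remainder f h x ^+ 2) -
      avg (fun c => g c ^+ 2)|); last first.
    by rewrite distrC; congr (`|_|); ring.
  have close z : in_cube z -> `|f z - F (cell_of n0 z)| <= k.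
    by move=> zc; apply: cell_mean_close => //; exact: ltW.
  apply: le_trans (variance_close (ltW k0) close gB) _.
  rewrite -/A -mulrA [_ * (_ * _)](_ : _ = 2 * A * (2 * G + 2 * (A * k)) * k); last by ring.
  have AK : 0 <= 2 * G + 2 * (A * k).
    by apply: addr_ge0; apply: mulr_ge0 => //; apply: mulr_ge0 => //; exact: ltW.
  rewrite ler_pM //; [|exact: ltW|].
    by apply: mulr_ge0 => //; apply: mulr_ge0.
  apply: ler_wpM2l; first exact: mulr_ge0.
  by rewrite lerD2l ler_wpM2l// ler_piMr.
(* Noise smoothing leads to the centred cell means; strength [h] puts their remainder [g] in their
   place, as the coupling requires. *)
have E : avg (fun p => heat y t0 (perm_sum H (fun c => F c - avg F) p)) =
    avg (fun p => heat y t0 (perm_sum H g p)).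
  by apply: eq_avg => p; rewrite perm_sum_dremainder.
rewrite {}E in T1.
set c2 := 2 * G * (A + 2 * G * (K%:R * 2)) + 3 * (8 ^+ K * G * G).
have T2' : Num.sqrt (coupling_error N K n h G (A * k) q) <= Num.sqrt c2 * s.
  have G2 : 0 <= 2 * G by exact: mulr_ge0.
  have E0 : 0 <= 8 ^+ K * G * G by apply: mulr_ge0 => //; apply: mulr_ge0 => //; exact: exprn_ge0.
  have K0 : 0 <= 2 * G * (K%:R * 2) by apply: mulr_ge0 => //; exact: mulr_ge0.
  have c20 : 0 <= c2.
    by apply: addr_ge0; apply: mulr_ge0 => //; exact: addr_ge0.
  rewrite -sqrtrM//; apply: ler_wsqrtr; rewrite /coupling_error [leRHS]mulrDl.
  apply: lerD; last by rewrite -[leRHS]mulrA; apply: ler_wpM2l => //; apply: ler_wpM2l.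
  rewrite -[leRHS]mulrA; apply: ler_wpM2l => //; rewrite [leRHS]mulrDl lerD2l -[leRHS]mulrA.
  apply: ler_wpM2l => //; rewrite -[leRHS]mulrA; apply: ler_wpM2l => //.
  exact: ler_wpM2l.
have T3' : Num.sqrt (crowding R N n h) <= s by exact: ler_wsqrtr.
have I0 : 0 <= iid_error K G by exact: iid_error_ge0.
have T12 := le_trans (ler_distD _ _ _) (lerD T1 T2).
have T123 := le_trans (ler_distD _ _ _) (lerD T12 T3).
apply: le_trans (le_trans (ler_distD _ _ _) (lerD T123 T4)) _.
have -> : C * finite_const * s = C * s + C * (Num.sqrt c2 * s) +
    C * iid_error K G * s + C * (2 * A * (2 * G + 2 * A) * s).
  rewrite /finite_const -/c2; move: (Num.sqrt c2) (iid_error K G) => a b.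
  by move: A G => A' G'; ring.
rewrite lerD2r; apply: lerD; first by apply: lerD; apply: ler_wpM2l.
by apply: ler_wpM2l => //; exact: mulr_ge0.
Qed.

End finite_clt.

(** * The statistic and its discretization *)

Section statistic.
Local Open Scope classical_set_scope.
Variables (R : realType) (N K n : nat) (H : 'M['I_n]_(N, K)).
Hypotheses (N0 : (0 < N)%N) (n0 : (0 < n)%N).
Variable f : 'rV[R]_K -> R.

Lemma modulus_le (d d' e : R) : d' <= d -> modulus f d e -> modulus f d' e.
Proof. by move=> dd fd x y xc yc xy; apply: fd => // k; exact: le_trans (xy k) dd. Qed.

Lemma fine_grid (d : R) : 0 < d -> exists2 M0 : nat, (0 < M0)%N &
  forall M, (M0 <= M)%N -> (n * M)%:R^-1 <= d.
Proof.
move=> d0; exists (Num.truncn d^-1).+1 => // M M0M.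
have M_gt0 : 0 < M%:R :> R by rewrite ltr0n; exact: leq_trans M0M.
rewrite -[leRHS]invrK lef_pV2 ?posrE ?invr_gt0// ?ltr0n ?muln_gt0 ?n0//; last first.
  by rewrite -(ltr0n R).
rewrite natrM; have dM : d^-1 <= M%:R.
  by rewrite (le_trans (ltW (truncnS_gt _)))// ler_nat.
by apply: le_trans dM _; rewrite ler_peMl ?ler1n// ltW.
Qed.

Lemma rOA_point_in s p (eta : 'I_N -> 'I_K -> R) i : (forall i k, 0 <= eta i k < 1) ->
  in_cube (rOA_point H s p eta i).
Proof.
move=> eta01 k; have /andP[e0 e1] := eta01 i k.
rewrite mxE -mulrDl divr_ge0 ?addr_ge0//= ltr_pdivrMr ?ltr0n// mul1r.
set a : 'I_n := p k _; apply: (@lt_le_trans _ _ (a%:R + 1)); first by rewrite ltrD2l.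
by rewrite natr1 ler_nat.
Qed.

Definition scaled_error s p eta : R :=
  Num.sqrt N%:R * (rOA_mean f H s p eta - cube_int f).

(** A deterministic bound: one [e] is for moving each sample point to the grid, the other for
    replacing [cube_int f] by the grid mean. *)
Lemma scaled_error_close M (M0 : (0 < M)%N) e s p (eta : 'I_N -> 'I_K -> R) :
  (forall i k, 0 <= eta i k < 1) -> modulus f (n * M)%:R^-1 e ->
  `|scaled_error s p eta - noisy_sum H (grid_value f) s [ffun k => p k]
      [ffun x : 'I_N * 'I_K => bucket M0 (eta x.1 x.2)]| <=
  Num.sqrt N%:R * (2 * e).
Proof.
move=> eta01 fe.
have NR : 0 < N%:R :> R by rewrite ltr0n.
have sN : 0 < Num.sqrt N%:R :> R by rewrite sqrtr_gt0.
have sNE : N%:R = Num.sqrt N%:R * Num.sqrt N%:R :> R by rewrite -expr2 sqr_sqrtr// ltW.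
set a := fun i => f (rOA_point H s p eta i) - cube_int f.
have -> : scaled_error s p eta = (Num.sqrt N%:R)^-1 * \sum_i a i.
  rewrite /scaled_error /rOA_mean /a sumrB sumr_const card_ord -[cube_int f *+ N]mulr_natl.
  set S := \sum_i _; move: (Num.sqrt N%:R) sN sNE => q q0 ->.
  by field; rewrite gt_eqF.
rewrite /noisy_sum -mulrBr normrM gtr0_norm ?invr_gt0// ler_pdivrMl// mulrA -sNE.
rewrite -sumrB (le_trans (ler_norm_sum _ _ _))//.
apply: (@le_trans _ _ (\sum_(i < N) 2 * e)); last first.
  by rewrite sumr_const card_ord [leRHS]mulr_natl.
apply: ler_sum => i _; rewrite /a opprD opprK addrACA [2 * e]mulr_natl mulr2n.
apply: le_trans (ler_normD _ _) _; rewrite lerD//; last first.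
  by rewrite addrC distrC; exact: cube_int_grid.
apply: fe => [||k]; [exact: rOA_point_in|exact: grid_point_in|].
rewrite !mxE !ffunE; exact: grid_point_eta.
Qed.

End statistic.

Section law.
Local Open Scope classical_set_scope.
Variables (R : realType) (N K n h : nat) (H : 'M['I_n]_(N, K)).
Hypotheses (N0 : (0 < N)%N) (n1 : (1 < n)%N) (h0 : (0 < h)%N) (hK : (h <= K)%N).
Hypotheses (HOA : is_OA h H) (Hfree : coincidence_free h H).
Variables (f : 'rV[R]_K -> R).
Hypothesis fcont : {within [set x : 'rV[R]_K | forall k, 0 <= x ord0 k <= 1],
              continuous f}.
Variables (d : measure_display) (T : measurableType d) (P : probability T R).
Variables (gam : T -> 'S_N) (p : 'I_K -> T -> 'S_n) (eta : 'I_N -> 'I_K -> T -> R).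
Hypothesis Hrand : randomization P gam p eta.

Let n0 : (0 < n)%N. Proof. exact: ltnW. Qed.

Let W w := scaled_error H f (gam w) (fun k => p k w) (fun i k => eta i k w).

Let eta01 w i k : 0 <= eta i k w < 1.
Proof. by case: Hrand => _ _ /(_ i k)[_ + _] _. Qed.

Let V M (t : 'S_N * {ffun 'I_K -> 'S_n} * {ffun 'I_N * 'I_K -> 'I_M}) : R :=
  noisy_sum H (grid_value f) t.1.1 t.1.2 t.2.

Let discretization_error e : 0 < e -> exists2 M0 : nat, (0 < M0)%N &
  forall M (M1 : (0 < M)%N), (M0 <= M)%N -> forall w,
    `|W w - V (discretized M1 gam p eta w)| <= e.
Proof.
move=> e0; have sN : 0 < Num.sqrt N%:R :> R by rewrite sqrtr_gt0 ltr0n.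
have e'0 : 0 < e / (Num.sqrt N%:R * 2) by rewrite divr_gt0// mulr_gt0.
have [dl dl0 fdl] := uniform_continuity fcont e'0.
have [M0 M00 fineM] := fine_grid n0 dl0; exists M0 => // M M1 M0M w.
rewrite (le_trans (scaled_error_close H N0 n0 M1 (gam w) (fun k => p k w)
  (eta := fun i k => eta i k w) (@eta01 w) (modulus_le (fineM _ M0M) fdl)))//.
rewrite le_eqVlt; apply/orP; left; apply/eqP.
by field; rewrite gt_eqF.
Qed.

(** The statistic is the pointwise limit of functions of its discretizations, which take finitely
    many values. *)
Lemma measurable_scaled_error : measurable_fun setT W.
Proof.
apply: (@measurable_realfun.measurable_fun_cvg _ _ _ _
  (fun j w => V (discretized (ltn0Sn j) gam p eta w))) => [j|w _].
  exact: (uniform_fin_measurable_fun (discretized_uniform (ltn0Sn j) Hrand)).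
apply/cvgrPdist_le => e /discretization_error[M0 _ close].
by exists M0 => // j /= M0j; apply: close; exact: leqW.
Qed.

Lemma measurable_scaled_error_le (x : R) : measurable [set w | W w <= x].
Proof.
rewrite -[X in measurable X]setTI -[X in _ `&` X](_ : W @^-1` `]-oo, x] = _).
  exact: measurable_scaled_error.
by apply/seteqP; split=> w /=; rewrite in_itv.
Qed.

Variables (B k : R) (q : nat).
Hypotheses (B0 : 0 <= B) (fB : forall x, in_cube x -> `|f x| <= B).
Hypotheses (k0 : 0 < k) (k1 : k <= 1) (q0 : (0 < q)%N).
Hypotheses (f_cell : modulus f n%:R^-1 k) (f_q : modulus f (q%:R / n%:R) k).
Hypotheses (nq : n%:R / q%:R ^+ 2 <= k) (crowded : crowding R N n h <= k).

Let v := cube_int (fun x => anova_remainder f h x ^+ 2).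

Variables (dl tau e : R).
Hypotheses (dl0 : 0 < dl) (tau0 : 0 < tau).
Hypotheses (Phi_upper : 1 - e <= normal_cdf 1 (dl / Num.sqrt tau)).
Hypotheses (Phi_lower : normal_cdf 1 (- (dl / Num.sqrt tau)) <= e).

Let e0 : 0 <= e.
Proof. exact: le_trans (normal_cdf_ge0 _ _) Phi_lower. Qed.

Let card_sample M : (0 < M)%N ->
  (0 < #|{: 'S_N * {ffun 'I_K -> 'S_n} * {ffun 'I_N * 'I_K -> 'I_M}}|)%N.
Proof.
move=> M0; apply/card_gt0P; exists (1%g, [ffun=> 1%g], [ffun=> Ordinal M0]).
by [].
Qed.

Let err := heat_const tau * finite_const K B * Num.sqrt k.

(** One shift by [dl] pays for the discretization, the other for the smoothing: if V <= x + dl, then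
    V plus a centred Gaussian of variance [tau] is at most x + 2 dl with probability at least 1 -
    e. *)
Lemma scaled_error_cdf_upper (x : R) :
  (P [set w | (W w <= x)%R] <= (heat (x + 2 * dl) (tau + v) 0 + err + e)%:E)%E.
Proof.
have [M M0 /(_ M M0 (leqnn M)) close] := discretization_error dl0.
have XU := discretized_uniform M0 Hrand.
pose Q (t : 'S_N * {ffun 'I_K -> 'S_n} * {ffun 'I_N * 'I_K -> 'I_M}) := V t <= x + dl.
apply: (@le_trans _ _ (P [set w | Q (discretized M0 gam p eta w)])).
  apply: le_measure; rewrite ?inE; [exact: measurable_scaled_error_le|exact: uniform_fin_measurable XU Q|].
  move=> w /=; rewrite /Q; have := close w; rewrite ler_norml => /andP[]; lra.
rewrite (uniform_fin_law XU Q) lee_fin.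
have clt := finite_clt N0 n1 M0 h0 hK HOA Hfree B0 fB k0 k1 q0 f_cell f_q nq crowded
  (x + 2 * dl) tau0.
move: clt; rewrite ler_norml -/err -/v => /andP[_].
set a := avg _ => clt.
have : avg (fun t => (Q t)%:R : R) <= a + e.
  rewrite -[e in leRHS](avg_cst e (card_sample M0)) -avgD; apply: ler_avg => t.
  rewrite /Q; case: (leP (V t) (x + dl)) => [Vx|_]; last first.
    apply: addr_ge0 => //. exact: normal_cdf_ge0.
  rewrite -lerBlDr (le_trans Phi_upper)//; apply: normal_cdf_nondecreasing.
  rewrite ler_wpM2r ?invr_ge0 ?sqrtr_ge0//; rewrite /V in Vx; lra.
lra.
Qed.

Lemma scaled_error_cdf_lower (x : R) :
  ((heat (x - 2 * dl) (tau + v) 0 - err - e)%:E <= P [set w | (W w <= x)%R])%E.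
Proof.
have [M M0 /(_ M M0 (leqnn M)) close] := discretization_error dl0.
have XU := discretized_uniform M0 Hrand.
pose Q (t : 'S_N * {ffun 'I_K -> 'S_n} * {ffun 'I_N * 'I_K -> 'I_M}) := V t <= x - dl.
apply: (@le_trans _ _ (P [set w | Q (discretized M0 gam p eta w)])); last first.
  apply: le_measure; rewrite ?inE; [exact: uniform_fin_measurable XU Q|exact: measurable_scaled_error_le|].
  move=> w /=; rewrite /Q; have := close w; rewrite ler_norml => /andP[]; lra.
rewrite (uniform_fin_law XU Q) lee_fin.
have clt := finite_clt N0 n1 M0 h0 hK HOA Hfree B0 fB k0 k1 q0 f_cell f_q nq crowded
  (x - 2 * dl) tau0.
move: clt; rewrite ler_norml -/err -/v => /andP[+ _].
set a := avg _ => clt.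
have : a <= avg (fun t => (Q t)%:R : R) + e.
  rewrite -[e in leRHS](avg_cst e (card_sample M0)) -avgD; apply: ler_avg => t.
  rewrite /Q; case: (leP (V t) (x - dl)) => [_|Vx].
    by rewrite (le_trans (normal_cdf_le1 _ _))// lerDl.
  rewrite add0r (le_trans _ Phi_lower)//; apply: normal_cdf_nondecreasing.
  rewrite -[leRHS]mulNr ler_wpM2r ?invr_ge0 ?sqrtr_ge0//; rewrite /V in Vx; lra.
lra.
Qed.

End law.

(** * Comparison with the limit distribution *)

Section limit_law.
Local Open Scope classical_set_scope.
Variable R : realType.

Definition limit_cdf (v t : R) : R := if v == 0 then (0 <= t)%R%:R else heat t v 0.

Lemma limit_cdfE (v t : R) : 0 <= v ->
  normal_law 0 v `]-oo, t]%classic = (limit_cdf v t)%:E.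
Proof.
move=> v0; rewrite /normal_law /limit_cdf; case: eqVneq => [_|vN0].
  by rewrite diracE; congr (_%:R)%:E; rewrite mem_setE in_itv.
rewrite -normal_cdfE normal_cdf_scale; first by rewrite /heat subr0.
by rewrite sqrtr_gt0 lt_neqAle eq_sym vN0.
Qed.

Lemma limit_cdf_nondecreasing (v s t : R) : s <= t -> limit_cdf v s <= limit_cdf v t.
Proof.
move=> st; rewrite /limit_cdf; case: ifP => _.
  by case: (leP 0 s) => [s0|]; [rewrite (le_trans s0 st)|rewrite ler_nat].
by apply: normal_cdf_nondecreasing; rewrite ler_wpM2r ?invr_ge0 ?sqrtr_ge0// lerD2r.
Qed.

(** [tau] is so small that dl / sqrt tau passes the points where the normal distribution function
    comes within [e] of 1 and of 0. *)
Lemma smoothing_scale (dl e c : R) : 0 < dl -> 0 < e -> 0 < c ->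
  exists tau : R, [/\ 0 < tau, tau <= c,
    1 - e <= normal_cdf 1 (dl / Num.sqrt tau) &
    normal_cdf 1 (- (dl / Num.sqrt tau)) <= e].
Proof.
move=> dl0 e0 c0.
have [a ha] := normal_cdf_upper 1 e0; have [b hb] := normal_cdf_lower 1 e0.
pose z : R := 1 + `|a| + `|b|.
have z0 : 0 < z by rewrite /z -addrA ltr_pwDl// addr_ge0.
pose tau := Num.min c ((dl / z) ^+ 2).
have tau0 : 0 < tau by rewrite lt_min c0 exprn_gt0// divr_gt0.
have zd : z <= dl / Num.sqrt tau.
  rewrite ler_pdivlMr ?sqrtr_gt0// mulrC -ler_pdivlMr//.
  rewrite -[leRHS]ger0_norm ?divr_ge0// ?(ltW dl0) ?(ltW z0)// -sqrtr_sqr.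
  by rewrite ler_wsqrtr// ge_min lexx orbT.
have az : a <= z by rewrite /z; have := ler_norm a; have := normr_ge0 b; lra.
have bz : - z <= b.
  by rewrite /z; have := ler_norm (- b); rewrite normrN; have := normr_ge0 a; lra.
exists tau; split => //; first by rewrite ge_min lexx.
  by rewrite (le_trans ha)// normal_cdf_nondecreasing// (le_trans az).
by rewrite (le_trans _ hb)// normal_cdf_nondecreasing// (le_trans _ bz)// lerN2.
Qed.

(** For [v > 0] the extra time [tau] costs little by the Lipschitz bound in time; for [v = 0] the
    limit is a step, and the shift by [dl] absorbs its smoothing. *)
Lemma limit_sandwich (v dl e : R) : 0 <= v -> 0 < dl -> 0 < e ->
  exists tau : R, [/\ 0 < tau, 1 - e <= normal_cdf 1 (dl / Num.sqrt tau),
    normal_cdf 1 (- (dl / Num.sqrt tau)) <= e &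
    forall y, limit_cdf v (y - dl) - e <= heat y (tau + v) 0 <= limit_cdf v (y + dl) + e].
Proof.
move=> v0 dl0 e0; case: (eqVneq v 0) => [->|vN0].
  have [tau [tau0 _ hu hl]] := smoothing_scale dl0 e0 ltr01.
  exists tau; split => // y; rewrite addr0 /limit_cdf eqxx /heat subr0.
  have s0 : 0 < (Num.sqrt tau)^-1 by rewrite invr_gt0 sqrtr_gt0.
  apply/andP; split.
    case: (leP 0 (y - dl)) => [ydl|_]; last first.
      by rewrite sub0r (le_trans _ (normal_cdf_ge0 _ _))// oppr_le0 ltW.
    rewrite (le_trans hu)// normal_cdf_nondecreasing// ler_pM2r//; lra.
  case: (leP 0 (y + dl)) => [_|ydl].
    by rewrite (le_trans (normal_cdf_le1 _ _))// lerDl ltW.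
  rewrite add0r (le_trans _ hl)// normal_cdf_nondecreasing// -[leRHS]mulNr ler_pM2r//; lra.
have {}v0 : 0 < v by rewrite lt_neqAle eq_sym vN0.
pose C := heat_const v + 1; have C0 : 0 < C by rewrite ltr_wpDl// heat_const_ge0.
have [tau [tau0 tauC hu hl]] := smoothing_scale dl0 e0 (divr_gt0 e0 C0).
exists tau; split => // y.
have close : `|heat y (tau + v) 0 - limit_cdf v y| <= e.
  rewrite /limit_cdf (negbTE vN0).
  rewrite (le_trans (heat_lipschitz_time v0 _ _ _ _))// ?lerDr ?(ltW tau0)//.
  rewrite addrK gtr0_norm// (@le_trans _ _ (C * tau))//.
    by rewrite ler_wpM2r ?(ltW tau0)// lerDl.
  by rewrite mulrC -ler_pdivlMr.
have ylo : limit_cdf v (y - dl) <= limit_cdf v y by apply: limit_cdf_nondecreasing; lra.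
have yhi : limit_cdf v y <= limit_cdf v (y + dl) by apply: limit_cdf_nondecreasing; lra.
by move: close; rewrite ler_norml => /andP[? ?]; apply/andP; split; lra.
Qed.

End limit_law.

Section asymptotics.
Local Open Scope classical_set_scope.
Variables (R : realType) (K h : nat) (f : 'rV[R]_K -> R).
Hypothesis fcont : {within [set x : 'rV[R]_K | forall k, 0 <= x ord0 k <= 1],
              continuous f}.
Variables (N n : nat -> nat).
Hypotheses (Noo : N m @[m --> \oo] --> \oo) (noo : n m @[m --> \oo] --> \oo).
Hypothesis (Hlam : (exists c : R, forall m, OA_index R (N m) (n m) h = c) \/
          (fun m => OA_index R (N m) (n m) h) =o_\oo (fun m => (n m)%:R : R)).

Lemma near_natr_ge (A : R) : \forall m \near \oo, A <= (n m)%:R.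
Proof.
have := noo => /cvgnyPge/(_ (Num.truncn A).+1); apply: filterS => m.
by rewrite -(ler_nat R); apply: le_trans; rewrite ltW// truncnS_gt.
Qed.

Lemma crowding_index N' n' : crowding R N' n' h = OA_index R N' n' h / n'%:R.
Proof. by rewrite /crowding /OA_index exprS invfM mulrA mulrAC. Qed.

Lemma near_crowding (k : R) : 0 < k ->
  \forall m \near \oo, crowding R (N m) (n m) h <= k.
Proof.
move=> k0; case: Hlam => [[c cE]|lam].
  have := near_natr_ge (Num.max 1 (c / k)); apply: filterS => m.
  rewrite ge_max => /andP[n1 ck]; rewrite crowding_index cE.
  by rewrite ler_pdivrMr ?(lt_le_trans ltr01)// mulrC -ler_pdivrMr.
have /eqoP/(_ k k0) small := lam.
have := near_natr_ge 1; move: small; apply: filterS2 => m + n1.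
have n0 : 0 < (n m)%:R :> R by exact: lt_le_trans ltr01 n1.
rewrite crowding_index ler_pdivrMr// (gtr0_norm n0).
by apply: le_trans; exact: ler_norm.
Qed.

(** [q] is the integer part of dl n: q/n stays below [dl] while n/q^2 is of order 1/n. Since dl n is
    at least 1, its integer part is at least half of it, whence the constant 4. *)
Lemma block_length (dl k : R) n' : 0 < dl -> 0 < k ->
  dl^-1 <= n'%:R -> 4 / (dl ^+ 2 * k) <= n'%:R ->
  exists q : nat, [/\ (0 < q)%N, q%:R / n'%:R <= dl & n'%:R / q%:R ^+ 2 <= k].
Proof.
move=> dl0 k0 ndl nk.
have n0 : 0 < n'%:R :> R by rewrite (lt_le_trans _ ndl)// invr_gt0.
have one : 1 <= dl * n'%:R by rewrite mulrC -ler_pdivrMr// div1r.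
exists (Num.truncn (dl * n'%:R)); set q := Num.truncn _.
have qle : q%:R <= dl * n'%:R by rewrite truncn_le// mulr_ge0// ltW.
have qgt : dl * n'%:R < q%:R + 1 by rewrite natr1 truncnS_gt.
have q0 : (0 < q)%N by rewrite truncn_gt0.
have q1 : 1 <= q%:R :> R by rewrite ler1n.
split => //; first by rewrite ler_pdivrMr.
have q2 : dl * n'%:R <= 2 * q%:R by lra.
have qq : 0 < q%:R :> R by rewrite ltr0n.
rewrite ler_pdivrMr ?exprn_gt0//.
move: nk; rewrite ler_pdivrMr ?mulr_gt0 ?exprn_gt0// => nk.
have s : (dl * n'%:R) ^+ 2 <= (2 * q%:R) ^+ 2 by rewrite ler_pXn2r ?nnegrE//; lra.
have a := ler_wpM2l (ltW n0) nk; have b := ler_wpM2r (ltW k0) s.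
nra.
Qed.

Lemma near_block_length (k : R) : 0 < k -> \forall m \near \oo,
  exists q : nat, [/\ (0 < q)%N, modulus f (n m)%:R^-1 k,
    modulus f (q%:R / (n m)%:R) k & (n m)%:R / q%:R ^+ 2 <= k].
Proof.
move=> k0; have [dl dl0 fdl] := uniform_continuity fcont k0.
have := near_natr_ge (Num.max (dl^-1) (4 / (dl ^+ 2 * k))); apply: filterS => m.
rewrite ge_max => /andP[ndl nk].
have [q [q0 qn nq]] := block_length dl0 k0 ndl nk; exists q; split => //.
  by apply: modulus_le fdl; rewrite -[leRHS]invrK lef_pV2// posrE ?invr_gt0// (lt_le_trans _ ndl) ?invr_gt0.
exact: modulus_le fdl.
Qed.

End asymptotics.

Local Open Scope classical_set_scope.
Local Open Scope ring_scope.

Theorem theorem3p5 (R : realType) (K h : nat) (hK : (1 <= h <= K)%N)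
  (f : 'rV[R]_K -> R)
  (fcont : {within [set x : 'rV[R]_K | forall k, 0 <= x ord0 k <= 1],
              continuous f})
  (N n : nat -> nat) (H : forall m, 'M['I_(n m)]_(N m, K))
  (HOA : forall m, is_OA h (H m))
  (Hfree : forall m, coincidence_free h (H m))
  (Noo : N m @[m --> \oo] --> \oo)
  (noo : n m @[m --> \oo] --> \oo)
  (Hlam : (exists c : R, forall m, OA_index R (N m) (n m) h = c) \/
          (fun m => OA_index R (N m) (n m) h) =o_\oo (fun m => (n m)%:R : R))
  (d : nat -> measure_display) (T : forall m, measurableType (d m))
  (P : forall m, probability (T m) R)
  (gam : forall m, T m -> 'S_(N m))
  (p : forall m, 'I_K -> T m -> 'S_(n m))
  (eta : forall m, 'I_(N m) -> 'I_K -> T m -> R)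
  (Hrand : forall m, randomization (P m) (@gam m) (@p m) (@eta m)) :
  cvg_in_distribution P
    (fun m w => Num.sqrt (N m)%:R *
       (rOA_mean f (H m) (gam m w) (fun k => p m k w) (fun i k => eta m i k w)
        - cube_int f))
    (normal_law 0 (cube_int (fun x => anova_remainder f h x ^+ 2))).
Proof.
move: hK => /andP[h0 hK].
set v := cube_int (fun x => anova_remainder f h x ^+ 2).
have v0 : 0 <= v by apply: cube_int_ge0 => x; rewrite sqr_ge0.
have [B B0 fB] := bounded_on_cube fcont.
move=> x xcont; move: (xcont : _ @ _ --> _); rewrite limit_cdfE// => {}xcont.
have [_ ccont] := (fine_cvgP _ _).1 xcont.
apply/fine_cvgP; split.
  near=> m; rewrite fin_num_measure//.
  by apply: (measurable_scaled_error_le (H m) _ _ fcont (Hrand m)); near: m;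
    [exact: (cvgnyPge _).1 Noo _|exact: (cvgnyPge _).1 noo _].
apply/cvgrPdist_le => e e0.
(* Three shifts by [dl] add up: discretization, smoothing of the indicator, and [limit_sandwich]. *)
have [dl dl0 dlP] : exists2 dl : R, 0 < dl & forall t, `|x - t| <= 3 * dl ->
    `|limit_cdf v x - limit_cdf v t| <= e / 2.
  have e20 : 0 < e / 2 by exact: divr_gt0.
  have /cvgrPdist_le/(_ _ e20)/nbhs_ballP[r r0 rP] := ccont.
  exists (r / 4) => [|t xt]; first exact: divr_gt0.
  have -> : limit_cdf v t = fine (normal_law 0 v `]-oo, t]) by rewrite limit_cdfE.
  apply: rP => /=; rewrite /ball/=; have : 0 < r := r0; lra.
(* Three errors of e/8, from the smoothing, from [limit_sandwich] and from the quantitative bound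
   through [k], join the e/2 of continuity. *)
have e80 : 0 < e / 8 by exact: divr_gt0.
have [tau [tau0 hu hl hP]] := limit_sandwich v0 dl0 e80.
set D := heat_const tau * finite_const K B.
pose k := Num.min 1 ((e / (8 * (`|D| + 1))) ^+ 2).
have D0 : 0 < 8 * (`|D| + 1) by rewrite mulr_gt0// ltr_wpDl.
have k0 : 0 < k by rewrite lt_min ltr01 exprn_gt0// divr_gt0.
have k1 : k <= 1 by rewrite ge_min lexx.
have Dk : D * Num.sqrt k <= e / 8.
  apply: (@le_trans _ _ ((`|D| + 1) * Num.sqrt k)).
    by rewrite ler_wpM2r ?sqrtr_ge0// (le_trans (ler_norm _))// lerDl.
  rewrite mulrC -ler_pdivlMr ?ltr_wpDl// -mulrA -invfM.
  rewrite -[leRHS]ger0_norm ?divr_ge0 ?(ltW e0) ?(ltW D0)// -sqrtr_sqr.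
  by rewrite ler_wsqrtr// ge_min lexx orbT.
near=> m.
have N0 : (0 < N m)%N by near: m; exact: (cvgnyPge _).1 Noo _.
have n1 : (1 < n m)%N by near: m; exact: (cvgnyPge _).1 noo _.
have crowded : crowding R (N m) (n m) h <= k by near: m; exact: near_crowding.
have [q [q0 fn fq nq]] : exists q : nat, [/\ (0 < q)%N, modulus f (n m)%:R^-1 k,
    modulus f (q%:R / (n m)%:R) k & (n m)%:R / q%:R ^+ 2 <= k].
  by near: m; exact: near_block_length.
have up := scaled_error_cdf_upper N0 n1 h0 hK (HOA m) (@Hfree m) fcont (Hrand m)
  B0 fB k0 k1 q0 fn fq nq crowded dl0 tau0 hu hl x.
have lo := scaled_error_cdf_lower N0 n1 h0 hK (HOA m) (@Hfree m) fcont (Hrand m)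
  B0 fB k0 k1 q0 fn fq nq crowded dl0 tau0 hl x.
rewrite -/v -/D in up lo.
have /andP[_ ub] := hP (x + 2 * dl); have /andP[lb _] := hP (x - 2 * dl).
move: up lo; rewrite /scaled_error /=.
case: (P m _) => [r| |]//; rewrite !lee_fin /= => up lo.
have := dlP (x + 2 * dl + dl); have := dlP (x - 2 * dl - dl).
have -> : x - (x - 2 * dl - dl) = 3 * dl by ring.
have -> : x - (x + 2 * dl + dl) = - (3 * dl) by ring.
rewrite normrN gtr0_norm ?mulr_gt0// => /(_ (lexx _)) + /(_ (lexx _)).
rewrite !ler_norml => /andP[c1 c2] /andP[c3 c4].
by apply/andP; split; lra.
Unshelve. all: by end_near.
Qed.
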